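(* Let $d\ge 2$ and let $\Omega_0\subset\Omega_1$ be two bounded open subsets of $\mathbb{R}^d$. Then there exists a family $(\Omega_t)_{t\in[0,1]}$ of open subsets of $\mathbb{R}^d$, whose members at $t=0$ and $t=1$ are the given sets $\Omega_0$ and $\Omega_1$ respectively, such that $$\Omega_s\subset\Omega_t\qquad\text{for every } s,t\in[0,1]\text{ with } s<t,$$ and such that the family is $\gamma$-continuous, i.e. for every $t\in[0,1]$ and every sequence $(t_n)$ in $[0,1]$ with $t_n\to t$, the sets $\Omega_{t_n}$ $\gamma$-converge to $\Omega_t$.
   Context: For a bounded open set $\Omega\subset\mathbb{R}^d$, functions in $H^1_0(\Omega)$ are considered extended by zero to $\mathbb{R}^d\setminus\Omega$, so that $H^1_0(\Omega)\subset H^1(\mathbb{R}^d)$. For $f\in L^2(\mathbb{R}^d)$ let $u_{\Omega,f}$ be the unique weak solution of $$-\Delta u=f\ \text{ in }\Omega,\qquad u\in H^1_0(\Omega),$$ that is, $u_{\Omega,f}\in H^1_0(\Omega)$ and $\int_\Omega\nabla u_{\Omega,f}\cdot\nabla\phi\,dx=\int_\Omega f\phi\,dx$ for all $\phi\in H^1_0(\Omega)$. Definition ($\gamma$-convergence). A sequence $(\Omega_n)$ of open sets, all contained in a fixed bounded open subset of $\mathbb{R}^d$, is said to $\gamma$-converge to an open set $\Omega$ contained in the same bounded open set if for every $f\in L^2(\mathbb{R}^d)$ the functions $u_{\Omega_n,f}$ converge to $u_{\Omega,f}$ weakly in $H^1(\mathbb{R}^d)$. *)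

(* Defs.v *)
From HB Require Import structures.
From mathcomp Require Import all_boot all_order all_algebra.
From mathcomp Require Import all_classical all_reals all_analysis.

Set Implicit Arguments.
Unset Strict Implicit.
Unset Printing Implicit Defensive.

Import Order.TTheory GRing.Theory Num.Theory.
Import numFieldNormedType.Exports.

Local Open Scope classical_set_scope.
Local Open Scope ring_scope.

(* The sigma-algebra generated by the coordinates, as on n.-tuple T; for T = R
   it is the Borel sigma-algebra of R^n. *)
Section measurable_rV.
Context {d} {T : measurableType d} {n : nat}.

Definition rV_coord (i : 'I_n) (x : 'rV[T]_n) : T := x ord0 i.

Let rV_set0 : g_sigma_preimage rV_coord set0.
Proof. exact: sigma_algebra0. Qed.

Let rV_setC A :
  g_sigma_preimage rV_coord A -> g_sigma_preimage rV_coord (~` A).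
Proof. exact: sigma_algebraC. Qed.

Let rV_bigcup (F : _^nat) : (forall i, g_sigma_preimage rV_coord (F i)) ->
  g_sigma_preimage rV_coord (\bigcup_i (F i)).
Proof. exact: sigma_algebra_bigcup. Qed.

HB.instance Definition _ := @isMeasurable.Build (measure_tuple_display d)
  'rV[T]_n (g_sigma_preimage rV_coord) rV_set0 rV_setC rV_bigcup.

Lemma measurable_rV_coord (i : 'I_n) :
  measurable_fun [set: 'rV[T]_n] (rV_coord i).
Proof.
move=> _ Y mY; rewrite setTI; apply: sub_sigma_algebra => /=.
rewrite -bigcup_seq/=; exists i => /=; first by rewrite mem_index_enum.
by exists Y => //; rewrite setTI.
Qed.

Lemma measurable_fun_rV d' (T' : measurableType d') (f : T' -> 'rV[T]_n) :
  (forall i, measurable_fun [set: T'] (rV_coord i \o f)) ->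
  measurable_fun [set: T'] f.
Proof.
move=> mf _ A mA; rewrite setTI.
have : image_set_system setT f measurable A; last first.
  by rewrite /image_set_system /= setTI.
move: A mA; apply: smallest_sub.
  exact: sigma_algebra_image (sigma_algebra_measurable T').
rewrite -bigcup_seq => B [i _ [C mC <-]].
rewrite /image_set_system /= !setTI.
by have := mf i measurableT C mC; rewrite setTI.
Qed.

End measurable_rV.

Section lebesgue_rV.
Context {R : realType}.
Local Open Scope ereal_scope.

Section step.
Context {n : nat}.

Definition rV_cons (p : measurableTypeR R * 'rV[R]_n) : 'rV[R]_n.+1 :=
  row_mx (p.1)%:M p.2 : 'rV_(1 + n).

Definition rV_uncons (x : 'rV[R]_n.+1) : measurableTypeR R * 'rV[R]_n :=
  (x ord0 ord0, rsubmx (x : 'rV_(1 + n))).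

Lemma rV_consE (p : R * 'rV[R]_n) (i : 'I_n.+1) :
  rV_cons p ord0 i = oapp (p.2 ord0) p.1 (unlift ord0 i).
Proof.
rewrite /rV_cons; case: unliftP => [j ->|->] /=.
  have -> : lift ord0 j = rshift 1 j :> 'I_(1 + n) by exact: val_inj.
  exact: (row_mxEr _ p.2).
have -> : ord0 = lshift n ord0 :> 'I_(1 + n) by exact: val_inj.
by rewrite [LHS](row_mxEl _ p.2) mxE mulr1n.
Qed.

Lemma rV_consK : cancel rV_cons rV_uncons.
Proof.
by move=> [a x]; rewrite /rV_uncons rV_consE unlift_none/= row_mxKr.
Qed.

Lemma measurable_rV_cons : measurable_fun setT rV_cons.
Proof.
apply: measurable_fun_rV => i; rewrite /comp /rV_coord.
under eq_fun do rewrite rV_consE.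
case: unliftP => [j _|_] /=; last exact: measurable_fst.
exact: (measurableT_comp (measurable_rV_coord j)).
Qed.

Lemma measurable_rV_uncons : measurable_fun setT rV_uncons.
Proof.
apply: measurable_fun_pair; first exact: measurable_rV_coord.
apply: measurable_fun_rV => i; rewrite /comp /rV_coord.
by under eq_fun do rewrite mxE; exact: measurable_rV_coord.
Qed.

HB.instance Definition _ := isMeasurableFun.Build _ _ _ _ rV_cons
  measurable_rV_cons.

Variable m : {sigma_finite_measure set 'rV[R]_n -> \bar R}.

(* The measure lebesgue_measure x m on R x R^n = R^(n+1) *)
Definition lebesgue_rV_cons : set 'rV[R]_n.+1 -> \bar R :=
  pushforward (lebesgue_measure \x m) rV_cons.

Let lebesgue_rV_cons0 : lebesgue_rV_cons set0 = 0.
Proof. by rewrite /lebesgue_rV_cons /pushforward preimage_set0 measure0. Qed.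

Let lebesgue_rV_cons_ge0 A : 0 <= lebesgue_rV_cons A.
Proof. exact: (measure_ge0 (pushforward (lebesgue_measure \x m) rV_cons)). Qed.

Let lebesgue_rV_cons_sigma_additive : semi_sigma_additive lebesgue_rV_cons.
Proof.
exact: (@measure_semi_sigma_additive _ _ _ (pushforward (lebesgue_measure \x m) rV_cons)).
Qed.

HB.instance Definition _ := isMeasure.Build _ _ _ lebesgue_rV_cons
  lebesgue_rV_cons0 lebesgue_rV_cons_ge0 lebesgue_rV_cons_sigma_additive.

Let lebesgue_rV_cons_sigma_finite : sigma_finite setT lebesgue_rV_cons.
Proof.
have /sigma_finiteP[F [TF ndF Foo]] := sigma_finiteT (@lebesgue_measure R).
have /sigma_finiteP[G [TG ndG Goo]] := sigma_finiteT m.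
exists (fun k => rV_uncons @^-1` (F k `*` G k)).
  apply/seteqP; split => // x _.
  have [k _ Fk] : (\bigcup_k F k) (rV_uncons x).1 by rewrite -TF.
  have [l _ Gl] : (\bigcup_k G k) (rV_uncons x).2 by rewrite -TG.
  exists (maxn k l) => //; split.
    by move: Fk; exact/subsetPset/ndF/leq_maxl.
  by move: Gl; exact/subsetPset/ndG/leq_maxr.
move=> k; have [mF Fk] := Foo k; have [mG Gk] := Goo k; split.
  rewrite -[X in measurable X]setTI; apply: measurable_rV_uncons => //.
  exact: measurableX.
rewrite /lebesgue_rV_cons /pushforward -comp_preimage.
rewrite (_ : _ \o _ = id); last by apply/funext => p; exact: rV_consK.
by rewrite product_measure1E// lte_mul_pinfty// ge0_fin_numE.
Qed.

HB.instance Definition _ := Measure_isSigmaFinite.Build _ _ _ lebesgue_rV_cons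
  lebesgue_rV_cons_sigma_finite.

End step.

(* Lebesgue measure on R^n as an iterated product of lebesgue_measure; by
   lebesgue_rV_box it is the measure giving boxes their volume. *)
Fixpoint lebesgue_rV (n : nat) :
    {sigma_finite_measure set 'rV[R]_n -> \bar R} :=
  match n with
  | 0%N => \d_(0%R : 'rV[R]_0)
  | n'.+1 => lebesgue_rV_cons (lebesgue_rV n')
  end.

Lemma lebesgue_rV_box n (A : 'I_n -> set R) : (forall i, measurable (A i)) ->
  lebesgue_rV n [set x | forall i, A i (x ord0 i)] =
  \prod_(i < n) lebesgue_measure (A i).
Proof.
elim: n A => [|n IH] A mA.
  by rewrite big_ord0 /= diracE mem_set// => -[].
have mS : measurable [set x : 'rV[R]_n | forall i, A (lift ord0 i) (x ord0 i)].
  have -> : [set x : 'rV[R]_n | forall i, A (lift ord0 i) (x ord0 i)] =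
      \bigcap_(i in [set: 'I_n]) (rV_coord i @^-1` A (lift ord0 i)).
    by apply/seteqP; split => x /= Ax i => [_|]; exact: Ax.
  apply: fin_bigcap_measurable => // i _.
  rewrite -[X in measurable X]setTI.
  exact: (measurable_rV_coord i measurableT (mA (lift ord0 i))).
rewrite big_ord_recl -(IH (fun i => A (lift ord0 i)))// -product_measure1E//=; last first.
  exact: mA.
rewrite /lebesgue_rV_cons /pushforward; congr product_measure1.
apply/seteqP; split => -[a x] /=.
  move=> Ax; split; first by have := Ax ord0; rewrite rV_consE unlift_none.
  by move=> i; have := Ax (lift ord0 i); rewrite rV_consE liftK.
by move=> [Aa Ax] i; rewrite rV_consE; case: unliftP => [j ->|->] /=.
Qed.

End lebesgue_rV.
Arguments lebesgue_rV {R} n.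

Section smooth.
Context {R : realType} {d : nat}.
Implicit Types (f : 'rV[R]_d -> R) (D : set 'rV[R]_d).

Definition pderiv (i : 'I_d) f : 'rV[R]_d -> R :=
  fun x => 'D_(delta_mx 0 i) f x.

Definition pderivs (s : seq 'I_d) f : 'rV[R]_d -> R := foldr pderiv f s.

Definition smooth f := forall s : seq 'I_d,
  continuous (pderivs s f) /\
  forall i x, derivable (pderivs s f) x (delta_mx 0 i).

(* C_c^oo(D) *)
Definition test_function D f :=
  [/\ smooth f, compact (closure [set x | f x != 0]) &
      closure [set x | f x != 0] `<=` D].

End smooth.

(* Elements of the function spaces are represented by functions R^d -> R, of
   which only the values on D matter; two of them are the same element when
   they agree almost everywhere on D. *)
Section sobolev.
Context {R : realType} {d : nat}.
Local Notation mu := (@lebesgue_rV R d).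
Implicit Types (D : set 'rV[R]_d) (u f : 'rV[R]_d -> R).

Definition L2 D : set ('rV[R]_d -> R) := [set f | f \_ D \in Lfun mu 2%:E].

Definition weak_gradient D u (g : 'I_d -> 'rV[R]_d -> R) := forall i,
  L2 D (g i) /\
  forall phi, test_function D phi ->
    \int[mu]_(x in D) (u x * pderiv i phi x) =
    - \int[mu]_(x in D) (g i x * phi x).

Definition H1 D : set ('rV[R]_d -> R) :=
  [set u | L2 D u /\ exists g, weak_gradient D u g].

(* The weak gradient in D of u in H^1(D), well defined almost everywhere in D. *)
Definition wgrad D u : 'I_d -> 'rV[R]_d -> R :=
  xget (fun _ _ => 0) [set g | weak_gradient D u g].

Definition H1norm D u : R :=
  Num.sqrt (\int[mu]_(x in D) (u x ^+ 2 + \sum_(i < d) wgrad D u i x ^+ 2)).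

(* The closure of C_c^oo(D) in H^1(D), extended by zero outside D. *)
Definition H10 D : set ('rV[R]_d -> R) :=
  [set u | [/\ H1 D u, forall x, ~ D x -> u x = 0 &
    forall e : R, 0 < e ->
      exists phi, test_function D phi /\ H1norm D (u \- phi) < e]].

Definition weak_solution D f u := H10 D u /\
  forall phi, H10 D phi ->
    \int[mu]_(x in D) (\sum_(i < d) wgrad D u i x * wgrad D phi i x) =
    \int[mu]_(x in D) (f x * phi x).

(* u_{D,f}, determined up to almost everywhere equality *)
Definition solution D f : 'rV[R]_d -> R :=
  xget (fun=> 0) [set u | weak_solution D f u].

(* Bounded linear functionals on H^1(R^d); boundedness forces L to depend on
   its argument only up to almost everywhere equality. *)
Definition H1_functional (L : ('rV[R]_d -> R) -> R) :=
  (forall (a : R) u v, H1 setT u -> H1 setT v ->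
     L (a \*o u \+ v) = a * L u + L v) /\
  exists C : R, forall u, H1 setT u -> `|L u| <= C * H1norm setT u.

Definition H1_weak_cvg (u_ : nat -> 'rV[R]_d -> R) u :=
  [/\ forall n, H1 setT (u_ n), H1 setT u &
    forall L, H1_functional L -> L (u_ n) @[n --> \oo] --> L u].

Definition gamma_cvg (O_ : nat -> set 'rV[R]_d) (O : set 'rV[R]_d) :=
  (exists B : set 'rV[R]_d, [/\ open B, bounded_set B,
     forall n, open (O_ n) /\ O_ n `<=` B & open O /\ O `<=` B]) /\
  forall f, L2 setT f ->
    H1_weak_cvg (fun n => solution (O_ n) f) (solution O f).

End sobolev.

(* Main.v *)
(** Omega_t is the union of Omega_0 and the part of Omega_1 where g < t, for an
    upper semicontinuous function g all of whose near-level sets [t <= g < s]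
    lie, as s - t -> 0, in arbitrarily thin neighbourhoods of a plane of
    codimension 2: the ternary digits of g(x) record on which side of each
    rational hyperplane x_0 = q or x_1 = q the point x lies.

    It remains to see that adding to an open set U a piece of Omega_1 close to
    such a plane has little effect on the solution.  If W is the larger set and
    u = u_{W,f} with f bounded, then |u| is bounded by comparison with an
    explicit barrier.  If eta is a smooth logarithmic cutoff equal to 1 near
    the plane, then (1 - eta) u is admissible for U, while u_{U,f} is the
    projection of u, so
      |grad (u - u_{U,f})|^2 <= |grad (eta u)|^2
        = int f eta^2 u + int u^2 |grad eta|^2,
    which is small because planes of codimension 2 have zero capacity.  The
    general case follows by truncating f; the estimate is uniform in U and W, so
    Omega_t is even continuous for the strong H^1 convergence of solutions. *)

(* Sweeping [Omega1] by a moving hyperplane would not do. When [Omega0] is the part of [Omega1] on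
   the far side of a hyperplane, the sweep misses only a piece of this hyperplane at the time when
   it reaches it, and nothing just after; hyperplanes have positive capacity, so the solutions jump.
   Whatever [Omega0] is, the sets where g = t must therefore have zero capacity, and codimension 2
   is the least for which planes do; this is where d >= 2 enters. A continuous g cannot have such
   thin level sets. Upper semicontinuity is what remains possible, and it is enough for the sets
   where g < t to be open.

   The gradient of the logarithmic cutoff is small in L^2 but not uniformly, so u^2 |grad eta|^2 can
   only be controlled through a uniform bound on u. Hence the barrier, and hence the detour through
   bounded data. *)
Require Import Defs.
From mathcomp Require Import all_boot all_order all_algebra.
From mathcomp Require Import all_classical all_reals all_analysis.
From mathcomp Require Import measurable_realfun ring lra.

Import Order.TTheory GRing.Theory Num.Theory.
Import numFieldNormedType.Exports.

Local Open Scope classical_set_scope.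
Local Open Scope ring_scope.

Set Implicit Arguments.
Unset Strict Implicit.
Unset Printing Implicit Defensive.

(** * Square integrable functions *)

Section square_integrable.
Context d (T : measurableType d) (R : realType).
Variable mu : {measure set T -> \bar R}.
Implicit Types f g h : T -> R.

Definition intg f := mu.-integrable [set: T] (EFin \o f).
(** Measurability of [f] is asked separately, since that of [f ^+ 2] does not imply it. *)
Definition sq f :=
  measurable_fun [set: T] f /\ intg (fun x => f x ^+ 2).
Definition ip f g : R := \int[mu]_x (f x * g x).

Lemma intgD f g : intg f -> intg g -> intg (fun x => f x + g x).
Proof. by move=> hf hg; exact: (integrableD measurableT hf hg). Qed.

Lemma intgZ a f : intg f -> intg (fun x => a * f x).
Proof.
by move=> hf; apply: (@integrableZl _ _ _ _ _ measurableT a (EFin \o f)).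
Qed.

Lemma intg_le f g : measurable_fun [set: T] f ->
  (forall x, `|f x| <= `|g x|) -> intg g -> intg f.
Proof.
move=> mf fg; apply: le_integrable => //; first exact/measurable_EFinP.
by move=> x _; rewrite lee_fin.
Qed.

Lemma intg0 : intg (fun=> 0).
Proof. exact: integrable0. Qed.

Lemma intg_sum (I : finType) (f : I -> T -> R) :
  (forall i, intg (f i)) -> intg (fun x => \sum_i f i x).
Proof.
move=> hf; rewrite /intg (_ : _ \o _ = fun x => \sum_i (EFin \o f i) x)%E.
  by apply: integrable_sum => // i _; exact: hf.
by apply/funext => x /=; rewrite -sumEFin.
Qed.

Lemma sq_meas f : sq f -> measurable_fun [set: T] f.
Proof. by case. Qed.

Lemma sqM f g : sq f -> sq g -> intg (fun x => f x * g x).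
Proof.
move=> [mf If] [mg Ig]; apply: (intg_le _ _ (intgD If Ig)).
  exact: measurable_funM.
move=> x; rewrite (@ger0_norm _ (_ + _)) ?addr_ge0 ?sqr_ge0//.
rewrite -(real_normK (num_real (f x))) -(real_normK (num_real (g x))) normrM.
move: (normr_ge0 (f x)) (normr_ge0 (g x)) => a b.
have := sqr_ge0 (`|f x| - `|g x|); nra.
Qed.

Lemma sqD f g : sq f -> sq g -> sq (fun x => f x + g x).
Proof.
move=> hf hg; split; first exact: measurable_funD hf.1 hg.1.
have := intgD (intgD hf.2 (intgZ 2 (sqM hf hg))) hg.2.
by congr intg; apply/funext => x; ring.
Qed.

Lemma sqZ a f : sq f -> sq (fun x => a * f x).
Proof.
move=> [mf hf]; split; first exact: measurable_funM.
have := intgZ (a ^+ 2) hf.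
by congr intg; apply/funext => x; ring.
Qed.

Lemma sqN f : sq f -> sq (fun x => - f x).
Proof.
by move=> /(sqZ (-1)); congr sq; apply/funext => x; rewrite mulN1r.
Qed.

Lemma sqB f g : sq f -> sq g -> sq (fun x => f x - g x).
Proof. by move=> hf /sqN; exact: sqD. Qed.

Lemma sq0 : sq (fun=> 0).
Proof.
split; first exact: measurable_cst.
by have := intg0; congr intg; apply/funext => x; rewrite expr0n.
Qed.

Lemma sq_le f g : measurable_fun [set: T] f ->
  (forall x, `|f x| <= `|g x|) -> sq g -> sq f.
Proof.
move=> mf fg [_ ig]; split => //; apply: intg_le ig.
  exact: measurable_funX.
by move=> x; rewrite !normrX; apply: lerXn2r; rewrite ?nnegrE.
Qed.

Lemma sqMb (C : R) h f : measurable_fun [set: T] h ->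
  (forall x, `|h x| <= C) -> sq f -> sq (fun x => h x * f x).
Proof.
move=> mh hC hf; apply: sq_le (sqZ C hf); first exact: measurable_funM hf.1.
move=> x; rewrite !normrM ler_wpM2r//.
by rewrite (le_trans (hC x))// ler_norm.
Qed.

Lemma ipC f g : ip f g = ip g f.
Proof. by congr Rintegral; apply/funext => x; rewrite mulrC. Qed.

Lemma ip_linl a f g h : sq f -> sq g -> sq h ->
  ip (fun x => a * f x + g x) h = a * ip f h + ip g h.
Proof.
move=> hf hg hh; rewrite /ip.
under eq_Rintegral do rewrite mulrDl -mulrA.
rewrite RintegralD// ?RintegralZl//; first exact: sqM.
- exact/intgZ/sqM.
- exact: sqM.
Qed.

Lemma ip_ge0 f : 0 <= ip f f.
Proof. by apply: Rintegral_ge0 => x _; rewrite -expr2 sqr_ge0. Qed.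

Lemma ip_le f g : sq f -> sq g -> (forall x, `|f x| <= `|g x|) ->
  ip f f <= ip g g.
Proof.
move=> hf hg fg; apply: le_Rintegral => //; [exact: sqM|exact: sqM|].
move=> x _; rewrite -!expr2 -(real_normK (num_real (f x))).
by rewrite -(real_normK (num_real (g x))) lerXn2r ?nnegrE.
Qed.

Lemma intg_fin f : intg f -> (\int[mu]_x (f x)%:E = (\int[mu]_x f x)%:E)%E.
Proof. by move=> hf; rewrite fineK//; exact: integrable_fin_num. Qed.

Lemma intg_ae0 f : intg f -> (forall x, 0 <= f x) -> \int[mu]_x f x = 0 ->
  {ae mu, forall x, f x = 0}.
Proof.
move=> hf f0 If0.
have mf := measurable_int _ hf.
have : ae_eq mu [set: T] (EFin \o f) (cst 0%E).
  apply/(ae_eq_integral_abs _ measurableT mf).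
  under eq_integral do rewrite gee0_abs ?lee_fin//.
  by rewrite intg_fin// If0.
by apply: filterS => x /(_ I) /= [].
Qed.

Lemma Rintegral_ae f g : intg f -> intg g -> {ae mu, forall x, f x = g x} ->
  \int[mu]_x f x = \int[mu]_x g x.
Proof.
move=> /measurable_int mf /measurable_int mg fg; congr fine.
apply: ae_eq_integral => //.
by apply: filterS fg => x -> _.
Qed.

Lemma ip_ae0 f : sq f -> ip f f = 0 -> {ae mu, forall x, f x = 0}.
Proof.
move=> hf f0; have f2 x : 0 <= f x * f x by rewrite -expr2 sqr_ge0.
have := intg_ae0 (sqM hf hf) f2 f0.
by apply: filterS => x /eqP; rewrite mulf_eq0 orbb => /eqP.
Qed.

Lemma ip_ae f f' g g' : sq f -> sq f' -> sq g -> sq g' ->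
  {ae mu, forall x, f x = f' x} -> {ae mu, forall x, g x = g' x} ->
  ip f g = ip f' g'.
Proof.
move=> hf hf' hg hg' ff' gg'; apply: Rintegral_ae; [exact: sqM|exact: sqM|].
by apply: filterS2 ff' gg' => x -> ->.
Qed.

End square_integrable.

Lemma cvgn_summable_steps (R : realType) (a : R ^nat) (M : R) :
  (forall k, `|a k.+1 - a k| <= (2 ^ k.+1)%:R^-1 * M) -> cvgn a.
Proof.
move=> aM.
have M0 : 0 <= M.
  by have := le_trans (normr_ge0 _) (aM 0%N); rewrite pmulr_rge0// invr_gt0.
rewrite (_ : a = fun n => a 0%N + series (telescope a) n); last first.
  by apply/funext => n; rewrite -eq_sum_telescope.
apply: is_cvgD; first exact: is_cvg_cst.
apply: normed_cvg; apply: (@series_le_cvg _ _ (geometric (M / 2) 2^-1)) => //.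
- by move=> n /=.
- by move=> n; rewrite /geometric /= ?mulr_ge0 ?divr_ge0 ?exprn_ge0 ?invr_ge0.
- move=> n; apply: le_trans (aM n) _.
  by rewrite /= natrX exprS invfM exprVn mulrC mulrA.
- by apply: is_cvg_geometric_series; rewrite ger0_norm// invf_lt1// ltr1n.
Qed.

Lemma limn_einf_le (R : realType) (u : (\bar R)^nat) (e : \bar R) :
  (forall n, (u n <= e)%E) -> (limn_einf u <= e)%E.
Proof.
move=> ue; rewrite limn_einf_lim; apply: lime_le; first exact: is_cvg_einfs.
apply: nearW => n; apply: le_trans (ue n).
by apply: ereal_inf_lbound; exists n => /=.
Qed.

(** * Completeness of L^2 *)

Section complete.
Context d (T : measurableType d) (R : realType).
Variable mu : {measure set T -> \bar R}.
Implicit Types f g h : T -> R.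

(** The third power leaves room for a weight: the squared steps divided by [c k ^+ 2] have integral
    at most [c k], so their sum [S] is finite almost everywhere. Where it is, the k-th step is at
    most [c k] times [1 + S], which replaces the square root of [S]. *)
Lemma fast_cauchy_ae (v : nat -> T -> R) : (forall n, sq mu (v n)) ->
  (forall k, ip mu (v k.+1 \- v k) (v k.+1 \- v k) <= (2 ^ k.+1)%:R^-1 ^+ 3) ->
  exists A, [/\ measurable A, {ae mu, forall x, A x} &
    forall x, A x -> cvgn (v ^~ x)].
Proof.
move=> hv vk; pose c k : R := (2 ^ k.+1)%:R^-1.
have c0 k : 0 < c k by rewrite invr_gt0 ltr0n expn_gt0.
pose F k x := (c k ^- 2 * (v k.+1 x - v k x) ^+ 2)%:E.
have hs k : sq mu (v k.+1 \- v k) by exact: sqB.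
have mF k : measurable_fun [set: T] (F k).
  by apply/measurable_EFinP/measurable_funM => //; apply: measurable_funX; exact: (sq_meas (hs k)).
have F0 k x : (0 <= F k x)%E by rewrite lee_fin mulr_ge0 ?sqr_ge0// invr_ge0 exprn_ge0// ltW.
pose S x := (\sum_(k <oo) F k x)%E.
have S0 x : (0 <= S x)%E by apply: nneseries_ge0 => n _ _.
have mS : measurable_fun [set: T] S by apply: ge0_emeasurable_sum.
have IS : (\int[mu]_x S x < +oo)%E.
  rewrite integral_nneseries//.
  apply: (@le_lt_trans _ _ (1%:E)%E); last exact: ltry.
  apply: le_trans (epsilon_trick0 xpredT (ler01 : 0 <= 1 :> R)).
  apply: lee_nneseries; first by move=> i _ _; exact: integral_ge0.
  move=> k _; rewrite intg_fin; last by apply/intgZ/(hs k).2.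
  rewrite lee_fin RintegralZl//; last exact: (hs k).2.
  have := vk k; rewrite /ip; under eq_Rintegral do rewrite -expr2.
  move=> vk'; rewrite mulrC ler_pdivrMr ?exprn_gt0// mul1r -exprS.
  exact: vk'.
have iS : mu.-integrable [set: T] S.
  apply/integrableP; split => //.
  by under eq_integral do rewrite gee0_abs//.
exists [set x | (S x < +oo)%E]; split.
- by rewrite -[X in measurable X]setTI; apply: emeasurable_fun_infty_o.
- apply: filterS (integrable_ae measurableT iS) => x /(_ I) /fin_numPlt /andP[_].
  by [].
- move=> x /= Sx.
  have Sf : S x \is a fin_num by rewrite ge0_fin_numE.
  apply: (@cvgn_summable_steps _ _ (1 + fine (S x))) => k.
  have FS : (F k x <= S x)%E.
    apply: le_trans (nneseries_lim_ge (P := xpredT) k.+1 _); last by [].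
    by rewrite big_nat_recr//= leeDr// sume_ge0.
  have s0 : 0 <= fine (S x) by rewrite fine_ge0.
  have : c k ^- 2 * (v k.+1 x - v k x) ^+ 2 <= fine (S x).
    by rewrite -lee_fin fineK.
  rewrite mulrC ler_pdivrMr ?exprn_gt0// => h.
  rewrite -/(c k) -(@ger0_norm _ (c k * _)); last by rewrite mulr_ge0 ?addr_ge0// ltW.
  rewrite -ler_sqr ?nnegrE// !real_normK ?num_real//.
  apply: (le_trans h); rewrite exprMn mulrC ler_wpM2l ?sqr_ge0//.
  by move: (fine (S x)) s0 => s s0; nra.
Qed.

(** Riesz-Fischer: a fast subsequence converges almost everywhere to some [f], and Fatou's lemma
    along it turns the Cauchy bound on [u n - u k] into the same bound on [u n - f]. *)
Lemma sq_complete (u : nat -> T -> R) : (forall n, sq mu (u n)) ->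
  (forall e, 0 < e -> exists N, forall m n, (N <= m)%N -> (N <= n)%N ->
     ip mu (u m \- u n) (u m \- u n) <= e) ->
  exists f, sq mu f /\ forall e, 0 < e -> exists N, forall n, (N <= n)%N ->
     ip mu (u n \- f) (u n \- f) <= e.
Proof.
move=> hu cu.
have /choice[N HN] : forall k : nat, exists N, forall m n, (N <= m)%N -> (N <= n)%N ->
     ip mu (u m \- u n) (u m \- u n) <= (2 ^ k.+1)%:R^-1 ^+ 3.
  by move=> k; apply: cu; rewrite exprn_gt0// invr_gt0 ltr0n expn_gt0.
(* Summing makes the indices strictly increasing and at least [N k] at once. *)
pose s k := (\sum_(j < k.+1) (N j).+1)%N.
have Ns k : (N k <= s k)%N by rewrite /s big_ord_recr/= (leq_trans (leqnSn _))// leq_addl.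
have sS k : (s k < s k.+1)%N by rewrite /s [X in (_ < X)%N]big_ord_recr/= -addn1 leq_add2l.
have sk k : (k <= s k)%N by elim: k => // k IH; exact: leq_ltn_trans (sS k).
pose v k := u (s k).
have hv k : sq mu (v k) by exact: hu.
have [A [mA aeA cA]] : exists A, [/\ measurable A, {ae mu, forall x, A x} &
    forall x, A x -> cvgn (v ^~ x)].
  apply: fast_cauchy_ae => // k; apply: HN => //; exact: leq_trans (ltnW (sS k)).
(* Cut off by [A], the subsequence converges everywhere, so its limit [f] is measurable. *)
pose w k x := \1_A x * v k x.
have m1 : measurable_fun [set: T] (\1_A : T -> R) by exact: measurable_indic.
have b1 x : `|\1_A x : R| <= 1.
  by rewrite indicE; case: (_ \in _); rewrite ?normr1 ?normr0.
pose f x := limn (w ^~ x).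
have wf x : w ^~ x @ \oo --> f x.
  rewrite /f /w; apply/cvg_ex; have [xA|xA] := boolP (x \in A).
    rewrite indicE xA; exists (limn (v ^~ x)).
    under eq_cvg do rewrite mul1r; exact: cA (set_mem xA).
  by exists 0; rewrite indicE (negbTE xA); under eq_cvg do rewrite mul0r; exact: cvg_cst.
have mf : measurable_fun [set: T] f.
  apply: (@measurable_fun_cvg _ _ _ _ w) => // m.
  exact: (measurable_funM m1 (hv m).1).
have key n e : 0 < e -> (forall k, (n <= k)%N -> ip mu (u n \- u k) (u n \- u k) <= e) ->
    (\int[mu]_x ((\1_A x * (u n x - f x)) ^+ 2)%:E <= e%:E)%E.
  move=> e0 hk.
  pose F k x := ((\1_A x * (u n x - w (n + k)%N x)) ^+ 2)%:E.
  have hB k : sq mu (fun x => \1_A x * (u n x - w (n + k)%N x)).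
    by apply: (sqMb m1 b1 (sqB (hu n) (sqMb m1 b1 (hv _)))).
  have -> : (\int[mu]_x ((\1_A x * (u n x - f x)) ^+ 2)%:E =
     \int[mu]_x limn_einf (F^~ x))%E.
    apply: eq_integral => x _; apply/esym; apply: (cvg_limn_einf_sup _).1.
    have wfn : (fun k => w (n + k)%N x) @ \oo --> f x.
      have := wf x; rewrite -(cvg_shiftn n).
      by under eq_fun do rewrite addnC.
    have h : (fun k => \1_A x * (u n x - w (n + k)%N x)) @ \oo --> \1_A x * (u n x - f x).
      by apply: cvgM; [apply: cvg_cst|apply: cvgB => //; apply: cvg_cst].
    apply/fine_cvgP; split; first exact: nearW.
    rewrite (_ : fine \o _ = fun k => (\1_A x * (u n x - w (n + k)%N x)) *
      (\1_A x * (u n x - w (n + k)%N x))); last first.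
      by apply/funext => k; rewrite /= expr2.
    by rewrite /= expr2; exact: (cvgM h h).
  apply: le_trans (fatou mu measurableT _ _) _.
  - move=> k; apply/measurable_EFinP/measurable_funX; exact: (hB k).1.
  - by move=> k x _; rewrite lee_fin sqr_ge0.
  apply: limn_einf_le => k.
  rewrite intg_fin; last exact: (hB k).2.
  rewrite lee_fin; apply: le_trans (hk (s (n + k)) _); last first.
    by rewrite (leq_trans _ (sk _))// leq_addr.
  have := @ip_le _ _ _ mu _ (u n \- u (s (n + k))) (hB k) (sqB (hu _) (hu _)).
  rewrite /ip; under [X in (_ -> X <= _) -> _]eq_Rintegral do rewrite -expr2.
  apply => x; rewrite /w /= indicE; case: (_ \in _).
    by rewrite !mul1r.
  by rewrite !mul0r normr0.
have hA n e : 0 < e -> (forall k, (n <= k)%N -> ip mu (u n \- u k) (u n \- u k) <= e) ->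
    sq mu (fun x => \1_A x * (u n x - f x)).
  move=> e0 hk; have mAf : measurable_fun [set: T] (fun x => \1_A x * (u n x - f x)).
    by apply: measurable_funM => //; apply: measurable_funB => //; exact: (hu n).1.
  split => //; apply/integrableP; split.
    by apply/measurable_EFinP/measurable_funX.
  under eq_integral do rewrite /= ger0_norm ?sqr_ge0//.
  exact: le_lt_trans (key n e e0 hk) (ltry _).
have fA x : \1_A x * f x = f x.
  rewrite indicE; case: (boolP (x \in A)) => xA; first by rewrite mul1r.
  have := wf x; rewrite (_ : w ^~ x = cst 0); last first.
    by apply/funext => k; rewrite /w indicE (negbTE xA) mul0r.
  by move=> h; rewrite mul0r; apply: (cvg_unique _ (cvg_cst _) h).
have hf : sq mu f.
  have [n0 Hn0] := cu 1 ltr01.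
  have hn := hA n0 1 ltr01 (fun k => Hn0 n0 k (leqnn _)).
  have := sqB (sqMb m1 b1 (hu n0)) hn; congr sq; apply/funext => x.
  by rewrite -[RHS]fA; ring.
exists f; split => // e e0; have [n0 Hn0] := cu e e0; exists n0 => n n0n.
have hk k : (n <= k)%N -> ip mu (u n \- u k) (u n \- u k) <= e.
  by move=> nk; apply: Hn0 => //; exact: leq_trans nk.
have h1 := hA n e e0 hk.
have h2 : sq mu (u n \- f) by exact: sqB.
have -> : ip mu (u n \- f) (u n \- f) =
    ip mu (fun x => \1_A x * (u n x - f x)) (fun x => \1_A x * (u n x - f x)).
  by apply: ip_ae => //; apply: filterS aeA => x Ax; rewrite indicE mem_set// mul1r.
rewrite -lee_fin -intg_fin; last exact: sqM.
by under eq_integral do rewrite -expr2; exact: key.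
Qed.

End complete.

(** * Semi-inner product spaces *)

Lemma discr_le (R : realFieldType) (a b c : R) : 0 <= c ->
  (forall t, 0 <= a + 2 * t * b + t ^+ 2 * c) -> b ^+ 2 <= a * c.
Proof.
move=> c0 h; have [c_gt0|] := ltP 0 c.
  have := h (- b / c); rewrite (_ : _ + _ = (a * c - b ^+ 2) / c); last first.
    by field; rewrite gt_eqF.
  by rewrite pmulr_lge0 ?invr_gt0// subr_ge0.
move=> c_le0; have -> : c = 0 by apply/eqP; rewrite eq_le c_le0.
rewrite mulr0; have [->|b0] := eqVneq b 0; first by rewrite expr0n.
(* With [c = 0] the expression is affine in [t], and this [t] gives it the value -1. *)
have := h (- (a + 1) / (2 * b)); have -> : c = 0 by apply/eqP; rewrite eq_le c_le0.
rewrite (_ : _ + _ = - 1) ?ler0N1//.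
by field.
Qed.

Lemma eq0_small (R : realFieldType) (x y : R) : 0 <= x -> 0 <= y ->
  (forall e, 0 < e -> x <= e * y) -> x = 0.
Proof.
move=> x0 y0 h; apply/eqP; rewrite eq_le x0 andbT leNgt; apply/negP => xgt.
have y1 : 0 < y + 1 by rewrite ltr_wpDl.
have := h (x / (y + 1)) (divr_gt0 xgt y1).
rewrite mulrAC ler_pdivlMr// ler_pM2l//.
by rewrite leNgt ltrDl ltr01.
Qed.

Section hilbert.
Variables (R : realType) (V : lmodType R).
Implicit Types (P : set V) (B : V -> V -> R).

(** The ambient [V] will consist of all functions, where a form given by an integral is not
    bilinear; [P] cuts out the part where it is. Degenerate forms are allowed, as functions equal
    almost everywhere are not identified. *)
Definition semi_inner P B :=
  [/\ P 0, forall a u v, P u -> P v -> P (a *: u + v),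
   forall u v, P u -> P v -> B u v = B v u,
   forall a u v w, P u -> P v -> P w -> B (a *: u + v) w = a * B u w + B v w &
   forall u, P u -> 0 <= B u u].

Section theory.
Variables (P : set V) (B : V -> V -> R).
Hypothesis PB : semi_inner P B.

Lemma semi_innerD u v : P u -> P v -> P (u + v).
Proof. by case: PB => _ PZ _ _ _ hu hv; rewrite -[u]scale1r; exact: PZ. Qed.

Lemma semi_innerZ a u : P u -> P (a *: u).
Proof. by case: PB => P0 PZ _ _ _ hu; rewrite -[_ *: _]addr0; exact: PZ. Qed.

Lemma semi_innerB u v : P u -> P v -> P (u - v).
Proof.
by move=> hu hv; apply: semi_innerD => //; rewrite -scaleN1r; exact: semi_innerZ.
Qed.

Lemma formDl u v w : P u -> P v -> P w -> B (u + v) w = B u w + B v w.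
Proof.
by case: PB => _ _ _ Bl _ hu hv hw; rewrite -[u in LHS]scale1r Bl// mul1r.
Qed.

Lemma form0l w : P w -> B 0 w = 0.
Proof.
case: PB => P0 _ _ Bl _ hw; have := formDl P0 P0 hw.
by rewrite addr0 => /eqP; rewrite -subr_eq0 opprD addrA subrr sub0r oppr_eq0 => /eqP.
Qed.

Lemma formZl a u w : P u -> P w -> B (a *: u) w = a * B u w.
Proof.
case: PB => P0 _ _ Bl _ hu hw; rewrite -[_ *: _]addr0 Bl//.
by rewrite form0l// addr0.
Qed.

Lemma formBl u v w : P u -> P v -> P w -> B (u - v) w = B u w - B v w.
Proof.
move=> hu hv hw; rewrite formDl//; last by rewrite -scaleN1r; exact: semi_innerZ.
by rewrite -scaleN1r formZl// mulN1r.
Qed.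

Lemma formDr u v w : P u -> P v -> P w -> B w (u + v) = B w u + B w v.
Proof.
case: (PB) => _ _ Bs _ _ hu hv hw.
by rewrite Bs ?formDl ?(Bs w)//; exact: semi_innerD.
Qed.

Lemma formBr u v w : P u -> P v -> P w -> B w (u - v) = B w u - B w v.
Proof.
case: (PB) => _ _ Bs _ _ hu hv hw.
by rewrite Bs ?formBl ?(Bs w)//; exact: semi_innerB.
Qed.

Lemma formZr a u w : P u -> P w -> B w (a *: u) = a * B w u.
Proof.
case: (PB) => _ _ Bs _ _ hu hw.
by rewrite Bs ?formZl ?(Bs w)//; exact: semi_innerZ.
Qed.

Lemma form_ge0 u : P u -> 0 <= B u u.
Proof. by case: PB => _ _ _ _; apply. Qed.

Lemma formC u v : P u -> P v -> B u v = B v u.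
Proof. by case: PB => _ _ Bs _ _; exact: Bs. Qed.

Lemma form_sqrD u v : P u -> P v ->
  B (u + v) (u + v) = B u u + 2 * B u v + B v v.
Proof.
move=> hu hv; have huv := semi_innerD hu hv.
by rewrite formDl// !formDr// (formC hv hu); ring.
Qed.

Lemma form_sqrBC u v : P u -> P v -> B (u - v) (u - v) = B (v - u) (v - u).
Proof.
move=> hu hv; have hvu := semi_innerB hv hu.
have -> : u - v = (-1) *: (v - u) by rewrite scaleN1r opprB.
rewrite formZl// ?formZr//; last exact: semi_innerZ.
by rewrite mulrA mulrNN mulr1 mul1r.
Qed.

Lemma cauchy_schwarz u v : P u -> P v -> B u v ^+ 2 <= B u u * B v v.
Proof.
move=> hu hv; apply: discr_le => [|t]; first exact: form_ge0.
have htv := semi_innerZ t hv.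
have := form_ge0 (semi_innerD hu htv).
rewrite form_sqrD// formZr// formZl// formZr//.
by congr (0 <= _); ring.
Qed.

Lemma form_le2 u v : P u -> P v -> 2 * B u v <= B u u + B v v.
Proof.
move=> hu hv; have := form_ge0 (semi_innerB hu hv).
have := semi_innerB hu hv => huv.
rewrite formBl// !formBr// (formC hv hu); lra.
Qed.

Lemma form_sqrD_le u v : P u -> P v ->
  B (u + v) (u + v) <= 2 * B u u + 2 * B v v.
Proof. by move=> hu hv; have := form_le2 hu hv; rewrite form_sqrD//; lra. Qed.

(** Minimise [J v = B v v - 2 l v]. Minimising sequences are Cauchy by the parallelogram identity,
    and the first variation of [J] at the limit is the claimed equation. *)
Lemma riesz (l : V -> R) (C : R) :
  (forall a u v, P u -> P v -> l (a *: u + v) = a * l u + l v) ->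
  (forall v, P v -> l v ^+ 2 <= C * B v v) ->
  (forall u : nat -> V, (forall n, P (u n)) ->
    (forall e, 0 < e -> exists N, forall m n, (N <= m)%N -> (N <= n)%N ->
      B (u m - u n) (u m - u n) <= e) ->
    exists v, P v /\ forall e, 0 < e -> exists N, forall n, (N <= n)%N ->
      B (u n - v) (u n - v) <= e) ->
  exists u, P u /\ forall v, P v -> B u v = l v.
Proof.
move=> l_lin lC cplt; case: (PB) => P0 PZ _ _ _.
have lD u v : P u -> P v -> l (u + v) = l u + l v.
  by move=> hu hv; rewrite -[u in LHS]scale1r l_lin// mul1r.
have l0 : l 0 = 0.
  by have := lD _ _ P0 P0; rewrite addr0 => h; lra.
have lZ a u : P u -> l (a *: u) = a * l u.
  by move=> hu; rewrite -[_ *: _]addr0 l_lin// l0 addr0.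
pose J v := B v v - 2 * l v.
have C' := Num.max C 0.
(* With [b = B v v] and [c] the maximum, [(l v)^2 <= c b] and [4 c b <= (b + c)^2] give
   [2 l v <= b + c]. *)
have JC v : P v -> - (Num.max C 0) <= J v.
  move=> hv; have := form_ge0 hv; have := lC _ hv; rewrite /J.
  have : C <= Num.max C 0 by rewrite le_max lexx.
  have : 0 <= Num.max C 0 by rewrite le_max lexx orbT.
  move: (B v v) (l v) (Num.max C 0) => b r c c0 Cc lb b0.
  have h : r ^+ 2 <= c * b by apply: le_trans lb _; rewrite ler_wpM2r.
  have : (2 * r) ^+ 2 <= (b + c) ^+ 2.
    by have := sqr_ge0 (b - c); nra.
  have bc : 0 <= b + c by lra.
  move=> h2; have : `|2 * r| <= b + c.
    by rewrite -ler_sqr ?nnegrE// real_normK ?num_real.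
  by move=> /ler_normlW; lra.
pose S := [set J v | v in P].
have Sinf : has_inf S.
  split; first by exists (J 0); exists 0.
  by exists (- Num.max C 0) => _ [v hv <-]; exact: JC.
pose m := inf S.
have mJ v : P v -> m <= J v.
  by move=> hv; apply: ge_inf; [exact: Sinf.2|exists v].
have /choice[u Hu] : forall n : nat, exists u, P u /\ J u <= m + n.+1%:R^-1.
  move=> n; have n0 : 0 < n.+1%:R^-1 :> R by rewrite invr_gt0.
  have [_ [v hv <-] hJ] := inf_adherent n0 Sinf.
  by exists v; split => //; exact: ltW.
have Pu n : P (u n) by have [] := Hu n.
have Ju n : J (u n) <= m + n.+1%:R^-1 by have [] := Hu n.
(* Parallelogram identity, [J] being at least [m] at the midpoint of [v] and [w]. *)
have par v w : P v -> P w -> B (v - w) (v - w) <= 2 * (J v - m) + 2 * (J w - m).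
  move=> hv hw; have hvw := semi_innerD hv hw.
  have := mJ _ (semi_innerZ 2^-1 hvw); have hm := semi_innerB hv hw.
  have hz := semi_innerZ 2^-1 hvw.
  rewrite /J lZ// lD// formZl// formZr// form_sqrD// formBl// !formBr// (formC hw hv).
  lra.
have inv_small e : 0 < e -> exists N, forall n, (N <= n)%N -> n.+1%:R^-1 <= e :> R.
  move=> e0; exists (Num.truncn e^-1) => n Nn.
  rewrite invf_ple ?posrE//; apply: le_trans (ltW (truncnS_gt _)) _.
  by rewrite ler_nat ltnS.
have [//| |w [hw uw]] := cplt u.
  move=> e e0; have [N HN] := inv_small (e / 4) (divr_gt0 e0 (ltr0n _ 4)).
  exists N => i j Ni Nj; apply: le_trans (par _ _ (Pu i) (Pu j)) _.
  have := HN _ Ni; have := HN _ Nj; have := Ju i; have := Ju j.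
  move: (i.+1%:R^-1) (j.+1%:R^-1) => a b; lra.
exists w; split => // v hv.
(* [J (u n + t v) >= m >= J (u n) - 1/(n+1)] for every [t]: the discriminant of this quadratic in
   [t] is not positive. *)
have step n : (B (u n) v - l v) ^+ 2 <= n.+1%:R^-1 * B v v.
  apply: discr_le => [|t]; first exact: form_ge0.
  have htv := semi_innerZ t hv.
  have := mJ _ (semi_innerD (Pu n) htv); have := Ju n.
  rewrite /J form_sqrD// lD// lZ// formZr// formZl// formZr//.
  move: (n.+1%:R^-1) => q; nra.
suff : (B w v - l v) ^+ 2 = 0.
  by move/eqP; rewrite expf_eq0/= subr_eq0 => /eqP.
apply: (@eq0_small _ _ (4 * B v v)).
- exact: sqr_ge0.
- by rewrite mulr_ge0 ?form_ge0.
move=> e e0; have [N1 HN1] := inv_small e e0; have [N2 HN2] := uw e e0.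
pose n := maxn N1 N2.
have h1 : (B (u n) v - l v) ^+ 2 <= e * B v v.
  apply: le_trans (step n) _; apply: ler_wpM2r; first exact: form_ge0.
  by apply: HN1; rewrite leq_maxl.
have hd := semi_innerB (Pu n) hw.
have h2 : (B (u n) v - B w v) ^+ 2 <= e * B v v.
  rewrite -formBl//; apply: le_trans (cauchy_schwarz hd hv) _.
  apply: ler_wpM2r; first exact: form_ge0.
  by apply: HN2; rewrite leq_maxr.
have := sqr_ge0 ((B (u n) v - l v) + (B (u n) v - B w v)).
move: h1 h2; nra.
Qed.

End theory.
End hilbert.

(** * Smooth functions on R^d *)

Section directional.
Context (R : realType) (V : normedModType R).
Implicit Types (f g : V -> R) (x v : V).

Lemma is_deriveP f x v df :
  (fun h => h^-1 * (f (h *: v + x) - f x)) @ 0^' --> df -> is_derive x v f df.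
Proof.
move=> h; apply: DeriveDef; first by apply/cvg_ex; exists df.
exact: cvg_lim h.
Qed.

Lemma is_derive_cvg f x v df : is_derive x v f df ->
  (fun h => h^-1 * (f (h *: v + x) - f x)) @ 0^' --> df.
Proof. by case=> hd <-; exact: hd. Qed.

End directional.

Section directional_rules.
Context (R : realType) (V : normedModType R).
Implicit Types (f g : V -> R) (x v : V).

Lemma is_derive_line f x v (t df : R) : is_derive (t *: v + x) v f df ->
  is_derive t (1 : R) (fun h => f (h *: v + x)) df.
Proof.
move=> /is_derive_cvg h; apply: is_deriveP.
rewrite (_ : (fun _ => _) =
  fun h => h^-1 * (f (h *: v + (t *: v + x)) - f (t *: v + x))) //.
by apply/funext => k; rewrite [k *: (1 : R)]mulr1 scalerDl addrA.
Qed.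

Lemma line_is_derive f x v (df : R) :
  is_derive (0 : R) (1 : R) (fun h => f (h *: v + x)) df ->
  is_derive x v f df.
Proof.
move=> /is_derive_cvg h; apply: is_deriveP; move: h.
rewrite (_ : (fun _ => _) = fun h => h^-1 * (f (h *: v + x) - f x)) //.
by apply/funext => k; rewrite [k *: (1 : R)]mulr1 scale0r add0r addr0.
Qed.

Lemma is_derive_mul f g x v df dg : is_derive x v f df -> is_derive x v g dg ->
  is_derive x v (fun y => f y * g y) (df * g x + f x * dg).
Proof.
move=> hf hg; have h := is_deriveM hf hg.
by apply: is_derive_eq h _; rewrite /GRing.scale /= addrC mulrC.
Qed.

Lemma is_derive_add f g x v df dg : is_derive x v f df -> is_derive x v g dg ->
  is_derive x v (fun y => f y + g y) (df + dg).
Proof. by move=> hf hg; exact: (is_deriveD hf hg). Qed.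

(** Restriction to the line through [x] with direction [v] reduces this to the chain rule in one
    variable. *)
Lemma is_derive_comp (T : R -> R) f x v (dT df : R) :
  is_derive (f x) (1 : R) T dT -> is_derive x v f df ->
  is_derive x v (fun y => T (f y)) (dT * df).
Proof.
move=> hT hf; apply: line_is_derive.
have hl : is_derive (0 : R) (1 : R) (fun h => f (h *: v + x)) df.
  by apply: is_derive_line; rewrite scale0r add0r.
have hT' : is_derive (f (0 *: v + x)) (1 : R) T dT by rewrite scale0r add0r.
have h := @is_derive1_comp _ T (fun h => f (h *: v + x)) 0 dT df hT' hl.
exact: h.
Qed.

End directional_rules.

(** Exhibiting the whole sequence of derivatives suits functions whose derivatives stay in an
    explicit family, such as [flat]. *)
Definition smooth1 (R : realType) (T : R -> R) :=
  exists S : nat -> R -> R, S 0%N = T /\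
    forall n (x : R), is_derive x (1 : R) (S n) (S n.+1 x).

(** * Flat functions *)

Section flat.
Variable R : realType.
Implicit Types p q : {poly R}.

(* [flat 1] is the usual flat function exp(-1/x); the polynomial factor in 1/x
   makes the family stable under derivation. *)
Definition flat p (x : R) : R := if 0 < x then p.[x^-1] * expR (- x^-1) else 0.

Lemma horner_le_expR p : exists2 K : R, 0 <= K &
  forall y, 0 <= y -> `|p.[y]| <= K * expR y.
Proof.
elim/poly_ind: p => [|p c _].
  by exists 0 => // y _; rewrite horner0 normr0 mul0r.
move: (p * 'X + c%:P) => {c} {}p.
have xn n (y : R) : 0 <= y -> y ^+ n <= n`!%:R * expR y.
  move=> y0; case: n => [|n]; first by rewrite expr0 mul1r -expR0 ler_expR.
  have := expR_ge1Dxn n y0; rewrite -ler_pdivrMl ?ltr0n ?fact_gt0// mulrC.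
  by apply: le_trans; rewrite lerDr.
exists (\sum_(i < size p) `|p`_i| * i`!%:R).
  by apply: sumr_ge0 => i _; rewrite mulr_ge0.
move=> y y0; rewrite horner_coef (le_trans (ler_norm_sum _ _ _))// mulr_suml.
apply: ler_sum => i _; rewrite normrM -mulrA ler_wpM2l//.
by rewrite ger0_norm ?exprn_ge0//; exact: xn.
Qed.

(** The exponential bound for [p * 'X] instead of [p] gains the factor [x], which yields continuity
    at 0. *)
Lemma flat_le p : exists2 K : R, 0 <= K & forall x, `|flat p x| <= K * `|x|.
Proof.
have [K K0 HK] := horner_le_expR (p * 'X); exists K => // x.
rewrite /flat; case: ltP => x0; last by rewrite normr0 mulr_ge0.
have y0 : 0 <= x^-1 by rewrite invr_ge0 ltW.
have := HK _ y0; rewrite hornerM hornerX normrM (@ger0_norm _ x^-1)//.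
rewrite ler_pdivrMr// => h.
rewrite normrM (@ger0_norm _ (expR _)) ?expR_ge0// expRN (gtr0_norm x0).
by rewrite ler_pdivrMr ?expR_gt0// mulrAC.
Qed.

(** With [y = 1/x], the derivative of [p(y) exp(-y)] with respect to [x] is
    [y^2 (p - p')(y) exp(-y)]. *)
Definition flat_next p := 'X^2 * (p - p^`()).

Lemma is_derive_flat p (x : R) : is_derive x (1 : R) (flat p) (flat (flat_next p) x).
Proof.
have [x0|x0|->] := ltgtP x 0.
- rewrite {2}/flat ltNge (ltW x0)/=.
  apply: (@near_eq_is_derive _ _ _ (cst 0)).
  near=> y; rewrite /flat ltNge (_ : y <= 0)//.
  by apply: ltW; near: y; exact: lt_nbhsl.
- rewrite {2}/flat x0.
  have xn : x != 0 by rewrite gt_eqF.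
  have hV : is_derive x (1 : R) (fun y : R => y^-1) (- x ^- 2).
    have h := @is_deriveV R id x 1 1 xn (is_derive_id _ _).
    by apply: (is_derive_eq h); rewrite /GRing.scale /= mulr1.
  have hp : is_derive x (1 : R) (fun y : R => p.[y^-1]) (p^`().[x^-1] * - x ^- 2).
    exact: (@is_derive_comp _ _ (horner p) _ _ _ _ _ (is_derive_poly _ _) hV).
  have hN : is_derive x (1 : R) (fun y : R => - y^-1) (x ^- 2).
    by apply: (is_derive_eq (is_deriveN hV)); rewrite opprK.
  have he : is_derive x (1 : R) (fun y : R => expR (- y^-1)) (expR (- x^-1) * x ^- 2).
    exact: (@is_derive_comp _ _ expR _ _ _ _ _ (is_derive_expR _) hN).
  have := is_derive_mul hp he; move=> /(near_eq_is_derive _) h.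
  have {h} := h (flat p); have fE : \near x, p.[x^-1] * expR (- x^-1) = flat p x.
    near=> y; rewrite /flat (_ : 0 < y)//.
    by near: y; exact: lt_nbhsr.
  move=> /(_ fE) h; apply: (is_derive_eq h).
  rewrite /flat_next hornerM hornerXn hornerD hornerN -exprVn; ring.
(* At 0 the difference quotient of [flat p] is [flat (p * 'X)], which tends to 0 by [flat_le]. *)
- rewrite {2}/flat ltxx; apply/is_derive1_caratheodory.
  exists (flat (p * 'X)); split.
  + move=> z; rewrite subr0 /flat ltxx subr0 hornerM hornerX.
    case: ifP => [z0|_]; last by rewrite mul0r.
    by move: (expR _) p.[_] => e q; field; rewrite gt_eqF.
  + have [K K0 HK] := flat_le (p * 'X).
    rewrite /prop_for /continuous_at (_ : flat (p * 'X) 0 = 0); last by rewrite /flat ltxx.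
    apply/cvgr0Pnorm_le => e e0.
    have K1 : 0 < K + 1 by rewrite ltr_wpDl.
    near=> y; apply: le_trans (HK y) _.
    apply: (@le_trans _ _ ((K + 1) * `|y|)); first by rewrite ler_wpM2r// lerDl.
    rewrite mulrC -ler_pdivlMr//.
    near: y; exists (e / (K + 1)) => /=; first exact: divr_gt0.
    by move=> y /=; rewrite sub0r normrN => /ltW.
  + by rewrite /flat ltxx.
Unshelve. all: by end_near. Qed.

Lemma smooth1_flat p : smooth1 (flat p).
Proof.
by exists (fun n => flat (iter n flat_next p)); split => // n x; exact: is_derive_flat.
Qed.

End flat.

(** * Calculus of smooth functions and test functions *)

Section smooth_calculus.
Context (R : realType) (d : nat).
Implicit Types (f g phi : 'rV[R]_d -> R) (D : set 'rV[R]_d).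

Lemma pderiv_val f x i df : is_derive x (delta_mx 0 i) f df -> pderiv i f x = df.
Proof. by case. Qed.

(** [smooth] quantifies over lists of indices, which is awkward for products. Induction on the order
    works: the derivative of a product is a sum of products of functions of one order less. *)
Fixpoint Ck k f : Prop :=
  if k is k'.+1 then continuous f /\ forall i,
    (forall x, derivable f x (delta_mx 0 i)) /\ Ck k' (pderiv i f)
  else continuous f.

Lemma CkW k f : Ck k.+1 f -> Ck k f.
Proof.
elim: k f => [|k IH] f; first by case.
by move=> [cf hf]; split => // i; have [df /IH] := hf i.
Qed.

Lemma smoothP f : smooth f <-> forall k, Ck k f.
Proof.
split=> [sf k|hf s].
  elim: k f sf => [|k IH] f sf; first by have [] := sf [::].
  split; first by have [] := sf [::].
  move=> i; split; first by have [_ h] := sf [::]; exact: h.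
  (* [pderivs] differentiates first in the last index of the list, hence [rcons]. *)
  by apply: IH => s; have := sf (rcons s i); rewrite /pderivs foldr_rcons.
elim/last_ind: s f hf => [|s i IH] f hf.
  by split; [have [] := hf 1%N|move=> i; have [_ /(_ i) []] := hf 1%N].
rewrite /pderivs foldr_rcons; apply: IH => k.
by have [_ /(_ i) []] := hf k.+1.
Qed.

Lemma smooth_continuous f : smooth f -> continuous f.
Proof. by move=> /smoothP /(_ 0%N). Qed.

Lemma smooth_pderiv i f : smooth f -> smooth (pderiv i f).
Proof. by move=> /smoothP hf; apply/smoothP => k; have [_ /(_ i) []] := hf k.+1. Qed.

Lemma smooth_is_derive i f x : smooth f ->
  is_derive x (delta_mx 0 i) f (pderiv i f x).
Proof. by move=> sf; apply: derivableP; have [_] := sf [::]; apply. Qed.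

Lemma Ck_cst k (c : R) : Ck k (fun=> c).
Proof.
elim: k c => [|k IH] c; first exact: cst_continuous.
split; first exact: cst_continuous.
move=> i; split => [x|]; first exact: derivable_cst.
rewrite (_ : pderiv i _ = fun=> 0) //.
by apply/funext => x; apply: pderiv_val; exact: is_derive_cst.
Qed.

Lemma continuous_fD f g : continuous f -> continuous g ->
  continuous (fun x => f x + g x).
Proof. by move=> hf hg x; apply: continuousD; [exact: hf|exact: hg]. Qed.

Lemma continuous_fM f g : continuous f -> continuous g ->
  continuous (fun x => f x * g x).
Proof. by move=> hf hg x; apply: continuousM; [exact: hf|exact: hg]. Qed.

Lemma CkD k f g : Ck k f -> Ck k g -> Ck k (fun x => f x + g x).
Proof.
elim: k f g => [|k IH] f g hf hg.
  exact: (continuous_fD hf hg).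
split; first exact: (continuous_fD hf.1 hg.1).
move=> i; have [df hf'] := hf.2 i; have [dg hg'] := hg.2 i.
have H x := is_derive_add (derivableP (df x)) (derivableP (dg x)).
split=> [x|]; first by case: (H x).
rewrite (_ : pderiv i _ = fun x => pderiv i f x + pderiv i g x).
  exact: IH.
by apply/funext => x; apply: pderiv_val; exact: H.
Qed.

Lemma CkM k f g : Ck k f -> Ck k g -> Ck k (fun x => f x * g x).
Proof.
elim: k f g => [|k IH] f g hf hg.
  exact: (continuous_fM hf hg).
split; first exact: (continuous_fM hf.1 hg.1).
move=> i; have [df hf'] := hf.2 i; have [dg hg'] := hg.2 i.
have H x := is_derive_mul (derivableP (df x)) (derivableP (dg x)).
split=> [x|]; first by case: (H x).
rewrite (_ : pderiv i _ = fun x => pderiv i f x * g x + f x * pderiv i g x).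
  by apply: CkD; apply: IH => //; exact: CkW.
by apply/funext => x; apply: pderiv_val; exact: H.
Qed.

Lemma Ck_comp k (S : nat -> R -> R) n f :
  (forall n x, is_derive x (1 : R) (S n) (S n.+1 x)) -> smooth f ->
  Ck k (fun x => S n (f x)).
Proof.
move=> hS sf.
have cS m : continuous (fun x => S m (f x)).
  move=> x; apply: (@continuous_comp _ _ _ f (S m)).
    exact: smooth_continuous.
  by apply: differentiable_continuous; apply/derivable1_diffP; case: (hS m (f x)).
elim: k n => [|k IH] n //.
split => // i.
have H x := is_derive_comp (hS n (f x)) (smooth_is_derive i x sf).
split=> [x|]; first by case: (H x).
rewrite (_ : pderiv i _ = fun x => S n.+1 (f x) * pderiv i f x).
  by apply: CkM => //; exact: ((smoothP _).1 (smooth_pderiv i sf) k).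
by apply/funext => x; apply: pderiv_val; exact: H.
Qed.

Lemma smooth_cst (c : R) : smooth (fun _ : 'rV[R]_d => c).
Proof. by apply/smoothP => k; exact: Ck_cst. Qed.

Lemma smoothD f g : smooth f -> smooth g -> smooth (fun x => f x + g x).
Proof. by move=> /smoothP hf /smoothP hg; apply/smoothP => k; exact: CkD. Qed.

Lemma smoothM f g : smooth f -> smooth g -> smooth (fun x => f x * g x).
Proof. by move=> /smoothP hf /smoothP hg; apply/smoothP => k; exact: CkM. Qed.

Lemma smoothZ (c : R) f : smooth f -> smooth (fun x => c * f x).
Proof. by apply: smoothM; exact: smooth_cst. Qed.

Lemma smoothN f : smooth f -> smooth (fun x => - f x).
Proof.
by move=> /(smoothZ (-1)); congr smooth; apply/funext => x; rewrite mulN1r.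
Qed.

Lemma smoothB f g : smooth f -> smooth g -> smooth (fun x => f x - g x).
Proof. by move=> hf /smoothN; exact: smoothD. Qed.

Lemma smooth_comp (T : R -> R) f : smooth1 T -> smooth f ->
  smooth (fun x => T (f x)).
Proof.
by move=> [S [<- hS]] sf; apply/smoothP => k; exact: (Ck_comp k 0 hS sf).
Qed.

Lemma smooth_sum (I : Type) (r : seq I) (F : I -> 'rV[R]_d -> R) :
  (forall i, smooth (F i)) -> smooth (fun x => \sum_(i <- r) F i x).
Proof.
move=> hF; elim: r => [|i r IH].
  by under eq_fun do rewrite big_nil; exact: smooth_cst.
by under eq_fun do rewrite big_cons; exact: smoothD.
Qed.

Lemma smooth_prod (I : Type) (r : seq I) (F : I -> 'rV[R]_d -> R) :
  (forall i, smooth (F i)) -> smooth (fun x => \prod_(i <- r) F i x).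
Proof.
move=> hF; elim: r => [|i r IH].
  by under eq_fun do rewrite big_nil; exact: smooth_cst.
by under eq_fun do rewrite big_cons; exact: smoothM.
Qed.

Lemma is_derive_coord i j (x : 'rV[R]_d) :
  is_derive x (delta_mx 0 i) (fun y : 'rV[R]_d => y 0 j) ((i == j)%:R : R).
Proof.
have H : \forall h \near (0 : R)^',
    (i == j)%:R = h^-1 * ((h *: delta_mx 0 i + x) 0 j - x 0 j).
  near=> h; have h0 : h != 0 by near: h; exact: nbhs_dnbhs_neq.
  by rewrite !mxE eqxx /= addrK eq_sym mulrA mulVf// mul1r.
have := @cvg_cst _ ((i == j)%:R : R) _ (0 : R)^' (dnbhs_filter (0 : R)).
by move=> hc; apply: is_deriveP; move: hc; apply: cvg_trans; exact: (near_eq_cvg H).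
Unshelve. all: by end_near. Qed.

Lemma smooth_coord j : smooth (fun y : 'rV[R]_d => y 0 j).
Proof.
apply/smoothP => -[|k]; first exact: coord_continuous.
split; first exact: coord_continuous.
move=> i; split=> [x|]; first by case: (is_derive_coord i j x).
rewrite (_ : pderiv i _ = fun=> (i == j)%:R); first exact: Ck_cst.
by apply/funext => x; apply: pderiv_val; exact: is_derive_coord.
Qed.

Lemma pderivD i f g x : smooth f -> smooth g ->
  pderiv i (fun x => f x + g x) x = pderiv i f x + pderiv i g x.
Proof.
move=> sf sg; apply: pderiv_val.
by apply: is_derive_add; exact: smooth_is_derive.
Qed.

Lemma pderivM i f g x : smooth f -> smooth g ->
  pderiv i (fun x => f x * g x) x = pderiv i f x * g x + f x * pderiv i g x.
Proof.
move=> sf sg; apply: pderiv_val.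
by apply: is_derive_mul; exact: smooth_is_derive.
Qed.

Lemma pderiv_cst i (c : R) (x : 'rV[R]_d) : pderiv i (fun=> c) x = 0.
Proof. by apply: pderiv_val; exact: is_derive_cst. Qed.

Lemma pderivZ i (c : R) f x : smooth f ->
  pderiv i (fun x => c * f x) x = c * pderiv i f x.
Proof.
by move=> sf; rewrite (pderivM _ _ (smooth_cst c) sf) pderiv_cst mul0r add0r.
Qed.

Lemma pderivN i f x : smooth f -> pderiv i (fun x => - f x) x = - pderiv i f x.
Proof.
move=> sf; rewrite -mulN1r -(pderivZ _ _ _ sf); congr pderiv.
by apply/funext => y; rewrite mulN1r.
Qed.

Lemma pderivB i f g x : smooth f -> smooth g ->
  pderiv i (fun x => f x - g x) x = pderiv i f x - pderiv i g x.
Proof. by move=> sf sg; rewrite (pderivD _ _ sf (smoothN sg)) pderivN. Qed.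

Lemma pderiv_coord i j (x : 'rV[R]_d) :
  pderiv i (fun y : 'rV[R]_d => y 0 j) x = (i == j)%:R.
Proof. by apply: pderiv_val; exact: is_derive_coord. Qed.

Lemma pderiv_comp i (T T' : R -> R) f x :
  (forall y, is_derive y (1 : R) T (T' y)) -> smooth f ->
  pderiv i (fun x => T (f x)) x = T' (f x) * pderiv i f x.
Proof.
move=> hT sf; apply: pderiv_val.
by apply: is_derive_comp => //; exact: smooth_is_derive.
Qed.

Lemma test_smooth D f : test_function D f -> smooth f.
Proof. by case. Qed.

Lemma test_in_compact D f (C : set 'rV[R]_d) : smooth f -> compact C -> closed C ->
  C `<=` D -> (forall x, f x != 0 -> C x) -> test_function D f.
Proof.
move=> sf cC clC CD fC; have h : closure [set x | f x != 0] `<=` C.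
  have /closure_id -> := clC.
  by apply: closureS => x; exact: fC.
split => //; last exact: subset_trans CD.
by apply: subclosed_compact cC h; exact: closed_closure.
Qed.

Lemma test_sub D f phi : smooth f -> test_function D phi ->
  (forall x, f x != 0 -> phi x != 0) -> test_function D f.
Proof.
move=> sf [_ cphi sphi] h; apply: (test_in_compact sf cphi _ sphi).
  exact: closed_closure.
by move=> x /h ?; exact: subset_closure.
Qed.

Lemma test_mono D D' f : D `<=` D' -> test_function D f -> test_function D' f.
Proof. by move=> DD' [? ? ?]; split => //; exact: subset_trans DD'. Qed.

Lemma test_out D f x : test_function D f -> ~ D x -> f x = 0.
Proof.
move=> [_ _ h] Dx; apply/eqP/negPn/negP => fx; apply: Dx; apply: h.
exact: subset_closure.
Qed.

Lemma testMl D f phi : smooth f -> test_function D phi ->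
  test_function D (fun x => f x * phi x).
Proof.
move=> sf tp; apply: (test_sub (smoothM sf (test_smooth tp)) tp) => x.
by rewrite mulf_eq0 negb_or => /andP[].
Qed.

Lemma testZ D (c : R) phi : test_function D phi ->
  test_function D (fun x => c * phi x).
Proof. exact: testMl (smooth_cst c). Qed.

Lemma testD D f g : test_function D f -> test_function D g ->
  test_function D (fun x => f x + g x).
Proof.
move=> [sf cf fD] [sg cg gD].
pose C := closure [set x | f x != 0] `|` closure [set x | g x != 0].
apply: (@test_in_compact _ _ C); first exact: smoothD.
- exact: compactU.
- by apply: closedU; exact: closed_closure.
- by move=> x [/fD|/gD].
- move=> x fg; have [f0|f0] := eqVneq (f x) 0; last by left; exact: subset_closure.
  by right; apply: subset_closure => /=; move: fg; rewrite f0 add0r.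
Qed.

Lemma test0 D : test_function D (fun=> 0 : R).
Proof.
apply: (@test_in_compact _ _ set0) => //; first exact: smooth_cst.
- exact: compact0.
- exact: closed0.
- by move=> x; rewrite eqxx.
Qed.

Lemma test_pderiv D i f : test_function D f -> test_function D (pderiv i f).
Proof.
move=> tf; have [sf cf fD] := tf.
apply: (test_in_compact (smooth_pderiv i sf) cf _ fD); first exact: closed_closure.
move=> x dfx; apply: contrapT => xc.
have : \near x, (cst 0 : _ -> R) x = f x.
  have /(_ _ xc) : open (~` closure [set x | f x != 0]).
    by apply: closed_openC; exact: closed_closure.
  move=> h; near=> y; apply/esym/eqP/negPn/negP => fy.
  have : (~` closure [set x | f x != 0]) y by near: y; exact: h.
  by apply; exact: subset_closure.
move=> /near_eq_is_derive /(_ (is_derive_cst _ _ (delta_mx 0 i))) /pderiv_val fx0.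
by rewrite fx0 eqxx in dfx.
Unshelve. all: by end_near. Qed.

End smooth_calculus.

(** * Integration on R^d *)

Section measure_rV.
Context (R : realType).
Implicit Types (n : nat).

Lemma measurable_prod_set n (A : 'I_n -> set R) : (forall i, measurable (A i)) ->
  measurable [set x : 'rV[R]_n | forall i, A i (x ord0 i)].
Proof.
move=> mA; have -> : [set x : 'rV[R]_n | forall i, A i (x ord0 i)] =
    \bigcap_(i in [set: 'I_n]) (rV_coord i @^-1` A i).
  by apply/seteqP; split => x /= Ax i => [_|]; exact: Ax.
apply: fin_bigcap_measurable => // i _.
rewrite -[X in measurable X]setTI.
exact: (measurable_rV_coord i measurableT (mA i)).
Qed.

Definition cube n (M : R) : set 'rV[R]_n := [set x | forall i, - M <= x ord0 i <= M].
Arguments cube n M : clear implicits.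

Lemma cube_itv n M : cube n M =
  [set x | forall i, [set` `[- M, M]%R] (x ord0 i)].
Proof. by apply/seteqP; split => x hx i; have := hx i; rewrite /= in_itv. Qed.

Lemma measurable_cube n M : measurable (cube n M).
Proof. by rewrite cube_itv; apply: (@measurable_prod_set n (fun=> [set` `[- M, M]%R])). Qed.

Lemma lebesgue_cube_lty n M : (@lebesgue_rV R n (cube n M) < +oo)%E.
Proof.
rewrite cube_itv (lebesgue_rV_box (A := fun=> [set` `[- M, M]%R]))//.
suff : (0 <= \prod_(i < n) lebesgue_measure [set` `[- M, M]%R] < +oo)%E.
  by case/andP.
elim/big_ind : _ => [|x y /andP[x0 xy] /andP[y0 yy]|i _].
- by rewrite lee01 ltry.
- by rewrite mule_ge0//= lte_mul_pinfty// ge0_fin_numE.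
- by rewrite measure_ge0 lebesgue_measure_itv /=; case: ifP => _; rewrite ltry.
Qed.

Lemma compact_cube n M : compact (cube n M).
Proof.
rewrite cube_itv; apply: (@rV_compact _ _ (fun=> `[(- M), M]%classic)) => i.
exact: segment_compact.
Qed.

Lemma norm_rV_coord n (x : 'rV[R]_n) i : `|x ord0 i| <= `|x|.
Proof.
have /mapP[j Hj ->] : `|x ord0 i| \in [seq `|x v.1 v.2| | v : 'I_1 * 'I_n].
  by apply/mapP; exists (ord0, i) => //=; rewrite mem_enum.
by rewrite [leRHS]/Num.Def.normr /= mx_normrE; apply/bigmax_geP; right => /=; exists j.
Qed.

Lemma bounded_sub_cube n (A : set 'rV[R]_n) : bounded_set A ->
  exists2 M : R, 0 < M & A `<=` cube n M.
Proof.
move=> [M [_ MA]]; exists (`|M| + 1); first by rewrite ltr_wpDl.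
move=> x Ax i; rewrite -ler_norml; apply: le_trans (norm_rV_coord _ _) _.
by apply: MA => //; rewrite (le_lt_trans (ler_norm _))// ltrDl.
Qed.

(** Rational corners leave countably many boxes, so open sets are countable unions of them. The
    closed boxes [cbox] will contain the supports of test functions. *)
Definition obox n (q : {ffun 'I_n -> rat * rat}) : set 'rV[R]_n :=
  [set x | forall i, ratr (q i).1 < x ord0 i < ratr (q i).2].

Definition cbox n (q : {ffun 'I_n -> rat * rat}) : set 'rV[R]_n :=
  [set x | forall i, ratr (q i).1 <= x ord0 i <= ratr (q i).2].

Lemma obox_itv n q : @obox n q =
  [set x | forall i, [set` `]ratr (q i).1, ratr (q i).2[%R] (x ord0 i)].
Proof. by apply/seteqP; split => x hx i; have := hx i; rewrite /= in_itv. Qed.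

Lemma measurable_obox n q : measurable (@obox n q).
Proof. rewrite obox_itv.
exact: (@measurable_prod_set n (fun i => [set` `]ratr (q i).1, ratr (q i).2[%R])). Qed.

Lemma open_obox n (O : set 'rV[R]_n) x : open O -> O x ->
  exists q, obox q x /\ cbox q `<=` O.
Proof.
move=> oO Ox; have /nbhs_ballP[e /= e0 be] : nbhs x O by exact: open_nbhs_nbhs.
have /choice[q hq] : forall i : 'I_n, exists q : rat * rat,
    [/\ x ord0 i - e < ratr q.1, (ratr q.1 : R) < x ord0 i, x ord0 i < ratr q.2 &
      (ratr q.2 : R) < x ord0 i + e].
  move=> i.
  have /rat_in_itvoo[q1] : x ord0 i - e < x ord0 i by rewrite ltrBlDr ltrDl.
  have /rat_in_itvoo[q2] : x ord0 i < x ord0 i + e by rewrite ltrDl.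
  by rewrite !in_itv /= => /andP[? ?] /andP[? ?]; exists (q1, q2).
exists [ffun i => q i]; split.
  by move=> i; rewrite ffunE; have [_ -> -> _] := hq i.
move=> y hy; apply: be; split=> // i j; rewrite (ord1 i).
have := hy j; rewrite ffunE; have [h1 h2 h3 h4] := hq j => /andP[h5 h6].
rewrite /ball /= ltr_distlC; apply/andP; split.
  exact: lt_le_trans h1 h5.
exact: le_lt_trans h6 h4.
Qed.

Lemma open_bigcup_obox n (O : set 'rV[R]_n) : open O ->
  O = \bigcup_(q : {ffun 'I_n -> rat * rat}) [set x | obox q x /\ cbox q `<=` O].
Proof.
move=> oO; apply/seteqP; split => x.
  by move=> /(open_obox oO)[q hq]; exists q.
move=> [q _ [hx]]; apply=> i; have /andP[/ltW -> /ltW ->//] := hx i.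
Qed.

Lemma measurable_open_rV n (O : set 'rV[R]_n) : open O -> measurable O.
Proof.
move=> /open_bigcup_obox ->; apply: countable_bigcupT_measurable.
  exact: countableP.
move=> q; have [h|h] := pselect (cbox q `<=` O).
  rewrite (_ : [set x | _] = obox q); first exact: measurable_obox.
  by apply/seteqP; split => x //= [].
rewrite (_ : [set x | _] = set0) //.
by apply/seteqP; split => x //= [].
Qed.

Lemma continuous_measurable_rV n (f : 'rV[R]_n -> R) : continuous f ->
  measurable_fun [set: 'rV[R]_n] f.
Proof.
move=> cf; apply: (measurability _ (RGenOpens.measurableE R)) => _ [_ [a [b ->]] <-].
rewrite setTI; apply: measurable_open_rV.
by move/continuousP: cf; apply; exact: interval_open.
Qed.

Lemma bounded_cube_intg n (f : 'rV[R]_n -> R) (C M : R) :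
  measurable_fun [set: 'rV[R]_n] f -> (forall x, `|f x| <= C) ->
  (forall x, ~ cube n M x -> f x = 0) -> intg (@lebesgue_rV R n) f.
Proof.
move=> mf fC f0; have mQ := @measurable_cube n M.
have iQ : intg (@lebesgue_rV R n) (fun x => C * \1_(cube n M) x).
  apply: intgZ; apply/integrableP; split.
    by apply/measurable_EFinP; exact: measurable_indic.
  under eq_integral do rewrite /= ger0_norm//.
  by rewrite integral_indic// setIT; exact: lebesgue_cube_lty.
apply: intg_le iQ => // x; rewrite indicE.
have [xQ|xQ] := boolP (x \in cube n M).
  by rewrite mulr1 (le_trans (fC x))// ler_norm.
by rewrite f0 ?normr0// => h; move: xQ; rewrite mem_set.
Qed.

Lemma bounded_cube_sq n (f : 'rV[R]_n -> R) (C M : R) :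
  measurable_fun [set: 'rV[R]_n] f -> (forall x, `|f x| <= C) ->
  (forall x, ~ cube n M x -> f x = 0) -> sq (@lebesgue_rV R n) f.
Proof.
move=> mf fC f0; split => //.
apply: (@bounded_cube_intg _ _ (C ^+ 2) M); first exact: measurable_funX.
- by move=> x; rewrite normrX lerXn2r ?nnegrE// (le_trans _ (fC x)).
- by move=> x /f0 ->; rewrite expr0n.
Qed.

Lemma continuous_cube_bounded n (f : 'rV[R]_n -> R) (M : R) : continuous f ->
  (forall x, ~ cube n M x -> f x = 0) -> exists C, forall x, `|f x| <= C.
Proof.
move=> cf f0; have : compact (f @` cube n M).
  by apply: continuous_compact (@compact_cube n M); exact: continuous_subspaceT.
move=> /compact_bounded[C [_ HC]]; exists (`|C| + 1) => x.
have [Qx|Qx] := pselect (cube n M x).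
  apply: HC; last by exists x.
  by rewrite (le_lt_trans (ler_norm _))// ltrDl.
by rewrite f0// normr0 addr_ge0.
Qed.

Lemma rV_cons_continuous n (a : R) :
  continuous (fun x : 'rV[R]_n => rV_cons (a, x)).
Proof.
move=> x A /nbhs_ballP[e /= e0 eA]; apply/nbhs_ballP; exists e => // y [_ bxy].
apply: eA; split=> // i j; rewrite (ord1 i) !rV_consE.
by case: unliftP => [k _|_] /=; [exact: bxy|exact: ballxx].
Qed.

Lemma rV_cons_lift n (a h : R) (x : 'rV[R]_n) j :
  h *: delta_mx 0 (lift ord0 j) + rV_cons (a, x) =
  rV_cons (a, h *: delta_mx 0 j + x) :> 'rV[R]_n.+1.
Proof.
apply/rowP => k; rewrite mxE [X in X + _]mxE [X in _ * X + _]mxE !rV_consE.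
case: unliftP => [l ->|->] /=; first by rewrite !mxE (inj_eq lift_inj).
by rewrite ?andbF mulr0 add0r.
Qed.

Lemma rV_cons_head n (t : R) (x : 'rV[R]_n) :
  rV_cons (t, x) = t *: delta_mx 0 ord0 + rV_cons (0, x) :> 'rV[R]_n.+1.
Proof.
apply/rowP => k; rewrite [in RHS]mxE [X in X + _]mxE [X in _ * X + _]mxE !rV_consE.
case: unliftP => [l ->|->] /=; last by rewrite addr0 ?eqxx mulr1.
by rewrite ?andbF mulr0 add0r.
Qed.

Let quotient_rV_cons n (f : 'rV[R]_n.+1 -> R) (a : R) (x : 'rV[R]_n) j :
  (fun h => h^-1 *: (((fun y => f (rV_cons (a, y))) \o shift x)
     (h *: (delta_mx 0 j : 'rV[R]_n)) - f (rV_cons (a, x)))) =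
  (fun h => h^-1 *: ((f \o shift (rV_cons (a, x)))
     (h *: delta_mx 0 (lift ord0 j)) - f (rV_cons (a, x)))).
Proof. by apply/funext => h /=; rewrite rV_cons_lift. Qed.

Lemma pderiv_rV_cons n (f : 'rV[R]_n.+1 -> R) (a : R) (x : 'rV[R]_n) j :
  pderiv j (fun y => f (rV_cons (a, y))) x =
  pderiv (lift ord0 j) f (rV_cons (a, x)).
Proof. by rewrite /pderiv /derive quotient_rV_cons. Qed.

Lemma derivable_rV_cons n (f : 'rV[R]_n.+1 -> R) (a : R) (x : 'rV[R]_n) j :
  derivable f (rV_cons (a, x)) (delta_mx 0 (lift ord0 j)) ->
  derivable (fun y => f (rV_cons (a, y))) x (delta_mx 0 j).
Proof. by rewrite /derivable quotient_rV_cons. Qed.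

Lemma pderiv_out_cube n (f : 'rV[R]_n -> R) M i x :
  (forall x, ~ cube n M x -> f x = 0) -> ~ cube n M x -> pderiv i f x = 0.
Proof.
move=> f0 Qx; apply: pderiv_val.
have oQ : open (~` cube n M).
  by apply: closed_openC; apply: compact_closed => //; exact: compact_cube.
have H : \near x, (cst 0 : _ -> R) x = f x.
  have : nbhs x (~` cube n M) by exact: open_nbhs_nbhs.
  by apply: filterS => y /f0.
exact: (near_eq_is_derive H (is_derive_cst _ _ (delta_mx 0 i))).
Qed.

End measure_rV.
Arguments cube {R} n M.

(** * Integration by parts *)

Section integration_by_parts.
Context (R : realType).
Local Open Scope ereal_scope.

Lemma integrable_pushforward_comp d1 d2 (X : measurableType d1)
    (Y : measurableType d2) (phi : X -> Y) (mphi : measurable_fun [set: X] phi)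
    (m : {measure set X -> \bar R}) (f : Y -> \bar R) :
  measurable_fun [set: Y] f ->
  \int[pushforward m phi]_y `|f y| < +oo ->
  m.-integrable [set: X] (f \o phi).
Proof.
move=> mf foo; apply/integrableP; split; first exact: measurableT_comp.
by move: foo; rewrite ge0_integral_pushforward//; exact: measurableT_comp.
Qed.

Lemma integral_rV_cons n (g : 'rV[R]_n.+1 -> R) :
  intg (@lebesgue_rV R n.+1) g ->
  let G := fun p : measurableTypeR R * 'rV[R]_n => (g (rV_cons p))%:E in
  (@lebesgue_measure R \x @lebesgue_rV R n).-integrable [set: _] G /\
  \int[@lebesgue_rV R n.+1]_x (g x)%:E =
    \int[@lebesgue_measure R \x @lebesgue_rV R n]_p G p.
Proof.
move=> ig G; have mg : measurable_fun [set: 'rV[R]_n.+1] (EFin \o g).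
  exact: measurable_int ig.
have mc : measurable_fun [set: measurableTypeR R * 'rV[R]_n] rV_cons.
  exact: measurable_rV_cons.
have iG : (@lebesgue_measure R \x @lebesgue_rV R n).-integrable [set: _] G.
  move/integrableP : ig => [_ ig].
  exact: (integrable_pushforward_comp mc mg ig).
split => //.
exact: (@integral_pushforward _ _ _ _ _ _ mc
  (@lebesgue_measure R \x @lebesgue_rV R n) setT (EFin \o g) mg iG measurableT).
Qed.

Lemma integral_line_derivative (F f : R -> R) (M : R) : (0 < M)%R ->
  (forall t, is_derive t (1%R : R) F (f t)) -> continuous f ->
  (forall t, ~ (- M <= t <= M)%R -> F t = 0%R /\ f t = 0%R) ->
  \int[@lebesgue_measure R]_t (f t)%:E = 0.
Proof.
(* [F] is known to vanish only strictly outside [[-M, M]], so the endpoints are moved outwards. *)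
move=> M0 dF cf out; pose N := (M + 1)%R.
have MN : (M < N)%R by rewrite ltrDl.
have N0 : (- N < N)%R by apply: (@lt_trans _ _ 0%R); rewrite ?oppr_lt0 (lt_trans M0).
have [|FN _] := out N; first by rewrite (leNgt N) MN andbF.
have [|FNN _] := out (- N)%R; first by rewrite lerN2 leNgt MN.
have cF : continuous F.
  move=> t; apply: differentiable_continuous; apply/derivable1_diffP.
  by case: (dF t).
transitivity (\int[@lebesgue_measure R]_(t in `[(- N)%R, N]) (f t)%:E).
  rewrite [RHS]integral_mkcond; apply: eq_integral => t _.
  rewrite patchE; case: ifPn => // tN; have [] := out t.
    move=> /andP[h1 h2]; move/negP: tN; apply; rewrite inE /= in_itv /=.
    by rewrite (le_trans _ h1) ?lerN2 ?(le_trans h2)// ltW.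
  by move=> _ ->.
rewrite (@continuous_FTC2 _ f F)//.
- by rewrite FN FNN subee.
- exact: continuous_subspaceT.
- split; first by move=> t _; case: (dF t).
  + by apply: cvg_at_right_filter; exact: cF.
  + by apply: cvg_at_left_filter; exact: cF.
- by move=> t _; rewrite derive1E; case: (dF t).
Qed.

(** Fubini and induction on the dimension. If [i] is not the first coordinate, the integral over
    each slice vanishes by induction; otherwise one integrates along the first coordinate first and
    applies the fundamental theorem of calculus. *)
Lemma integral_pderiv n (f : 'rV[R]_n -> R) (i : 'I_n) (M : R) : (0 < M)%R ->
  (forall x, derivable f x (delta_mx 0%R i)) -> continuous (pderiv i f) ->
  (forall x, ~ cube n M x -> f x = 0%R) ->
  \int[@lebesgue_rV R n]_x (pderiv i f x)%:E = 0.
Proof.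
move=> M0; elim: n f i => [|n IH] f i df cf f0; first by case: (i).
have g0 x : ~ cube n.+1 M x -> pderiv i f x = 0%R by exact: pderiv_out_cube.
have [C gC] := continuous_cube_bounded cf g0.
have ig : intg (@lebesgue_rV R n.+1) (pderiv i f).
  exact: (bounded_cube_intg (continuous_measurable_rV cf) gC g0).
have [iG ->] := integral_rV_cons ig.
case: (unliftP ord0 i) => [j ij|i0].
  rewrite -integral12_prod_meas1//; apply: integral0_eq => a _.
  rewrite /fubini_F (eq_integral
    (fun y => (pderiv j (fun y => f (rV_cons (a, y))) y)%:E)); last first.
    by move=> y _; rewrite pderiv_rV_cons -ij.
  apply: IH.
  - by move=> x; apply: derivable_rV_cons; rewrite -ij.
  - rewrite (_ : pderiv j _ = fun y => pderiv i f (rV_cons (a, y))).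
      move=> x; apply: (@continuous_comp _ _ _ (fun y => rV_cons (a, y)) (pderiv i f)).
        exact: rV_cons_continuous.
      exact: cf.
    by apply/funext => y; rewrite pderiv_rV_cons -ij.
  - move=> x Qx; apply: f0 => Q; apply: Qx => k.
    by have := Q (lift ord0 k); rewrite rV_consE liftK.
rewrite -integral21_prod_meas1//; apply: integral0_eq => x _.
rewrite /fubini_G /=.
apply: (@integral_line_derivative (fun t => f (rV_cons (t, x)))
  (fun t => pderiv i f (rV_cons (t, x))) M M0).
- move=> t; rewrite (_ : (fun t => f _) =
    fun t => f (t *: delta_mx 0 ord0 + rV_cons (0%R, x))%R); last first.
    by apply/funext => s; rewrite rV_cons_head.
  apply: is_derive_line; rewrite -rV_cons_head -i0.
  exact: derivableP.
- move=> t; apply: (@continuous_comp _ _ _ (fun t => rV_cons (t, x)) (pderiv i f)).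
    rewrite (_ : (fun t => rV_cons (t, x)) =
      fun t => (t *: delta_mx 0 ord0 + rV_cons (0, x))%R : 'rV[R]_n.+1); last first.
      by apply/funext => s; rewrite rV_cons_head.
    apply: cvgD; last exact: cvg_cst.
    exact: scalel_continuous.
  exact: cf.
- move=> t tM; have Q : ~ cube n.+1 M (rV_cons (t, x)).
    by move=> /(_ ord0); rewrite rV_consE unlift_none.
  by rewrite f0// g0.
Qed.

End integration_by_parts.

Section test_integrals.
Context (R : realType) (d : nat).
Local Notation mu := (@lebesgue_rV R d).
Implicit Types (f g phi : 'rV[R]_d -> R) (D : set 'rV[R]_d).

Lemma test_cube D phi : test_function D phi ->
  exists2 M : R, 0 < M & forall x, ~ cube d M x -> phi x = 0.
Proof.
move=> [_ /compact_bounded /bounded_sub_cube[M M0 hM] _]; exists M => //.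
move=> x Qx; apply/eqP/negPn/negP => px; apply: Qx; apply: hM.
exact: subset_closure.
Qed.

Lemma test_continuous D phi : test_function D phi -> continuous phi.
Proof. by move=> /test_smooth /smooth_continuous. Qed.

Lemma test_sq D phi : test_function D phi -> sq mu phi.
Proof.
move=> tp; have [M M0 hM] := test_cube tp; have cp := test_continuous tp.
have [C hC] := continuous_cube_bounded cp hM.
exact: (bounded_cube_sq (continuous_measurable_rV cp) hC hM).
Qed.

Lemma test_intg D phi : test_function D phi -> intg mu phi.
Proof.
move=> tp; have [M M0 hM] := test_cube tp; have cp := test_continuous tp.
have [C hC] := continuous_cube_bounded cp hM.
exact: (bounded_cube_intg (continuous_measurable_rV cp) hC hM).
Qed.

Lemma Rintegral_test_pderiv D phi i : test_function D phi ->
  \int[mu]_x pderiv i phi x = 0.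
Proof.
move=> tp; have [M M0 hM] := test_cube tp.
rewrite /Rintegral (integral_pderiv M0)//; last first.
- exact: test_continuous (test_pderiv i tp).
- move=> x; case: (smooth_is_derive i x (test_smooth tp)); by [].
Qed.

Lemma integration_by_parts D f phi i : smooth f -> test_function D phi ->
  \int[mu]_x (f x * pderiv i phi x) = - \int[mu]_x (pderiv i f x * phi x).
Proof.
move=> sf tp; have h := Rintegral_test_pderiv i (testMl sf tp).
have sp := test_smooth tp.
move: h; under eq_Rintegral do rewrite (pderivM _ _ sf sp).
rewrite RintegralD//.
- by move/eqP; rewrite addrC addr_eq0 => /eqP.
- exact: test_intg (testMl (smooth_pderiv i sf) tp).
- exact: test_intg (testMl sf (test_pderiv i tp)).
Qed.

End test_integrals.

(** The sets over which [h] has integral 0 form a Dynkin class, so by the pi-lambda theorem they are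
    all the measurable sets. *)
Lemma ae0_of_pi_system d (T : measurableType d) (R : realType)
    (mu : {measure set T -> \bar R}) (G : set (set T)) (h : T -> R) :
  @measurable _ T = <<s G >> -> setI_closed G -> intg mu h ->
  (\int[mu]_x (h x)%:E = 0)%E ->
  (forall A, G A -> (\int[mu]_(x in A) (h x)%:E = 0)%E) ->
  {ae mu, forall x, h x = 0}.
Proof.
move=> mG GI ih hT hG.
have key : forall S, <<s G >> S -> (\int[mu]_(x in S) (h x)%:E = 0)%E.
  apply: (dynkin_induction mG GI hT hG) => [S mS hS|F mF tF hF].
    have mS' := measurableC mS.
    have := @integral_setU _ _ _ mu _ _ (EFin \o h) mS mS'.
    rewrite setUCr hT hS add0e => <- //; first exact: measurable_int ih.
    by apply/disj_setPCl.
  rewrite integral_bigcup//; first by apply: eseries0 => k _ _; exact: hF.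
  by apply: integrableS ih => //; exact: bigcupT_measurable.
have := @integral_ae_eq _ _ _ mu setT measurableT (cst 0%E) _ ih (measurable_cst _).
move=> H; have {H} : ae_eq mu setT (EFin \o h) (cst 0%E).
  by apply: H => E _ mE; rewrite integral0; apply: key; rewrite -mG.
by apply: filterS => x /(_ I) [].
Qed.

(** * The fundamental lemma of the calculus of variations *)

Section fundamental_lemma.
Context (R : realType) (d : nat).
Local Notation mu := (@lebesgue_rV R d).
Implicit Types (f g h phi : 'rV[R]_d -> R) (D : set 'rV[R]_d).

Local Definition boxes : set (set 'rV[R]_d) := [set @obox R d q | q in setT].

(** The inclusion of closed boxes keeps the intersection admissible in [integral_obox0], which asks
    for a closed box inside [D]. *)
Lemma obox_setI (q q' : {ffun 'I_d -> rat * rat}) : exists p,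
  @obox R d p = obox q `&` obox q' /\ @cbox R d p `<=` cbox q.
Proof.
exists [ffun i => (Num.max (q i).1 (q' i).1, Num.min (q i).2 (q' i).2)].
have ratr_max (a b : rat) : ratr (Num.max a b) = Num.max (ratr a) (ratr b) :> R.
  by rewrite /Order.max ltr_rat; case: ifP.
have ratr_min (a b : rat) : ratr (Num.min a b) = Num.min (ratr a) (ratr b) :> R.
  by rewrite /Order.min ltr_rat; case: ifP.
split.
  apply/seteqP; split => x.
    move=> hx; split => i; have := hx i; rewrite ffunE /= ratr_max ratr_min.
      by rewrite gt_max lt_min => /andP[/andP[-> _] /andP[-> _]].
    by rewrite gt_max lt_min => /andP[/andP[_ ->] /andP[_ ->]].
  move=> [h1 h2] i; rewrite ffunE /= ratr_max ratr_min gt_max lt_min.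
  by have /andP[-> ->] := h1 i; have /andP[-> ->] := h2 i.
move=> x hx i; have := hx i; rewrite ffunE /= ratr_max ratr_min.
by rewrite ge_max le_min => /andP[/andP[-> _] /andP[-> _]].
Qed.

Lemma measurable_boxes : @measurable _ 'rV[R]_d = <<s boxes >>.
Proof.
apply/seteqP; split => A.
  (* Applied to the identity out of the space equipped with the sigma-algebra of boxes: only the
     coordinates have to be checked. *)
  move=> mA; have := @measurable_fun_rV _ (measurableTypeR R) d _
    (g_sigma_algebraType boxes) id _ measurableT A mA.
  rewrite setTI; apply => i.
  apply: (measurability _ (RGenOpens.measurableE R)) => _ [_ [a [b ->]] <-].
  rewrite setTI; set O := _ @^-1` _.
  have oO : open (O : set 'rV[R]_d).
    have /continuousP := @coord_continuous R 1 d ord0 i.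
    by apply; exact: interval_open.
  rewrite (open_bigcup_obox oO).
  apply: countable_bigcupT_measurable; first exact: countableP.
  move=> q; have [h|h] := pselect (cbox q `<=` O).
    rewrite (_ : [set x | _] = obox q); last by apply/seteqP; split => x //= [].
    by apply: sub_sigma_algebra; exists q.
  rewrite (_ : [set x | _] = set0); last by apply/seteqP; split => x //= [].
  exact: measurable0.
move: A; apply: smallest_sub; first exact: sigma_algebra_measurable.
by move=> _ [q _ <-]; exact: measurable_obox.
Qed.

Lemma boxes_setI_closed : setI_closed boxes.
Proof. by move=> _ _ [q _ <-] [q' _ <-]; have [p [<- _]] := obox_setI q q'; exists p. Qed.

Lemma closed_cbox (q : {ffun 'I_d -> rat * rat}) : closed (@cbox R d q) /\ compact (@cbox R d q).
Proof.
have : compact (@cbox R d q).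
  rewrite (_ : cbox q = [set x : 'rV[R]_d | forall i,
      [set` `[ratr (q i).1, ratr (q i).2]%R] (x ord0 i)]).
    apply: (@rV_compact R d (fun i => `[(ratr (q i).1 : R), ratr (q i).2]%classic)).
    by move=> i; exact: segment_compact.
  by apply/seteqP; split => x hx i; have := hx i; rewrite /= in_itv.
by move=> cq; split => //; apply: compact_closed.
Qed.

(* [flat 1 (k * box_bump q)] increases to the indicator of [obox q] as k -> oo. *)
Definition box_bump (q : {ffun 'I_d -> rat * rat}) (x : 'rV[R]_d) : R :=
  \prod_(i < d) (flat 1 (x ord0 i - ratr (q i).1) * flat 1 (ratr (q i).2 - x ord0 i)).

Lemma flat1_gt0 (x : R) : (0 < flat 1 x) = (0 < x).
Proof. by rewrite /flat; case: ifP => // x0; rewrite ?ltxx// hornerC mul1r expR_gt0. Qed.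

Lemma flat1_ge0 (x : R) : 0 <= flat 1 x.
Proof. by rewrite /flat; case: ifP => // x0; rewrite hornerC mul1r expR_ge0. Qed.

Lemma flat1_le1 (x : R) : flat 1 x <= 1.
Proof.
rewrite /flat; case: ifP => // x0; rewrite hornerC mul1r -expR0 ler_expR.
by rewrite oppr_le0 invr_ge0 ltW.
Qed.

Lemma box_bump_ge0 q x : 0 <= box_bump q x.
Proof. by apply: prodr_ge0 => i _; rewrite mulr_ge0 ?flat1_ge0. Qed.

Lemma box_bumpP q x : 0 < box_bump q x <-> obox q x.
Proof.
split=> [|hx].
  rewrite lt_neqAle box_bump_ge0 andbT eq_sym => /prodf_neq0 h i.
  have := h i isT; rewrite mulf_eq0 negb_or => /andP[].
  rewrite !neq_lt !flat1_gt0 !subr_gt0.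
  by rewrite !(ltNge (flat _ _)) !flat1_ge0 /= => -> ->.
apply: prodr_gt0 => i _; have /andP[h1 h2] := hx i.
by rewrite mulr_gt0// flat1_gt0 subr_gt0.
Qed.

Lemma smooth_box_bump q : smooth (box_bump q).
Proof.
apply: smooth_prod => i; apply: smoothM; apply: smooth_comp (smooth1_flat 1) _.
  by apply: smoothB; [exact: smooth_coord|exact: smooth_cst].
by apply: smoothB; [exact: smooth_cst|exact: smooth_coord].
Qed.

Lemma sq_obox q : sq mu (\1_(obox q) : 'rV[R]_d -> R).
Proof.
have [M M0 hM] := bounded_sub_cube (compact_bounded (closed_cbox q).2).
apply: (@bounded_cube_sq _ _ _ 1 M).
- by apply: measurable_indic; exact: measurable_obox.
- by move=> x; rewrite indicE; case: (_ \in _); rewrite ?normr1 ?normr0.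
- move=> x Qx; rewrite indicE memNset// => hx; apply: Qx; apply: hM => i.
  by have /andP[/ltW -> /ltW ->] := hx i.
Qed.

(** Dominated convergence: the test functions [phi k] lie between 0 and the indicator of the box and
    converge to it. *)
Lemma integral_obox0 D h q : sq mu h -> @cbox R d q `<=` D ->
  (forall phi, test_function D phi -> \int[mu]_x (h x * phi x) = 0) ->
  (\int[mu]_x (h x * \1_(obox q) x)%:E = 0)%E.
Proof.
move=> sh qD hphi.
pose phi k x := flat 1 (k%:R * box_bump q x).
have tphi k : test_function D (phi k).
  have [clq cq] := closed_cbox q; apply: (test_in_compact _ cq clq qD).
    by apply: smooth_comp (smooth1_flat 1) _; apply: smoothZ; exact: smooth_box_bump.
  move=> x; rewrite /phi neq_lt (ltNge (flat _ _)) flat1_ge0 /= flat1_gt0.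
  move=> hp; have /box_bumpP hx : 0 < box_bump q x.
    rewrite lt_neqAle box_bump_ge0 andbT eq_sym; apply/eqP => b0.
    by rewrite b0 mulr0 ltxx in hp.
  by move=> i; have /andP[/ltW -> /ltW ->] := hx i.
have hk k : (\int[mu]_x (h x * phi k x)%:E = 0)%E.
  by rewrite intg_fin ?hphi//; apply: sqM => //; exact: test_sq (tphi k).
have phi_cvg x : phi ^~ x @ \oo --> (\1_(obox q) x : R).
  rewrite indicE; have [hx|hx] := boolP (x \in obox q).
    move: hx; rewrite inE => /box_bumpP b0.
    (* [phi 0] is identically 0; the closed form below is valid from index 1 on. *)
    rewrite -(@cvg_shiftS _).
    rewrite (_ : (fun n => phi n.+1 x) = fun n => expR (- (box_bump q x)^-1 * n.+1%:R^-1)).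
      rewrite (_ : true%:R = expR (- (box_bump q x)^-1 * 0)); last first.
        by rewrite mulr0 expR0.
      apply: continuous_cvg; first exact: continuous_expR.
      by apply: cvgM; [exact: cvg_cst|exact: cvg_harmonic].
    apply/funext => n; rewrite /phi /flat mulr_gt0// hornerC mul1r.
    by rewrite invfM mulrC mulNr.
  rewrite (_ : phi ^~ x = cst 0); first exact: cvg_cst.
  apply/funext => k; rewrite /phi /flat; case: ifP => // hp; move: hx; rewrite mem_set//.
  apply/box_bumpP; rewrite lt_neqAle box_bump_ge0 andbT eq_sym; apply/eqP => b0.
  by rewrite b0 mulr0 ltxx in hp.
have so := sq_obox q.
have [| | | | |_ _ H] := @dominated_convergence _ _ _ mu setT measurableT
  (fun k x => (h x * phi k x)%:E) (fun x => (h x * \1_(obox q) x)%:E)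
  (fun x => (`|h x * \1_(obox q) x|)%:E).
- move=> k; apply/measurable_EFinP; apply: measurable_funM; first exact: sq_meas sh.
  exact: sq_meas (test_sq (tphi k)).
- by apply/measurable_EFinP/measurable_funM; [exact: sq_meas sh|exact: sq_meas so].
- apply: aeW => x _; apply: cvg_EFin; first exact: nearW.
  by apply: cvgM; [exact: cvg_cst|exact: phi_cvg].
- by apply: integrable_norm; exact: sqM.
- apply: aeW => x k _; rewrite lee_fin !normrM ler_wpM2l//.
  rewrite indicE; have [hx|hx] := boolP (x \in obox q).
    by rewrite normr1 /phi ger0_norm ?flat1_ge0// flat1_le1.
  rewrite /phi /flat; case: ifP => [hp|_]; last first.
    by rewrite normr0 lexx.
  move: hx; rewrite mem_set//.
  apply/box_bumpP; rewrite lt_neqAle box_bump_ge0 andbT eq_sym; apply/eqP => b0.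
  by rewrite b0 mulr0 ltxx in hp.
move: H; rewrite (_ : [sequence _]_n = cst 0%E); last first.
  by apply/funext => n /=; rewrite hk.
move=> H; apply/esym; apply: (cvg_unique _ _ H); first exact: ereal_hausdorff.
exact: cvg_cst.
Qed.

(** On a rational box with closure in [D], the pi-system argument applies to [h] times the indicator
    of the box; countably many such boxes cover [D]. *)
Theorem fundamental_lemma D h : open D -> sq mu h ->
  (forall phi, test_function D phi -> \int[mu]_x (h x * phi x) = 0) ->
  {ae mu, forall x, D x -> h x = 0}.
Proof.
move=> oD sh hphi.
have loc q : @cbox R d q `<=` D -> {ae mu, forall x, obox q x -> h x = 0}.
  move=> qD.
  have : {ae mu, forall x, h x * \1_(obox q) x = 0}.
    apply: (ae0_of_pi_system measurable_boxes boxes_setI_closed).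
    - by apply: sqM => //; exact: sq_obox.
    - exact: integral_obox0 sh qD hphi.
    move=> _ [q' _ <-]; have [p [pE pq]] := obox_setI q q'.
    rewrite integral_mkcond -[RHS](integral_obox0 sh (subset_trans pq qD) hphi).
    apply: eq_integral => x _; rewrite patchE pE indicI /=.
    case: ifPn => hx; first by rewrite !indicE hx mulr1.
    by rewrite !indicE (negbTE hx) !mulr0.
  by apply: filterS => x hx xq; move: hx; rewrite indicE mem_set// mulr1.
(* [unpickle] enumerates the boxes, so that countably many null sets can be discarded together; an
   index that codes no box contributes [True]. *)
have : {ae mu, forall x (n : nat), oapp (fun q : {ffun 'I_d -> rat * rat} =>
    @cbox R d q `<=` D -> obox q x -> h x = 0) True (unpickle n)}.
  apply/ae_foralln => n; case: unpickle => [q|] /=; last exact: aeW.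
  have [qD|qD] := pselect (@cbox R d q `<=` D); last exact: aeW.
  by apply: filterS (loc q qD) => x hx _.
apply: filterS => x hx Dx; have [q [xq qD]] := open_obox oD Dx.
by have := hx (pickle q); rewrite pickleK /=; exact.
Qed.

End fundamental_lemma.

(** * Jets and Sobolev spaces *)

Lemma ip_lin2 d (T : measurableType d) (R : realType)
    (mu : {measure set T -> \bar R}) (a : R) (f g : T -> R) :
  sq mu f -> sq mu g ->
  ip mu (fun x => a * f x + g x) (fun x => a * f x + g x) =
  a ^+ 2 * ip mu f f + 2 * a * ip mu f g + ip mu g g.
Proof.
move=> hf hg; have hh := sqD (sqZ a hf) hg; set h := fun x => _ in hh *.
rewrite {1}/h ip_linl// (ipC _ f h) (ipC _ g h) {1 2}/h !ip_linl//.
by rewrite (ipC _ g f); ring.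
Qed.

Lemma ip_semi_inner d (T : measurableType d) (R : realType)
    (mu : {measure set T -> \bar R}) : semi_inner (sq mu : set (T -> R)) (ip mu).
Proof.
split; first exact: sq0.
- by move=> a u w hu hw; exact: sqD (sqZ a hu) hw.
- by move=> u w _ _; exact: ipC.
- by move=> a u w z hu hw hz; exact: ip_linl.
- by move=> u _; exact: ip_ge0.
Qed.

Section jets.
Context (R : realType) (d : nat).
Local Notation mu := (@lebesgue_rV R d).
Local Notation V := (option 'I_d -> 'rV[R]_d -> R).
Implicit Types (f g h phi : 'rV[R]_d -> R) (D : set 'rV[R]_d) (F G H : V).

(* An element of H^1 is handled together with its gradient, as a family indexed
   by [option 'I_d]: [None] is the function, [Some i] its i-th derivative.  The
   jets in [clos D] are the elements of H^1_0(D), up to null sets. *)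
Definition vsq : set V := [set F | forall o, sq mu (F o)].
Definition dirichlet F G : R := \sum_(i < d) ip mu (F (Some i)) (G (Some i)).
Definition sobolev F G : R := ip mu (F None) (G None) + dirichlet F G.
Definition jet phi : V := fun o => if o is Some i then pderiv i phi else phi.

Lemma vsq_closed a F G : vsq F -> vsq G -> vsq (a *: F + G).
Proof. by move=> hF hG o; exact: sqD (sqZ a (hF o)) (hG o). Qed.

Lemma vsq0 : vsq 0.
Proof. by move=> o; exact: sq0. Qed.

Lemma dirichlet_semi_inner : semi_inner vsq dirichlet.
Proof.
split; [exact: vsq0|exact: vsq_closed| | |].
- by move=> F G _ _; apply: eq_bigr => i _; rewrite ipC.
- move=> a F G H hF hG hH; rewrite /dirichlet mulr_sumr -big_split/=.
  by apply: eq_bigr => i _; exact: ip_linl.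
- by move=> F _; apply: sumr_ge0 => i _; exact: ip_ge0.
Qed.

Lemma sobolev_semi_inner : semi_inner vsq sobolev.
Proof.
have [_ _ Ds Dl Dp] := dirichlet_semi_inner.
split; [exact: vsq0|exact: vsq_closed| | |].
- by move=> F G hF hG; rewrite /sobolev Ds// ipC.
- move=> a F G H hF hG hH; rewrite /sobolev Dl// mulrDr.
  have -> : ip mu ((a *: F + G) None) (H None) =
    a * ip mu (F None) (H None) + ip mu (G None) (H None) by exact: ip_linl.
  by ring.
- by move=> F hF; rewrite addr_ge0 ?ip_ge0// Dp.
Qed.

Lemma vsqB F G : vsq F -> vsq G -> vsq (F - G).
Proof. exact: semi_innerB sobolev_semi_inner _ _. Qed.

Lemma vsqD F G : vsq F -> vsq G -> vsq (F + G).
Proof. exact: semi_innerD sobolev_semi_inner _ _. Qed.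

Lemma sobolev_ge0 F : vsq F -> 0 <= sobolev F F.
Proof. exact: form_ge0 sobolev_semi_inner _. Qed.

Lemma dirichlet_ge0 F : 0 <= dirichlet F F.
Proof. by apply: sumr_ge0 => i _; exact: ip_ge0. Qed.

Lemma dirichlet_le_sobolev F : dirichlet F F <= sobolev F F.
Proof. by rewrite /sobolev lerDr ip_ge0. Qed.

Lemma ip_le_sobolev F o : ip mu (F o) (F o) <= sobolev F F.
Proof.
case: o => [i|]; last by rewrite /sobolev lerDl dirichlet_ge0.
apply: le_trans (dirichlet_le_sobolev F); rewrite /dirichlet (bigD1 i)//= lerDl.
by apply: sumr_ge0 => j _; exact: ip_ge0.
Qed.

Lemma sobolev_complete (u : nat -> V) : (forall n, vsq (u n)) ->
  (forall e, 0 < e -> exists N, forall m n, (N <= m)%N -> (N <= n)%N ->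
     sobolev (u m - u n) (u m - u n) <= e) ->
  exists F, vsq F /\ forall e, 0 < e -> exists N, forall n, (N <= n)%N ->
     sobolev (u n - F) (u n - F) <= e.
Proof.
move=> hu cu.
have /choice[F HF] : forall o, exists f, sq mu f /\ forall e, 0 < e -> exists N,
    forall n, (N <= n)%N -> ip mu (u n o \- f) (u n o \- f) <= e.
  move=> o; apply: sq_complete => [n|e e0]; first exact: hu.
  have [N HN] := cu e e0; exists N => m n Nm Nn.
  exact: le_trans (ip_le_sobolev (u m - u n) o) (HN _ _ Nm Nn).
exists F; split => [k|e e0]; first by have [] := HF k.
pose e' := e / d.+1%:R.
have e'0 : 0 < e' by rewrite divr_gt0.
have /choice[N HN] : forall o, exists N, forall n, (N <= n)%N ->
    ip mu (u n o \- F o) (u n o \- F o) <= e'.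
  by move=> o; have [_] := HF o; apply.
exists (\max_o N o)%N => n Nn.
have HN' o : ip mu (u n o \- F o) (u n o \- F o) <= e'.
  by apply: HN; apply: leq_trans Nn; exact: leq_bigmax.
rewrite /sobolev (_ : e = e' + \sum_(i < d) e'); last first.
  rewrite sumr_const card_ord -mulrS -[in RHS]mulr_natr /e' divfK//.
apply: lerD; first exact: (HN' None).
by apply: ler_sum => i _; exact: (HN' (Some i)).
Qed.

Lemma vsq_jet D phi : test_function D phi -> vsq (jet phi).
Proof.
by move=> tp [i|] /=; [exact: test_sq (test_pderiv i tp)|exact: test_sq tp].
Qed.

Lemma jet_out D phi o x : test_function D phi -> ~ D x -> jet phi o x = 0.
Proof.
move=> tp Dx; case: o => [i|]; last exact: test_out tp Dx.
exact: test_out (test_pderiv i tp) Dx.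
Qed.

Lemma jet_linear a f g : smooth f -> smooth g ->
  jet (fun x => a * f x + g x) = a *: jet f + jet g.
Proof.
move=> sf sg; apply/funext => -[i|//]; apply/funext => x.
rewrite /= (pderivD _ _ (smoothZ a sf) sg) pderivZ//.
Qed.

Definition clos D : set V := [set F | vsq F /\ forall e, 0 < e ->
  exists phi, test_function D phi /\ sobolev (F - jet phi) (F - jet phi) <= e].

Lemma clos_vsq D F : clos D F -> vsq F.
Proof. by case. Qed.

Lemma clos_jet D phi : test_function D phi -> clos D (jet phi).
Proof.
move=> tp; split; first exact: vsq_jet tp.
move=> e e0; exists phi; split => //; rewrite subrr.
by rewrite (form0l sobolev_semi_inner vsq0) ltW.
Qed.

Lemma clos_closed D F : vsq F -> (forall e, 0 < e -> exists G, clos D G /\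
  sobolev (F - G) (F - G) <= e) -> clos D F.
Proof.
move=> hF h; split => // e e0; have e4 : 0 < e / 4 by rewrite divr_gt0.
have [G [[hG hG'] FG]] := h _ e4; have [phi [tp Gp]] := hG' _ e4.
have hp := vsq_jet tp; exists phi; split => //.
rewrite (_ : F - jet phi = (F - G) + (G - jet phi)); last by rewrite addrA subrK.
apply: le_trans (form_sqrD_le sobolev_semi_inner (vsqB hF hG) (vsqB hG hp)) _.
lra.
Qed.

Lemma clos_linear D a F G : clos D F -> clos D G -> clos D (a *: F + G).
Proof.
move=> [hF hF'] [hG hG']; split; first exact: vsq_closed.
move=> e e0; pose c := 4 * (a ^+ 2 + 1).
have c0 : 0 < c by rewrite mulr_gt0// ltr_wpDl ?sqr_ge0.
have ec : 0 < e / c by rewrite divr_gt0.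
have [p [tp Fp]] := hF' _ ec; have [q [tq Gq]] := hG' _ ec.
have hp := vsq_jet tp; have hq := vsq_jet tq.
exists (fun x => a * p x + q x); split; first exact: testD (testZ a tp) tq.
rewrite (jet_linear _ (test_smooth tp) (test_smooth tq)).
rewrite (_ : _ - _ = a *: (F - jet p) + (G - jet q)); last first.
  by rewrite scalerBr opprD addrACA.
have hP := sobolev_semi_inner; have hFp := vsqB hF hp.
have haFp := semi_innerZ hP a hFp.
apply: le_trans (form_sqrD_le hP haFp (vsqB hG hq)) _.
rewrite (formZl hP)// (formZr hP)//.
have : (a ^+ 2 + 1) * (e / c) = e / 4 by rewrite /c; field; rewrite gt_eqF// ltr_wpDl ?sqr_ge0.
have := sobolev_ge0 hFp; have := sqr_ge0 a.
move: (e / c) Fp Gq => k; move: (sobolev _ _) (sobolev _ _) => s t; nra.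
Qed.

Lemma clos0 D : clos D 0.
Proof.
split; first exact: vsq0.
move=> e e0; exists (fun=> 0); split; first exact: test0.
rewrite (_ : 0 - _ = 0) ?(form0l sobolev_semi_inner vsq0) ?ltW//.
rewrite sub0r; apply/eqP; rewrite oppr_eq0; apply/eqP.
by apply/funext => -[i|//]; apply/funext => x; rewrite /= pderiv_cst.
Qed.

Lemma clos_semi_inner D B : semi_inner vsq B -> semi_inner (clos D) B.
Proof.
move=> [_ _ Bs Bl Bp]; split.
- exact: clos0.
- by move=> *; exact: clos_linear.
- by move=> u v /clos_vsq hu /clos_vsq hv; exact: Bs.
- by move=> a u v w /clos_vsq hu /clos_vsq hv /clos_vsq hw; exact: Bl.
- by move=> u /clos_vsq hu; exact: Bp.
Qed.

Lemma closB D F G : clos D F -> clos D G -> clos D (F - G).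
Proof. exact: semi_innerB (clos_semi_inner D sobolev_semi_inner) _ _. Qed.

Lemma clos_mono D D' F : D `<=` D' -> clos D F -> clos D' F.
Proof.
move=> DD' [hF h]; split => // e e0; have [p [tp ?]] := h e e0.
by exists p; split => //; exact: test_mono tp.
Qed.

(** Density: if [jet phi] is close to [F], Cauchy-Schwarz bounds
    [sobolev F H = sobolev (F - jet phi) H]. *)
Lemma clos_ortho D H F : vsq H ->
  (forall phi, test_function D phi -> sobolev (jet phi) H = 0) ->
  clos D F -> sobolev F H = 0.
Proof.
move=> hH h [hF hF'].
suff : sobolev F H ^+ 2 = 0 by move/eqP; rewrite expf_eq0/= => /eqP.
apply: (@eq0_small _ _ (sobolev H H)).
- exact: sqr_ge0.
- exact: sobolev_ge0.
move=> e e0; have [p [tp Fp]] := hF' e e0; have hp := vsq_jet tp.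
have hP := sobolev_semi_inner.
have -> : sobolev F H = sobolev (F - jet p) H by rewrite (formBl hP)// h// subr0.
apply: le_trans (cauchy_schwarz hP (vsqB hF hp) hH) _.
by apply: ler_wpM2r => //; exact: sobolev_ge0.
Qed.

(** Outside [D], [F] coincides with [F - jet phi] for every test function [phi], and this difference
    can be made arbitrarily small in L^2. *)
Lemma clos_ae_out D F o : open D -> clos D F -> {ae mu, forall x, ~ D x -> F o x = 0}.
Proof.
move=> oD [hF hF']; pose h x := \1_(~` D) x * F o x.
have mD : measurable (~` D) by apply: measurableC; exact: measurable_open_rV.
have m1 : measurable_fun [set: 'rV[R]_d] (\1_(~` D) : 'rV[R]_d -> R) by exact: measurable_indic.
have b1 x : `|\1_(~` D) x : R| <= 1.
  by rewrite indicE; case: (_ \in _); rewrite ?normr1 ?normr0.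
have sh : sq mu h by apply: sqMb m1 b1 (hF o).
have : ip mu h h = 0.
  apply: (@eq0_small _ _ 1) => //; first exact: ip_ge0.
  move=> e e0; have [p [tp Fp]] := hF' e e0; rewrite mulr1; apply: le_trans Fp.
  apply: le_trans (ip_le_sobolev _ o).
  have hp := vsqB hF (vsq_jet tp).
  apply: (ip_le sh (hp o)) => x; rewrite /h indicE.
  have [xD|xD] := boolP (x \in ~` D); last by rewrite mul0r normr0.
  rewrite mul1r -[(F - jet p) o x]/(F o x - jet p o x).
  by rewrite (jet_out o tp) ?subr0//; move: xD; rewrite inE.
move=> /(ip_ae0 sh); apply: filterS => x hx Dx.
by move: hx; rewrite /h indicE mem_set// mul1r.
Qed.

(** As [psi] is a test function on the whole space, this is the reason why extension by zero stays
    in H^1(R^d). *)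
Lemma clos_by_parts D F psi i : clos D F -> test_function setT psi ->
  \int[mu]_x (F None x * pderiv i psi x) = - \int[mu]_x (F (Some i) x * psi x).
Proof.
move=> hF tpsi.
(* Chosen so that [sobolev F H] is the defect in the formula, which vanishes for jets of test
   functions. *)
pose H : V := fun o => if o is Some j then (fun x => (j == i)%:R * psi x) else pderiv i psi.
have hH : vsq H.
  move=> [j|] /=; first exact: sqZ (test_sq tpsi).
  exact: test_sq (test_pderiv i tpsi).
have HE G : vsq G -> sobolev G H = ip mu (G None) (pderiv i psi) + ip mu (G (Some i)) psi.
  move=> hG; rewrite /sobolev /dirichlet (bigD1 i)//= big1 ?addr0.
    by congr (_ + _); congr ip; apply/funext => x; rewrite eqxx mul1r.
  move=> j ji; rewrite /ip (_ : (fun x => _) = fun=> 0) ?Rintegral_cst ?mul0r//.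
  by apply/funext => x; rewrite (negbTE ji) mul0r mulr0.
have : sobolev F H = 0.
  apply: (clos_ortho hH _ hF) => phi tp; rewrite (HE _ (vsq_jet tp)) /ip /=.
  by rewrite (integration_by_parts i (test_smooth tp) tpsi) addNr.
by rewrite (HE _ (clos_vsq hF)) => /eqP; rewrite addr_eq0 => /eqP.
Qed.

(* integrate [phi^2 * d_i x_i] by parts *)
Lemma poincare_test D M phi (i : 'I_d) : D `<=` cube d M -> test_function D phi ->
  ip mu phi phi <= 4 * M ^+ 2 * dirichlet (jet phi) (jet phi).
Proof.
move=> DM tp; have sp := test_smooth tp; pose X (x : 'rV[R]_d) : R := x ord0 i.
have sX : smooth X by exact: smooth_coord.
have tpp := testMl sp tp.
have tdp := test_pderiv i tp; have tXp := testMl sX tdp.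
have sXp := test_sq tXp; have sqp := test_sq tp.
have := integration_by_parts i sX tpp.
rewrite (_ : (fun x => pderiv i X x * (phi x * phi x)) = fun x => phi x * phi x); last first.
  by apply/funext => x; rewrite pderiv_coord eqxx mul1r.
rewrite (_ : (fun x => X x * _) = fun x => 2 * ((X x * pderiv i phi x) * phi x)); last first.
  by apply/funext => x; rewrite (pderivM _ _ sp sp); ring.
rewrite RintegralZl//; last exact: sqM.
rewrite -/(ip mu (fun x => X x * pderiv i phi x) phi) -/(ip mu phi phi) => h1.
have h2 : ip mu (fun x => X x * pderiv i phi x) (fun x => X x * pderiv i phi x) <=
    M ^+ 2 * dirichlet (jet phi) (jet phi).
  apply: (@le_trans _ _ (M ^+ 2 * ip mu (pderiv i phi) (pderiv i phi))); last first.
    rewrite ler_wpM2l ?sqr_ge0// /dirichlet (bigD1 i)//= lerDl.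
    by apply: sumr_ge0 => j _; exact: ip_ge0.
  rewrite /ip -RintegralZl//; last by apply: sqM; exact: test_sq tdp.
  apply: le_Rintegral => //; first exact: sqM.
  - by apply: intgZ; apply: sqM; exact: test_sq tdp.
  - move=> x _; have [Dx|Dx] := pselect (D x); last first.
      by rewrite (test_out tdp Dx) !mulr0.
    have := DM _ Dx i; rewrite /X; move: (x ord0 i) (pderiv i phi x) => a b /andP[h3 h4].
    have h5 : 0 <= (M - a) * (M + a) by rewrite mulr_ge0//; lra.
    by have := mulr_ge0 h5 (sqr_ge0 b); lra.
have := ip_ge0 mu (fun x => 2 * (X x * pderiv i phi x) + phi x).
rewrite ip_lin2//; nra.
Qed.

(** The factor 4 of [poincare_test], doubled twice by |a + b|^2 <= 2 |a|^2 + 2 |b|^2 in the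
    approximation of [F] by a test function. *)
Definition poincare_const (M : R) : R := 16 * M ^+ 2.

Lemma poincare D M F (i : 'I_d) : D `<=` cube d M -> clos D F ->
  ip mu (F None) (F None) <= poincare_const M * dirichlet F F.
Proof.
move=> DM [hF hF']; rewrite -subr_le0; set t := _ - _.
rewrite leNgt; apply/negP => t0.
have M2 := sqr_ge0 M.
(* The total factor in front of the approximation error. *)
pose c := 2 + 16 * M ^+ 2; have c0 : 0 < c by rewrite /c; lra.
have e0 : 0 < t / (2 * c) by rewrite divr_gt0// mulr_gt0.
have [p [tp Fp]] := hF' _ e0.
have hp := vsq_jet tp; have hFp := vsqB hF hp.
have hP := dirichlet_semi_inner.
have h1 : ip mu (F None) (F None) <= 2 * ip mu ((F - jet p) None) ((F - jet p) None) + 2 * ip mu p p.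
  have := ip_ge0 mu (fun x => -2 * p x + F None x); have h := hF None; have q := hp None.
  rewrite ip_lin2//.
  have -> : ip mu ((F - jet p) None) ((F - jet p) None) =
     ip mu (fun x => -1 * p x + F None x) (fun x => -1 * p x + F None x).
    by congr ip; apply/funext => x; rewrite mulN1r addrC.
  rewrite ip_lin2//=; lra.
have h2 := poincare_test i DM tp.
have h3 : dirichlet (jet p) (jet p) <=
    2 * dirichlet (F - jet p) (F - jet p) + 2 * dirichlet F F.
  have hN := vsqB hp hF.
  by have := form_sqrD_le hP hN hF; rewrite subrK (form_sqrBC hP hp hF).
have h4 := dirichlet_le_sobolev (F - jet p).
have h5 := ip_le_sobolev (F - jet p) None.
have h6 : t / (2 * c) * c = t / 2 by field; rewrite gt_eqF.
move: h1 h2 h3 h4 h5 h6 Fp t0; rewrite /t /poincare_const /c.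
move: (ip mu (F None) _) (ip mu p p) (dirichlet (jet p) _) (dirichlet F F).
move: (dirichlet (F - _) _) (sobolev _ _) (ip mu _ _) (M ^+ 2) M2 => a b c' m m0 u v w z.
move: (_ / _) => k; nra.
Qed.

(** Riesz representation for the Dirichlet form: by Poincare's inequality it controls the
    functional, and also the Sobolev form, for which [clos D] is complete. *)
Lemma weak_solution_exists D M f (i : 'I_d) : D `<=` cube d M -> sq mu f ->
  exists F, clos D F /\ forall G, clos D G -> dirichlet F G = ip mu f (G None).
Proof.
move=> DM sf; have hP := clos_semi_inner D dirichlet_semi_inner.
have K0 : 0 <= poincare_const M by rewrite /poincare_const mulr_ge0 ?sqr_ge0.
apply: (@riesz _ _ _ _ hP (fun G => ip mu f (G None)) (ip mu f f * poincare_const M)).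
- move=> a u v /clos_vsq hu /clos_vsq hv; rewrite (ipC _ f).
  by rewrite (ipC _ f (u None)) (ipC _ f (v None)); exact: ip_linl.
- move=> v hv; rewrite -mulrA.
  have h := poincare i DM hv.
  apply: le_trans (cauchy_schwarz (ip_semi_inner mu) sf (clos_vsq hv None)) _.
  by rewrite ler_wpM2l// ip_ge0.
- move=> u hu cu; pose c := 1 + poincare_const M.
  have c0 : 0 < c by rewrite ltr_wpDr.
  have sd G : clos D G -> sobolev G G <= c * dirichlet G G.
    by move=> /(poincare i DM); rewrite /sobolev /c mulrDl mul1r addrC lerD2l.
  have [n| |F [hF uF]] := @sobolev_complete u; first exact: clos_vsq (hu n).
    move=> e e0; have [N HN] := cu (e / c) (divr_gt0 e0 c0); exists N => m n Nm Nn.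
    apply: le_trans (sd _ (closB (hu m) (hu n))) _.
    by rewrite mulrC -ler_pdivlMr// HN.
  exists F; split.
    apply: (clos_closed hF) => e e0; have [N HN] := uF e e0.
    exists (u N); split => //.
    by rewrite (form_sqrBC sobolev_semi_inner hF (clos_vsq (hu N))) HN.
  move=> e e0; have [N HN] := uF e e0; exists N => n Nn.
  exact: le_trans (dirichlet_le_sobolev _) (HN n Nn).
Qed.

End jets.

(** * Translation between H^1_0 and jets *)

Section sobolev_bridge.
Context (R : realType) (d : nat).
Local Notation mu := (@lebesgue_rV R d).
Local Notation V := (option 'I_d -> 'rV[R]_d -> R).
Implicit Types (f h phi u v : 'rV[R]_d -> R) (D : set 'rV[R]_d) (F G H : V).

Lemma Lfun2_sq d' (T : measurableType d') (m : {measure set T -> \bar R}) (f : T -> R) :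
  f \in Lfun m 2%:E <-> sq m f.
Proof.
split=> [hf|[mf hf]].
  split; last exact: Lfun2_integrable_sqr.
  by move: hf; rewrite inE => /andP[/[!inE]].
rewrite inE; apply/andP; split; rewrite inE//= /finite_norm unlock /Lnorm.
apply: poweR_lty; rewrite (eq_integral (fun x => (f x ^+ 2)%:E)).
  exact: integrable_lty hf.
by move=> x _; rewrite /= powR_mulrn// real_normK ?num_real.
Qed.

Lemma L2P D f : L2 D f <-> sq mu (f \_ D).
Proof. exact: Lfun2_sq. Qed.

Lemma restrictT f : f \_ setT = f.
Proof. by apply/funext => x; rewrite patchE in_setT. Qed.

Lemma restrict_id D f : (forall x, ~ D x -> f x = 0) -> f \_ D = f.
Proof.
move=> f0; apply/funext => x; rewrite patchE; case: ifPn => // xD.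
by rewrite f0// => Dx; move: xD; rewrite mem_set.
Qed.

Lemma sq_restrict D f : measurable D -> sq mu f -> sq mu (f \_ D).
Proof.
move=> mD hf.
have mI : measurable_fun [set: 'rV[R]_d] (\1_D : 'rV[R]_d -> R) by exact: measurable_indic.
have h := @sqMb _ _ _ mu 1 (\1_D) f mI _ hf.
rewrite (_ : f \_ D = fun x => \1_D x * f x).
  by apply: h => x; rewrite indicE; case: (_ \in _); rewrite ?normr1 ?normr0.
by apply/funext => x; rewrite patchE indicE; case: ifPn => _; rewrite ?mul1r ?mul0r.
Qed.

Lemma Rintegral_restrict D f phi : (forall x, ~ D x -> phi x = 0) ->
  \int[mu]_(x in D) (f x * phi x) = ip mu (f \_ D) phi.
Proof.
move=> p0; rewrite Rintegral_mkcond; congr Rintegral; apply/funext => x.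
rewrite !patchE; case: ifPn => // xD.
by rewrite p0 ?mulr0// => Dx; move: xD; rewrite mem_set.
Qed.

Lemma Rintegral_supp D f phi : (forall x, ~ D x -> phi x = 0) ->
  \int[mu]_(x in D) (f x * phi x) = ip mu f phi.
Proof.
move=> p0; rewrite Rintegral_mkcond; congr Rintegral; apply/funext => x.
rewrite !patchE; case: ifPn => // xD.
by rewrite p0 ?mulr0// => Dx; move: xD; rewrite mem_set.
Qed.

Lemma weak_gradient_unique D u g g' : open D ->
  weak_gradient D u g -> weak_gradient D u g' ->
  forall i, {ae mu, forall x, (g i \_ D) x = (g' i \_ D) x}.
Proof.
move=> oD hg hg' i; have [/L2P sg Eg] := hg i; have [/L2P sg' Eg'] := hg' i.
pose h x := (g i \_ D) x - (g' i \_ D) x.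
have : {ae mu, forall x, D x -> h x = 0}.
  apply: fundamental_lemma => // [|phi tp]; first exact: sqB.
  have := Eg _ tp; rewrite Eg'// => /oppr_inj E.
  have p0 x : ~ D x -> phi x = 0 by exact: test_out tp.
  rewrite !Rintegral_restrict// /ip in E.
  under eq_Rintegral do rewrite /h mulrBl.
  rewrite RintegralB//; try (by apply: sqM => //; exact: test_sq tp).
  by rewrite E subrr.
apply: filterS => x hx; have [Dx|Dx] := pselect (D x).
  by apply/eqP; rewrite -subr_eq0; apply/eqP; exact: hx.
by rewrite !patchE memNset.
Qed.

(** Values outside [D] are arbitrary in [H1 D]; cutting them off turns integrals over [D] into
    integrals over the whole space. *)
Definition restricted_jet D u (g : 'I_d -> 'rV[R]_d -> R) : V :=
  fun o => if o is Some i then g i \_ D else u \_ D.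

Lemma vsq_restricted_jet D u g : L2 D u -> weak_gradient D u g ->
  vsq (restricted_jet D u g).
Proof. by move=> /L2P hu hg [i|] //=; have [/L2P] := hg i. Qed.

Lemma sobolev_ae F G F' G' : vsq F -> vsq G -> vsq F' -> vsq G' ->
  (forall o, {ae mu, forall x, F o x = F' o x}) ->
  (forall o, {ae mu, forall x, G o x = G' o x}) ->
  sobolev F G = sobolev F' G' /\ dirichlet F G = dirichlet F' G'.
Proof.
move=> hF hG hF' hG' FF' GG'.
have E : dirichlet F G = dirichlet F' G' by apply: eq_bigr => i _; exact: ip_ae.
by split => //; rewrite /sobolev E; congr (_ + _); exact: ip_ae.
Qed.

Lemma wgradP D u g : weak_gradient D u g -> weak_gradient D u (wgrad D u).
Proof. by move=> hg; exact: (xgetPex (fun _ _ => 0) (ex_intro _ g hg)). Qed.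

Lemma wgrad_ae D u g i : open D -> weak_gradient D u g ->
  {ae mu, forall x, (wgrad D u i \_ D) x = (g i \_ D) x}.
Proof. by move=> oD hg; apply: weak_gradient_unique (wgradP hg) hg i. Qed.

Lemma Rintegral_sum (I : finType) (f : I -> 'rV[R]_d -> R) :
  (forall i, intg mu (f i)) ->
  \int[mu]_x (\sum_i f i x) = \sum_i \int[mu]_x f i x.
Proof.
move=> hf; rewrite /Rintegral; under eq_integral do rewrite -sumEFin.
rewrite integral_sum//.
rewrite (eq_bigr (fun i => (\int[mu]_x f i x)%:E)) ?sumEFin//.
by move=> i _; rewrite intg_fin.
Qed.

(** [H1norm] is computed from the chosen gradient [wgrad]; by uniqueness almost everywhere, any weak
    gradient gives the same value. *)
Lemma H1norm_jet D u g : open D -> L2 D u -> weak_gradient D u g ->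
  H1norm D u = Num.sqrt (sobolev (restricted_jet D u g) (restricted_jet D u g)).
Proof.
move=> oD hu hg; have hw := wgradP hg; congr Num.sqrt.
have vg := vsq_restricted_jet hu hg; have vw := vsq_restricted_jet hu hw.
have [<- _] := @sobolev_ae (restricted_jet D u (wgrad D u)) (restricted_jet D u (wgrad D u)) _ _
  vw vw vg vg (fun o => match o with
    | Some i => wgrad_ae i oD hg | None => aeW _ (fun=> erefl) end)
  (fun o => match o with
    | Some i => wgrad_ae i oD hg | None => aeW _ (fun=> erefl) end).
rewrite Rintegral_mkcond (_ : _ \_ D = fun x => (u \_ D) x * (u \_ D) x +
  \sum_(i < d) (wgrad D u i \_ D) x * (wgrad D u i \_ D) x); last first.
  apply/funext => x; have [xD|xD] := boolP (x \in D).
    rewrite !patchE xD -expr2; congr (_ + _); apply: eq_bigr => i _.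
    by rewrite patchE xD expr2.
  have E f : (f \_ D) x = 0 by rewrite patchE (negbTE xD).
  by rewrite !E mul0r big1 ?addr0// => i _; rewrite E mul0r.
rewrite RintegralD//; last first.
- by apply: intg_sum => i; exact: sqM (vw (Some i)) (vw (Some i)).
- exact: sqM (vw None) (vw None).
congr (_ + _).
apply: (@Rintegral_sum _ (fun i x => (wgrad D u i \_ D) x * (wgrad D u i \_ D) x)).
by move=> i; exact: sqM (vw (Some i)) (vw (Some i)).
Qed.

Lemma weak_gradientB D u v g g' : L2 D u -> L2 D v ->
  weak_gradient D u g -> weak_gradient D v g' ->
  L2 D (u \- v) /\ weak_gradient D (u \- v) (fun i x => g i x - g' i x).
Proof.
move=> /L2P su /L2P sv hg hg'.
have rB f h : (f \- h) \_ D = (fun x => (f \_ D) x - (h \_ D) x).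
  by apply/funext => x; rewrite !patchE; case: ifPn => // _; rewrite subr0.
split=> [|i]; first by apply/L2P; rewrite rB; exact: sqB.
have [/L2P sg Eg] := hg i; have [/L2P sg' Eg'] := hg' i.
split=> [|phi tp]; first by apply/L2P; rewrite (rB (g i)); exact: sqB.
have := Eg _ tp; have := Eg' _ tp.
have tdp := test_pderiv i tp.
have p0 x : ~ D x -> phi x = 0 by exact: test_out tp.
have q0 x : ~ D x -> pderiv i phi x = 0 by exact: test_out tdp.
rewrite !Rintegral_restrict// rB (rB (g i)) => E' E.
have dist f h k : sq mu f -> sq mu h -> sq mu k ->
    ip mu (fun x => f x - h x) k = ip mu f k - ip mu h k.
  move=> hf hh hk; rewrite /ip; under eq_Rintegral do rewrite mulrBl.
  by rewrite RintegralB//; exact: sqM.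
have sp := test_sq tp; have sdp := test_sq tdp.
by rewrite dist// dist// E E'; ring.
Qed.

(** Used with [E = D] for the problem in [D], and with [E = setT] for the extension by zero. *)
Lemma clos_weak_gradient D E F : D `<=` E -> open E -> clos D F ->
  L2 E (F None) /\ weak_gradient E (F None) (fun i => F (Some i)).
Proof.
move=> DE oE hF; have vF := clos_vsq hF; have mE := measurable_open_rV oE.
split=> [|i]; first by apply/L2P; exact: sq_restrict.
split=> [|phi tp]; first by apply/L2P; exact: sq_restrict.
have tT : test_function setT phi by exact: test_mono tp.
have p0 x : ~ E x -> phi x = 0 by exact: test_out tp.
have q0 x : ~ E x -> pderiv i phi x = 0 by exact: test_out (test_pderiv i tp).
by rewrite !Rintegral_supp//; exact: clos_by_parts hF tT.
Qed.

Lemma clos_H1 D F : clos D F -> H1 setT (F None).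
Proof.
move=> hF; have [h1 h2] := clos_weak_gradient (@subsetT _ D) openT hF.
by split => //; exists (fun i => F (Some i)).
Qed.

Lemma clos_H1norm D F : clos D F -> H1norm setT (F None) = Num.sqrt (sobolev F F).
Proof.
move=> hF; have [h1 h2] := clos_weak_gradient (@subsetT _ D) openT hF.
rewrite (H1norm_jet openT h1 h2); congr (Num.sqrt (sobolev _ _)).
  by apply/funext => -[i|]; rewrite /restricted_jet restrictT.
by apply/funext => -[i|]; rewrite /restricted_jet restrictT.
Qed.

Lemma clos_ae D F G : vsq G -> (forall o, {ae mu, forall x, F o x = G o x}) ->
  clos D F -> clos D G.
Proof.
move=> hG FG [hF hF']; split => // e e0; have [p [tp Fp]] := hF' e e0.
exists p; split => //; have hp := vsq_jet tp.
have FpGp o : {ae mu, forall x, (F - jet p) o x = (G - jet p) o x}.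
  apply: filterS (FG o) => x E.
  by rewrite -[LHS]/(F o x - jet p o x) -[RHS]/(G o x - jet p o x) E.
have [<- _] := sobolev_ae (vsqB hF hp) (vsqB hF hp) (vsqB hG hp) (vsqB hG hp) FpGp FpGp.
by [].
Qed.

(* [H10] asks for vanishing outside [D] everywhere, [clos] only almost everywhere. *)
Definition trim D F : V := fun o => F o \_ D.

Lemma clos_trim_ae D F o : open D -> clos D F ->
  {ae mu, forall x, F o x = trim D F o x}.
Proof.
move=> oD hF; apply: filterS (clos_ae_out o oD hF) => x h.
rewrite /trim patchE; case: ifPn => // xD; apply: h => Dx.
by move: xD; rewrite mem_set.
Qed.

Lemma clos_trim D F : open D -> clos D F -> clos D (trim D F).
Proof.
move=> oD hF; apply: (clos_ae _ _ hF) => k; last exact: clos_trim_ae.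
exact: sq_restrict (measurable_open_rV oD) (clos_vsq hF k).
Qed.

Lemma H10_clos D u : open D -> H10 D u ->
  clos D (restricted_jet D u (wgrad D u)) /\ u \_ D = u.
Proof.
move=> oD [[hu [g hg]] u0 happ]; have hw := wgradP hg.
have vJ := vsq_restricted_jet hu hw; split; last exact: restrict_id.
split => // e e0; have se0 : 0 < Num.sqrt e by rewrite sqrtr_gt0.
have [phi [tp hp]] := happ _ se0; exists phi; split => //.
have [lp wp] := clos_weak_gradient (@subset_refl _ D) oD (clos_jet tp).
have [lup wup] := weak_gradientB hu lp hw wp.
have vJp := vsqB vJ (vsq_jet tp).
have -> : restricted_jet D u (wgrad D u) - jet phi =
    restricted_jet D (u \- phi) (fun i x => wgrad D u i x - pderiv i phi x).
  have rB f h : (forall x, ~ D x -> h x = 0) ->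
      (fun x => (f \_ D) x - h x) = (f \- h) \_ D.
    move=> h0; apply/funext => x; rewrite !patchE; case: ifPn => // xD.
    by rewrite h0 ?subr0// => Dx; move: xD; rewrite mem_set.
  apply/funext => -[i|]; last by apply: rB => x; exact: test_out tp.
  by apply: (rB (wgrad D u i)) => x; exact: test_out (test_pderiv i tp).
move: hp; rewrite (H1norm_jet oD lup wup) => hp.
rewrite -ler_sqrt//; last exact: ltW.
exact: ltW.
Qed.

Lemma clos_H10 D F : open D -> clos D F -> (forall x, ~ D x -> F None x = 0) ->
  H10 D (F None).
Proof.
move=> oD hF F0; have [lF wF] := clos_weak_gradient (@subset_refl _ D) oD hF.
split => //; first by split => //; exists (fun i => F (Some i)).
move=> e e0; have e4 : 0 < e ^+ 2 / 4 by rewrite divr_gt0// exprn_gt0.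
have [phi [tp hp]] := hF.2 _ e4; exists phi; split => //.
have hFp := closB hF (clos_jet tp).
have [lFp wFp] := clos_weak_gradient (@subset_refl _ D) oD hFp.
rewrite (H1norm_jet oD lFp wFp : H1norm D (F None \- phi) = _).
have vr := vsq_restricted_jet lFp wFp; have vFp := clos_vsq hFp.
have ae k : {ae mu, forall x, restricted_jet D ((F - jet phi) None)
    (fun i => (F - jet phi) (Some i)) k x = (F - jet phi) k x}.
  have := clos_trim_ae k oD hFp; apply: filterS => x ->.
  by case: k.
have [-> _] := sobolev_ae vr vr vFp vFp ae ae.
rewrite -[ltRHS](@ger0_norm _ e) ?ltW// -sqrtr_sqr ltr_sqrt ?exprn_gt0//.
by apply: le_lt_trans hp _; rewrite ltr_pdivrMr// ltr_pMr ?exprn_gt0// ltr1n.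
Qed.

Definition weak_solution_jet D f F := clos D F /\
  forall G, clos D G -> dirichlet F G = ip mu f (G None).

Lemma weak_solution_jetP D f F phi : open D -> sq mu f -> H10 D phi ->
  clos D F -> (forall x, ~ D x -> F None x = 0) ->
  \int[mu]_(x in D) (\sum_(i < d) wgrad D (F None) i x * wgrad D phi i x) =
    dirichlet F (restricted_jet D phi (wgrad D phi)) /\
  \int[mu]_(x in D) (f x * phi x) = ip mu f phi.
Proof.
move=> oD sf hphi hF F0; split; last by apply: Rintegral_supp; case: hphi.
have [lF wF] := clos_weak_gradient (@subset_refl _ D) oD hF.
have [hJ _] := H10_clos oD hphi; have vJ := clos_vsq hJ.
have vw := vsq_restricted_jet lF (wgradP wF).
rewrite Rintegral_mkcond (_ : _ \_ D = fun x =>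
  \sum_(i < d) (wgrad D (F None) i \_ D) x * (wgrad D phi i \_ D) x); last first.
  apply/funext => x; have [xD|xD] := boolP (x \in D).
    by rewrite patchE xD; apply: eq_bigr => i _; rewrite !patchE xD.
  have E h : (h \_ D) x = 0 by rewrite patchE (negbTE xD).
  by rewrite E big1// => i _; rewrite E mul0r.
rewrite (@Rintegral_sum _ (fun i x => (wgrad D (F None) i \_ D) x * (wgrad D phi i \_ D) x)).
  apply: eq_bigr => i _; apply: ip_ae.
  - exact: (vw (Some i)).
  - exact: (clos_vsq hF (Some i)).
  - exact: (vJ (Some i)).
  - exact: (vJ (Some i)).
  - apply: filterS2 (wgrad_ae i oD wF) (clos_trim_ae (Some i) oD hF) => x -> ->.
    by [].
  - exact: aeW.
by move=> i; exact: sqM (vw (Some i)) (vJ (Some i)).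
Qed.

(** [solution] is an unspecified weak solution: jets provide one, so the chosen function does solve
    the equation, which is then carried back to jets. The final equality is pointwise because
    elements of [H10] vanish everywhere outside [D]. *)
Lemma solution_jet D M f (i : 'I_d) : open D -> D `<=` cube d M -> sq mu f ->
  exists2 F, weak_solution_jet D f F & F None = solution D f.
Proof.
move=> oD DM sf.
have [F0 [hF0 eF0]] := weak_solution_exists i DM sf.
have tz F x : ~ D x -> trim D F None x = 0 by move=> Dx; rewrite /trim patchE memNset.
have ws : weak_solution D f (trim D F0 None).
  have hF := clos_trim oD hF0.
  split; first exact: clos_H10 oD hF (tz F0).
  move=> phi hphi.
  have [-> ->] := weak_solution_jetP oD sf hphi hF (tz F0).
  have [hJ phiE] := H10_clos oD hphi.
  rewrite -[in RHS]phiE -(eF0 _ hJ).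
  have vF := clos_vsq hF; have vF0 := clos_vsq hF0; have vJ := clos_vsq hJ.
  by have [_ ->] := sobolev_ae vF0 vJ vF vJ (fun k => clos_trim_ae k oD hF0) (fun k => aeW _ (fun=> erefl)).
have [hu hsol] : weak_solution D f (solution D f) := xgetPex (fun=> 0) (ex_intro _ _ ws).
have [hJ uE] := H10_clos oD hu; set F := restricted_jet _ _ _ in hJ.
have FN : F None = solution D f by rewrite /F /= uE.
exists F => //; split => // G hG.
have hG' := clos_trim oD hG.
have HG := clos_H10 oD hG' (tz G).
have hu0 x : ~ D x -> F None x = 0 by rewrite FN; case: hu => _ + _; apply.
have := hsol _ HG; rewrite -FN.
have [-> ->] := weak_solution_jetP oD sf HG hJ hu0.
have [lG wG] := clos_weak_gradient (@subset_refl _ D) oD hG'.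
have vF := clos_vsq hJ; have vG := clos_vsq hG; have vG' := clos_vsq hG'.
have vr := vsq_restricted_jet lG (wgradP wG).
have GG' k : {ae mu, forall x, restricted_jet D (trim D G None) (wgrad D (trim D G None)) k x = G k x}.
  case: k => [k|].
    apply: filterS3 (wgrad_ae k oD wG) (clos_trim_ae (Some k) oD hG') (clos_trim_ae (Some k) oD hG) => x E0 E1 E2.
    by rewrite E2 E1; exact: E0.
  apply: filterS2 (clos_trim_ae None oD hG') (clos_trim_ae None oD hG) => x E1 E2.
  by rewrite E2 E1.
have [_ ->] := sobolev_ae vF vr vF vG (fun k => aeW _ (fun=> erefl)) GG'.
move=> ->; apply: ip_ae; [exact: sf|exact: sf|exact: (vG' None)|exact: (vG None)|exact: aeW|].
by apply: filterS (clos_trim_ae None oD hG) => x ->.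
Qed.

End sobolev_bridge.

(** * A priori estimates *)

Section product_jets.
Context (R : realType) (d : nat).
Local Notation mu := (@lebesgue_rV R d).
Local Notation V := (option 'I_d -> 'rV[R]_d -> R).
Implicit Types (f h phi al : 'rV[R]_d -> R) (D : set 'rV[R]_d) (F G H : V) (C : R).

Definition mulj (al : 'rV[R]_d -> R) F : V := fun o =>
  if o is Some i then fun x => al x * F (Some i) x + pderiv i al x * F None x
  else fun x => al x * F None x.

Definition bounded1 (C : R) (al : 'rV[R]_d -> R) :=
  [/\ smooth al, forall x, `|al x| <= C & forall i x, `|pderiv i al x| <= C].

Lemma mulj_jet al phi : smooth al -> smooth phi ->
  jet (fun x => al x * phi x) = mulj al (jet phi).
Proof.
move=> sa sp; apply/funext => -[i|//]; apply/funext => x.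
by rewrite /= (pderivM _ _ sa sp) addrC.
Qed.

Lemma muljB al F G : mulj al F - mulj al G = mulj al (F - G).
Proof.
apply/funext => -[i|]; apply/funext => x.
  rewrite -[LHS]/(al x * F (Some i) x + pderiv i al x * F None x -
    (al x * G (Some i) x + pderiv i al x * G None x)).
  rewrite -[RHS]/(al x * (F (Some i) x - G (Some i) x) +
    pderiv i al x * (F None x - G None x)); ring.
rewrite -[LHS]/(al x * F None x - al x * G None x).
by rewrite -[RHS]/(al x * (F None x - G None x)) mulrBr.
Qed.

Lemma smooth_measurable al : smooth al -> measurable_fun [set: 'rV[R]_d] al.
Proof. by move=> /smooth_continuous /continuous_measurable_rV. Qed.

Lemma vsq_mulj C al F : bounded1 C al -> vsq F -> vsq (mulj al F).
Proof.
move=> [sa aC daC] hF [i|] /=; last first.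
  exact: sqMb (smooth_measurable sa) aC (hF None).
apply: sqD; first exact: sqMb (smooth_measurable sa) aC (hF (Some i)).
exact: sqMb (smooth_measurable (smooth_pderiv i sa)) (daC i) (hF None).
Qed.

Lemma ip_mulb C al f : measurable_fun [set: 'rV[R]_d] al ->
  (forall x, `|al x| <= C) -> sq mu f ->
  ip mu (fun x => al x * f x) (fun x => al x * f x) <= C ^+ 2 * ip mu f f.
Proof.
move=> ma aC hf; have := @ip_le _ _ _ mu _ _ (sqMb ma aC hf) (sqZ C hf).
have -> : ip mu (fun x => C * f x) (fun x => C * f x) = C ^+ 2 * ip mu f f.
  by rewrite /ip -RintegralZl//; [congr Rintegral; apply/funext => x; ring|exact: sqM].
apply=> x; rewrite !normrM ler_wpM2r//.
by rewrite (le_trans (aC x))// ler_norm.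
Qed.

Lemma ip_sqrD_le f h : sq mu f -> sq mu h ->
  ip mu (fun x => f x + h x) (fun x => f x + h x) <= 2 * ip mu f f + 2 * ip mu h h.
Proof.
move=> hf hh; have := ip_ge0 mu (fun x => -1 * f x + h x).
have -> : (fun x => f x + h x) = (fun x => 1 * f x + h x).
  by apply/funext => x; rewrite mul1r.
rewrite !ip_lin2//; lra.
Qed.

Lemma sobolev_mulj C al F : bounded1 C al -> vsq F ->
  sobolev (mulj al F) (mulj al F) <= (C ^+ 2 * (3 + 2 * d%:R)) * sobolev F F.
Proof.
move=> [sa aC daC] hF; have ma := smooth_measurable sa.
have h0 := ip_mulb ma aC (hF None).
have hd : dirichlet (mulj al F) (mulj al F) <=
    \sum_(i < d) (2 * (C ^+ 2 * ip mu (F (Some i)) (F (Some i))) +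
                  2 * (C ^+ 2 * ip mu (F None) (F None))).
  apply: ler_sum => i _; have mda := smooth_measurable (smooth_pderiv i sa).
  apply: le_trans (ip_sqrD_le (sqMb ma aC (hF (Some i))) (sqMb mda (daC i) (hF None))) _.
  by apply: lerD; apply: ler_wpM2l => //; exact: ip_mulb.
have : dirichlet (mulj al F) (mulj al F) <=
    2 * C ^+ 2 * dirichlet F F + 2 * C ^+ 2 * d%:R * ip mu (F None) (F None).
  apply: le_trans hd _; rewrite big_split /= sumr_const card_ord -mulr_natr.
  rewrite /dirichlet mulr_sumr le_eqVlt; apply/orP; left; apply/eqP; congr (_ + _).
    by apply: eq_bigr => i _; ring.
  by ring.
have d0 := dirichlet_ge0 F; have u0 := ip_ge0 mu (F None).
have C0 := sqr_ge0 C; have n0 : 0 <= d%:R :> R by [].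
have := mulr_ge0 (mulr_ge0 C0 n0) d0; have := mulr_ge0 C0 u0; have := mulr_ge0 C0 d0.
move: h0; rewrite /sobolev -[mulj al F None]/(fun x => al x * F None x).
move: (C ^+ 2) (ip mu (F None) _) (dirichlet F F) => c u v.
by move: (ip mu _ _) (dirichlet _ _) (d%:R : R) => a b k; lra.
Qed.

(** Two sets are allowed because a factor such as [1 - eta], which vanishes near the piece to be
    removed, sends test functions on [D] to test functions on a smaller set. *)
Lemma clos_mulj C al D E F : bounded1 C al ->
  (forall phi, test_function D phi -> test_function E (fun x => al x * phi x)) ->
  clos D F -> clos E (mulj al F).
Proof.
move=> ha DE [hF hF']; have [sa _ _] := ha; split; first exact: vsq_mulj ha hF.
pose K := C ^+ 2 * (3 + 2 * d%:R); have K0 : 0 < K + 1.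
  by rewrite ltr_wpDl// mulr_ge0 ?sqr_ge0// addr_ge0// mulr_ge0.
move=> e e0; have [p [tp hp]] := hF' _ (divr_gt0 e0 K0).
exists (fun x => al x * p x); split; first exact: DE.
rewrite (mulj_jet sa (test_smooth tp)) muljB.
have hFp := vsqB hF (vsq_jet tp).
apply: le_trans (sobolev_mulj ha hFp) _; rewrite -/K.
apply: (@le_trans _ _ ((K + 1) * sobolev (F - jet p) (F - jet p))).
  by rewrite ler_wpM2r ?sobolev_ge0// lerDl.
by rewrite mulrC -ler_pdivlMr.
Qed.

Lemma bounded1_sqr C al : bounded1 C al ->
  bounded1 (C ^+ 2 + 2 * C ^+ 2) (fun x => al x * al x).
Proof.
move=> [sa aC daC]; have C2 := sqr_ge0 C.
have bd a b : `|a| <= C -> `|b| <= C -> `|a * b| <= C ^+ 2.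
  by move=> ha hb; rewrite normrM expr2 ler_pM.
split; first exact: smoothM.
- by move=> x; apply: le_trans (bd _ _ (aC x) (aC x)) _; lra.
- move=> i x; rewrite (pderivM _ _ sa sa).
  have h1 := bd _ _ (daC i x) (aC x); have h2 := bd _ _ (aC x) (daC i x).
  apply: le_trans (ler_normD _ _) _; lra.
Qed.

Lemma dirichlet_sum F G : vsq F -> vsq G ->
  dirichlet F G = \int[mu]_x (\sum_(i < d) F (Some i) x * G (Some i) x).
Proof.
move=> hF hG; rewrite (@Rintegral_sum _ _ _ (fun i x => F (Some i) x * G (Some i) x))//.
by move=> i; exact: sqM (hF (Some i)) (hG (Some i)).
Qed.

(* For a weak solution u, testing with eta^2 u gives
   |grad (eta u)|^2 = grad u . grad (eta^2 u) + u^2 |grad eta|^2. *)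
Lemma energy_cutoff C D f F al : bounded1 C al -> weak_solution_jet D f F ->
  dirichlet (mulj al F) (mulj al F) =
  ip mu f (fun x => al x * al x * F None x) +
  \sum_(i < d) ip mu (fun x => pderiv i al x * F None x) (fun x => pderiv i al x * F None x).
Proof.
move=> ha [hF eF]; have ha2 := bounded1_sqr ha; have [sa aC daC] := ha.
have h2 : clos D (mulj (fun x => al x * al x) F).
  apply: (clos_mulj ha2 _ hF) => phi tp; apply: testMl tp; exact: smoothM.
rewrite -[ip mu f _](eF _ h2) /dirichlet -big_split /=; apply: eq_bigr => i _.
have vF := clos_vsq hF.
have s1 := sqMb (smooth_measurable (smooth_pderiv i sa)) (daC i) (vF None).
have s2 := clos_vsq h2 (Some i).
rewrite /ip -RintegralD//; last 2 first.
- exact: sqM (vF (Some i)) s2.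
- exact: sqM.
congr Rintegral; apply/funext => x /=; rewrite (pderivM _ _ sa sa); ring.
Qed.

End product_jets.

(** * Uniform bounds by comparison *)

Section barrier.
Context (R : realType) (d : nat).
Local Notation mu := (@lebesgue_rV R d).
Local Notation V := (option 'I_d -> 'rV[R]_d -> R).
Implicit Types (f h phi al : 'rV[R]_d -> R) (D : set 'rV[R]_d) (F G H : V) (C : R).

Local Notation theta := (@flat R 1).
Local Notation theta' := (@flat R (flat_next 1)).

Lemma flat_next1E (x : R) : 0 < x -> theta' x = x^-1 ^+ 2 * expR (- x^-1).
Proof.
move=> x0; rewrite /flat x0 /flat_next hornerM hornerXn hornerD hornerN.
by rewrite derivC horner0 subr0 hornerC mulr1.
Qed.

Lemma flat_next1_ge0 (x : R) : 0 <= theta' x.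
Proof.
have [x0|x0] := ltP 0 x; last by rewrite /flat ltNge x0.
by rewrite flat_next1E// mulr_ge0 ?sqr_ge0 ?expR_ge0.
Qed.

(* [exp y = (exp (y/4))^4 >= (1 + y/4)^4 >= y^2] *)
Lemma flat_next1_le1 (x : R) : theta' x <= 1.
Proof.
have [x0|x0] := ltP 0 x; last by rewrite /flat ltNge x0.
rewrite flat_next1E// expRN ler_pdivrMr ?expR_gt0// mul1r.
have y0 : 0 < x^-1 by rewrite invr_gt0.
move: (x^-1) y0 => y y0.
have -> : expR y = expR (y / 4) ^+ 4.
  by rewrite -expRM_natl; congr expR; field.
have h := expR_ge1Dx (y / 4).
have h2 : (1 + y / 4) ^+ 4 <= expR (y / 4) ^+ 4.
  by rewrite lerXn2r// nnegrE; [rewrite addr_ge0// divr_ge0// ltW|exact: expR_ge0].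
apply: le_trans h2; rewrite -[4%N]/(2 * 2)%N exprM.
rewrite lerXn2r ?nnegrE ?sqr_ge0//; first exact: ltW.
have := sqr_ge0 (1 - y / 4); lra.
Qed.

Lemma flat1_continuous : continuous theta.
Proof.
move=> x; apply: differentiable_continuous; apply/derivable1_diffP.
by case: (is_derive_flat 1 x).
Qed.

Lemma flat1_lipschitz (a b : R) : `|theta a - theta b| <= `|a - b|.
Proof.
wlog ab : a b / a <= b.
  move=> H; have [ab|/ltW ab] := leP a b; first exact: H.
  by rewrite distrC (distrC a); exact: H.
have [c _ E] := @MVT_segment R theta theta' a b ab
  (fun x _ => is_derive_flat 1 x) (continuous_subspaceT flat1_continuous).
rewrite distrC E normrM (distrC a) ger0_norm ?flat_next1_ge0//.
by rewrite ler_piMl// flat_next1_le1.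
Qed.

Variables (D : set 'rV[R]_d) (M B : R) (i : 'I_d).
Hypotheses (DM : D `<=` cube d M) (B0 : 0 <= B).

Let X (x : 'rV[R]_d) : R := x ord0 i.
(** [A] and [c] are tuned so that [- z'' = 4 c (A - 3 X^2) = B (3 M^2 + 1 - 3 X^2)], which is at
    least [B] when [|X| <= M]. *)
Let A : R := 3 * M ^+ 2 + 1.
Let c : R := B / 4.
(* [z] satisfies [- z'' >= B] on [D] and is nonnegative on the whole space, so that
   [flat 1 (phi - z)] is a test function on [D] whenever [phi] is. *)
Let w (x : 'rV[R]_d) : R := A - X x * X x.
Let z (x : 'rV[R]_d) : R := c * (w x * w x).
Let zeta (x : 'rV[R]_d) : R := - 4 * c * (X x * w x).

Let sX : smooth X. Proof. exact: smooth_coord. Qed.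
Let sw : smooth w.
Proof. by apply: smoothB; [exact: smooth_cst|exact: smoothM]. Qed.
Let sz : smooth z. Proof. by apply: smoothZ; exact: smoothM. Qed.
Let szeta : smooth zeta. Proof. by apply: smoothZ; exact: smoothM. Qed.

Let dw j x : pderiv j w x = - (2 * (j == i)%:R * X x).
Proof.
rewrite (pderivB _ _ (smooth_cst A) (smoothM sX sX)) pderiv_cst (pderivM _ _ sX sX).
rewrite pderiv_coord; ring.
Qed.

Let dz j x : pderiv j z x = (j == i)%:R * zeta x.
Proof.
rewrite (pderivZ _ _ _ (smoothM sw sw)) (pderivM _ _ sw sw) dw /zeta.
by move: (X x) (w x) c ((j == i)%:R : R) => a b k e; ring.
Qed.

Let dzeta x : pderiv i zeta x = - 4 * c * (A - 3 * X x ^+ 2).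
Proof.
rewrite (pderivZ _ _ _ (smoothM sX sw)) (pderivM _ _ sX sw) dw pderiv_coord eqxx /w.
rewrite -[true%:R]/(1 : R).
by move: (X x) c A => a k e; ring.
Qed.

Let c0 : 0 <= c. Proof. by rewrite divr_ge0. Qed.

Let z0 x : 0 <= z x.
Proof. by rewrite mulr_ge0// -expr2 sqr_ge0. Qed.

Let X2 x : D x -> X x ^+ 2 <= M ^+ 2.
Proof.
move=> Dx; have /andP[h1 h2] := DM Dx i; rewrite /X.
have : 0 <= (M - x ord0 i) * (M + x ord0 i) by rewrite mulr_ge0//; lra.
by lra.
Qed.

Let zeta_le x : D x -> B <= - pderiv i zeta x.
Proof.
by move=> /X2 h; rewrite dzeta; have := mulr_ge0 c0 (_ : 0 <= M ^+ 2 - X x ^+ 2);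
  rewrite subr_ge0 => /(_ h); rewrite /A /c; lra.
Qed.

Definition barrier_const : R := B / 4 * (3 * M ^+ 2 + 1) ^+ 2.

Let z_le x : D x -> z x <= barrier_const.
Proof.
move=> /X2 h; rewrite /z /barrier_const -/c -/A ler_wpM2l// -expr2.
have := sqr_ge0 (X x); have := sqr_ge0 M => h1 h2.
by rewrite lerXn2r ?nnegrE /w /A -?expr2//; lra.
Qed.

Let psi phi x := theta (phi x - z x).

Let tpsi phi : test_function D phi -> test_function D (psi phi).
Proof.
move=> tp; apply: (test_sub _ tp).
  by apply: smooth_comp (smooth1_flat 1) _; apply: smoothB => //; exact: test_smooth tp.
move=> x; rewrite /psi /flat; case: ifP => [h _|_]; last by rewrite eqxx.
by rewrite gt_eqF// (le_lt_trans (z0 x))// -subr_gt0.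
Qed.

Let dpsi phi j x : test_function D phi -> pderiv j (psi phi) x =
  theta' (phi x - z x) * (pderiv j phi x - pderiv j z x).
Proof.
move=> tp; have sp := test_smooth tp.
rewrite (@pderiv_comp _ _ j theta theta' _ _ (is_derive_flat 1) (smoothB sp sz)).
by rewrite (pderivB _ _ sp sz).
Qed.

(** For [phi = F] this would be the usual comparison: testing with [theta (F - z)], where
    [- z'' >= B >= f], makes its gradient vanish. With a test function [phi] instead, the error is
    the product of the gradients of [phi - F] and [psi phi], half of which Young's inequality
    absorbs on the left. *)
Let gradient_psi f F phi e : weak_solution_jet D f F -> sq mu f ->
  (forall x, f x <= B) -> test_function D phi ->
  sobolev (F - jet phi) (F - jet phi) <= e ->
  dirichlet (jet (psi phi)) (jet (psi phi)) <= e.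
Proof.
move=> [hF eF] sf fB tp Fe; have tq := tpsi tp; have vq := vsq_jet tq.
have vp := vsq_jet tp; have vF := clos_vsq hF; have sq_ := test_sq tq.
have tdq := test_pderiv i tq.
have tzq := testMl szeta tdq; have tz'q := testMl (smooth_pderiv i szeta) tq.
(* The equation, [f <= B <= - zeta'] on [D], and an integration by parts. *)
have E1 : dirichlet F (jet (psi phi)) <= \int[mu]_x (zeta x * pderiv i (psi phi) x).
  rewrite (eF _ (clos_jet tq)) (integration_by_parts i szeta tq).
  rewrite -mulN1r -RintegralZl//; last exact: test_intg tz'q.
  apply: le_Rintegral => //; [exact: sqM|exact: intgZ (test_intg tz'q)|].
  move=> x _; rewrite mulN1r -mulNr.
  have [Dx|Dx] := pselect (D x); last by rewrite /= (test_out tq Dx) !mulr0.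
  by rewrite ler_wpM2r ?flat1_ge0// (le_trans (fB x))// zeta_le.
(* Pointwise: the gradient of [psi phi] is [theta'] times that of [phi - z], and
   [theta'^2 <= theta'] as [0 <= theta' <= 1]. *)
have E2 : dirichlet (jet (psi phi)) (jet (psi phi)) <=
    dirichlet (jet phi) (jet (psi phi)) - \int[mu]_x (zeta x * pderiv i (psi phi) x).
  rewrite !dirichlet_sum// -RintegralB//; last 2 first.
  - by apply: intg_sum => j; exact: sqM (vp (Some j)) (vq (Some j)).
  - exact: test_intg tzq.
  apply: le_Rintegral => //.
  - by apply: intg_sum => j; exact: sqM (vq (Some j)) (vq (Some j)).
  - have := intgD (intg_sum (fun j => sqM (vp (Some j)) (vq (Some j)))) (intgZ (-1) (test_intg tzq)).
    by congr intg; apply/funext => x; rewrite mulN1r.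
  move=> x _ /=.
  have -> : zeta x * pderiv i (psi phi) x = \sum_(j < d) pderiv j z x * pderiv j (psi phi) x.
    rewrite (bigD1 i)//= big1 ?addr0; first by rewrite dz eqxx mul1r.
    by move=> j ji; rewrite dz (negbTE ji) !mul0r.
  rewrite -sumrB; apply: ler_sum => j _; rewrite -mulrBl !dpsi//.
  have := flat_next1_ge0 (phi x - z x); have := flat_next1_le1 (phi x - z x).
  move: (theta' _) (pderiv j phi x - _) => t W t1 t0.
  have := mulr_ge0 (mulr_ge0 t0 (_ : 0 <= 1 - t)) (sqr_ge0 W).
  by rewrite subr_ge0 => /(_ t1); lra.
have hP := @dirichlet_semi_inner R d.
have E3 := form_le2 hP (vsqB vp vF) vq.
rewrite (formBl hP)// in E3.
have E4 : dirichlet (jet phi - F) (jet phi - F) = dirichlet (F - jet phi) (F - jet phi).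
  exact: (form_sqrBC hP vp vF).
have E5 := dirichlet_le_sobolev (F - jet phi).
move: E1 E2 E3 Fe E5; rewrite E4.
move: (\int[mu]_x _) (dirichlet F _) (dirichlet (jet phi) _) => I a b.
by move: (dirichlet _ _) (sobolev _ _) (dirichlet _ _) => k s q; lra.
Qed.

(** [theta] is a smooth substitute for the positive part: zero exactly on [s <= 0], nondecreasing
    and 1-Lipschitz. The gradient estimate and Poincare's inequality, with [phi] tending to [F],
    give [theta (F - z) = 0] almost everywhere, that is [F <= z]. *)
Lemma barrier f F : open D -> weak_solution_jet D f F -> sq mu f ->
  (forall x, f x <= B) -> {ae mu, forall x, F None x <= barrier_const}.
Proof.
move=> oD hsol sf fB; have [hF _] := hsol; have vF := clos_vsq hF.
pose Th x := theta (F None x - z x).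
have mTh : measurable_fun [set: 'rV[R]_d] Th.
  apply: (measurableT_comp (continuous_measurable_fun flat1_continuous)).
  by apply: measurable_funB; [exact: (vF None).1|exact: smooth_measurable].
have lip phi x : `|Th x - psi phi x| <= `|F None x - phi x|.
  by apply: le_trans (flat1_lipschitz _ _) _; rewrite opprB addrA subrK.
have sd phi : test_function D phi -> sq mu (fun x => Th x - psi phi x).
  move=> tp; apply: sq_le (lip phi) _; last exact: sqB (vF None) (test_sq tp).
  by apply: measurable_funB => //; exact: (test_sq (tpsi tp)).1.
have sTh : sq mu Th.
  have tp := test0 D; have := sqD (sd _ tp) (test_sq (tpsi tp)).
  by congr sq; apply/funext => x; rewrite subrK.
have M2 : 0 <= M ^+ 2 by exact: sqr_ge0.
have : ip mu Th Th = 0.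
  apply: (@eq0_small _ _ (2 + 8 * M ^+ 2)); [exact: ip_ge0|lra|].
  move=> e e0; have [phi [tp Fe]] := hF.2 e e0; have tq := tpsi tp.
  have h1 := gradient_psi hsol sf fB tp Fe.
  have h2 := poincare_test i DM tq.
  have := ip_sqrD_le (sd _ tp) (test_sq tq).
  rewrite (_ : (fun x => _ - _ + _) = Th); last by apply/funext => x; rewrite subrK.
  have h3 : ip mu (fun x => Th x - psi phi x) (fun x => Th x - psi phi x) <= e.
    apply: le_trans Fe; apply: le_trans (ip_le_sobolev _ None).
    exact: ip_le (sd _ tp) (vsqB vF (vsq_jet tp) None) (lip phi).
  move: h1 h2 h3; move: (ip mu _ _) (dirichlet _ _) (ip mu _ _) (ip mu _ _) => a b k l h1 h2 h3 h4.
  have := mulr_ge0 M2 (_ : 0 <= e - b); rewrite subr_ge0 => /(_ h1); lra.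
move=> /(ip_ae0 sTh) h; apply: filterS2 h (clos_ae_out None oD hF) => x h1 h2.
have [Dx|Dx] := pselect (D x); last by rewrite h2// mulr_ge0 ?sqr_ge0.
apply: le_trans (z_le Dx); rewrite -subr_le0 leNgt -flat1_gt0 -/(Th x) h1.
by rewrite ltxx.
Qed.

End barrier.

(** * Logarithmic cutoffs around planes of codimension two *)

Section step.
Context (R : realType).
Local Notation theta := (@flat R 1).
Local Notation theta' := (@flat R (flat_next 1)).

Lemma flat_le0 q (s : R) : s <= 0 -> flat q s = 0.
Proof. by move=> s0; rewrite /flat ltNge s0. Qed.

Lemma flat1_mono (a b : R) : a <= b -> theta a <= theta b.
Proof.
move=> ab; have [c _ E] := @MVT_segment R theta theta' a b ab
  (fun x _ => is_derive_flat 1 x) (continuous_subspaceT (@flat1_continuous R)).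
by rewrite -subr_ge0 E mulr_ge0 ?subr_ge0// flat_next1_ge0.
Qed.

(** The inner difference equals [theta 1] for [s <= 0] and is nonpositive for [s >= 1]; the outer
    [theta] kills it there, and the factor normalises the value on [s <= 0] to 1. *)
Definition step (s : R) : R := (theta (theta 1))^-1 * theta (theta 1 - theta s).
Definition step' (s : R) : R :=
  (theta (theta 1))^-1 * (theta' (theta 1 - theta s) * - theta' s).

Let k0 : 0 < theta (theta 1).
Proof. by rewrite !flat1_gt0. Qed.

Lemma step_le0 s : s <= 0 -> step s = 1.
Proof.
move=> s0; rewrite /step (flat_le0 1 s0) subr0 mulVf//.
by rewrite gt_eqF.
Qed.

Lemma step_ge0 s : 0 <= step s.
Proof. by rewrite mulr_ge0 ?flat1_ge0// invr_ge0 flat1_ge0. Qed.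

Lemma step_le1 s : step s <= 1.
Proof.
rewrite /step mulrC ler_pdivrMr// mul1r flat1_mono// lerBlDr lerDl.
exact: flat1_ge0.
Qed.

Lemma step_ge1 s : 1 <= s -> step s = 0.
Proof.
move=> /flat1_mono s1; have h : theta 1 - theta s <= 0 by rewrite subr_le0.
by rewrite /step (flat_le0 1 h) mulr0.
Qed.

Lemma step'_supp s : step' s != 0 -> 0 < s < 1.
Proof.
move=> h; apply/andP; split; rewrite ltNge; apply/negP => hs; move: h.
  by rewrite /step' (flat_le0 (flat_next 1) hs) oppr0 !mulr0 eqxx.
have h : theta 1 - theta s <= 0 by rewrite subr_le0 flat1_mono.
by rewrite /step' (flat_le0 (flat_next 1) h) mul0r mulr0 eqxx.
Qed.

Lemma step'_le s : `|step' s| <= (theta (theta 1))^-1.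
Proof.
rewrite /step' normrM ger0_norm ?invr_ge0 ?flat1_ge0// ler_piMr ?invr_ge0 ?flat1_ge0//.
rewrite normrM normrN !ger0_norm ?flat_next1_ge0//.
by rewrite mulr_ile1 ?flat_next1_ge0 ?flat_next1_le1.
Qed.

Lemma is_derive_step s : is_derive s (1 : R) step (step' s).
Proof.
have h1 := is_derive_flat (1 : {poly R}) s.
have h2 : is_derive s (1 : R) (fun s => theta 1 - theta s) (- theta' s).
  have h := is_deriveB (is_derive_cst (theta 1) s (1 : R)) h1.
  by apply: (is_derive_eq h); rewrite sub0r.
have h3 := @is_derive_comp _ _ theta (fun s : R => theta 1 - theta s) s 1 _ _
  (is_derive_flat 1 (theta 1 - theta s)) h2.
have h := is_derive_mul (is_derive_cst (theta (theta 1))^-1 s (1 : R)) h3.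
by apply: (is_derive_eq h); rewrite mul0r add0r.
Qed.

Lemma smooth_step n (q : 'rV[R]_n -> R) : smooth q -> smooth (fun x => step (q x)).
Proof.
move=> sq_; apply: smoothZ; apply: smooth_comp (smooth1_flat 1) _.
apply: smoothB; first exact: smooth_cst.
exact: smooth_comp (smooth1_flat 1) sq_.
Qed.

End step.

(** Bumps at different scales have gradients with disjoint supports. Without cross terms, averaging
    n bumps divides the sum of their energies by n^2. *)
Lemma sqr_sum_disjoint (R : comRingType) (I : finType) (a : I -> R) :
  (forall j k, j != k -> a j * a k = 0) -> (\sum_j a j) ^+ 2 = \sum_j a j ^+ 2.
Proof.
move=> h; rewrite expr2 mulr_suml; apply: eq_bigr => j _.
rewrite mulr_sumr (bigD1 j)//= big1 ?addr0 -?expr2// => k kj.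
by rewrite h// eq_sym.
Qed.

Section cutoff.
Context (R : realType) (d : nat).
Local Notation T := 'rV[R]_d.+2.
Local Notation mu := (@lebesgue_rV R d.+2).
Local Notation i0 := (ord0 : 'I_d.+2).
Local Notation i1 := (lift ord0 ord0 : 'I_d.+2).

Lemma pderiv_sum m (q : 'I_m -> T -> R) i x : (forall j, smooth (q j)) ->
  pderiv i (fun x => \sum_(j < m) q j x) x = \sum_(j < m) pderiv i (q j) x.
Proof.
elim: m q => [|m IH] q sq_.
  rewrite big_ord0 (_ : (fun x => _) = fun=> 0) ?pderiv_cst//.
  by apply/funext => y; rewrite big_ord0.
rewrite big_ord_recl -IH// -pderivD//; last exact: smooth_sum.
by congr pderiv; apply/funext => y; rewrite big_ord_recl.
Qed.

Definition axis_dist2 (a b : R) (x : T) : R :=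
  (x ord0 i0 - a) * (x ord0 i0 - a) + (x ord0 i1 - b) * (x ord0 i1 - b).

Section fixed_axis.
Variables (a b : R).
Local Notation p := (axis_dist2 a b).

Let s0 : smooth (fun x : T => x ord0 i0 - a).
Proof. by apply: smoothB; [exact: smooth_coord|exact: smooth_cst]. Qed.
Let s1 : smooth (fun x : T => x ord0 i1 - b).
Proof. by apply: smoothB; [exact: smooth_coord|exact: smooth_cst]. Qed.

Lemma smooth_axis_dist2 : smooth p.
Proof. by apply: smoothD; apply: smoothM. Qed.

Lemma axis_dist2_ge0 x : 0 <= p x.
Proof. by rewrite /axis_dist2 -!expr2 addr_ge0 ?sqr_ge0. Qed.

Lemma pderiv_axis_dist2 i x : pderiv i p x =
  2 * ((i == i0)%:R * (x ord0 i0 - a) + (i == i1)%:R * (x ord0 i1 - b)).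
Proof.
rewrite (pderivD _ _ (smoothM s0 s0) (smoothM s1 s1)).
rewrite (pderivM _ _ s0 s0) (pderivM _ _ s1 s1).
rewrite (pderivB _ _ (smooth_coord R i0) (smooth_cst a)).
rewrite (pderivB _ _ (smooth_coord R i1) (smooth_cst b)).
rewrite !pderiv_cst !pderiv_coord !subr0.
by move: ((i == i0)%:R : R) ((i == i1)%:R : R) => u v; ring.
Qed.

Lemma gradient_axis_dist2 x : \sum_i pderiv i p x ^+ 2 = 4 * p x.
Proof.
rewrite 2!big_ord_recl big1 => [|i _]; last first.
  by rewrite pderiv_axis_dist2 !mul0r addr0 mulr0 expr0n.
rewrite !pderiv_axis_dist2 /axis_dist2 /=.
by rewrite -[true%:R]/(1 : R) -[false%:R]/(0 : R); ring.
Qed.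

(** Equal to 1 where [p <= t^2] and to 0 where [p >= 2 t^2]; for [t = 2^-j] the regions in between
    are disjoint. *)
Definition bump (t : R) (x : T) : R := step (t ^- 2 * p x - 1).

Lemma smooth_bump t : smooth (bump t).
Proof.
apply: smooth_step; apply: smoothB; last exact: smooth_cst.
apply: smoothZ; exact: smooth_axis_dist2.
Qed.

Lemma pderiv_bump t i x :
  pderiv i (bump t) x = step' (t ^- 2 * p x - 1) * (t ^- 2 * pderiv i p x).
Proof.
have sZ := smoothZ (t ^- 2) smooth_axis_dist2.
rewrite (@pderiv_comp _ _ i (@step R) (@step' R) _ _ (@is_derive_step R)
  (smoothB sZ (smooth_cst 1))).
by rewrite (pderivB _ _ sZ (smooth_cst 1)) pderiv_cst subr0 pderivZ//;
  exact: smooth_axis_dist2.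
Qed.

Let c : R := (flat 1 (flat 1 1))^-1.

Lemma pderiv_bump_neq0 t i x : 0 < t -> pderiv i (bump t) x != 0 ->
  t ^+ 2 < p x < 2 * t ^+ 2.
Proof.
move=> t0; rewrite pderiv_bump mulf_eq0 negb_or => /andP[/step'_supp /andP[h1 h2] _].
have t2 : 0 < t ^+ 2 by rewrite exprn_gt0.
move: h1 h2; rewrite subr_gt0 ltrBlDr mulrC ltr_pdivlMr// mul1r ltr_pdivrMr// => -> h.
by move: h; rewrite -[1 + 1]/(2 : R).
Qed.

Lemma gradient_bump_le t x : 0 < t ->
  \sum_i pderiv i (bump t) x ^+ 2 <= 8 * c ^+ 2 * t ^- 2.
Proof.
move=> t0; have t2 : 0 < t ^+ 2 by rewrite exprn_gt0.
have ti : 0 < t ^- 2 by rewrite invr_gt0.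
have -> : \sum_i pderiv i (bump t) x ^+ 2 =
    step' (t ^- 2 * p x - 1) ^+ 2 * (t ^- 2) ^+ 2 * (4 * p x).
  rewrite -gradient_axis_dist2 mulr_sumr; apply: eq_bigr => i _.
  by rewrite pderiv_bump; move: (t ^- 2) => u; ring.
have := @step'_supp R (t ^- 2 * p x - 1); have := step'_le (t ^- 2 * p x - 1).
rewrite -/c; have [-> _ _|_ hc /(_ isT) /andP[_ h]] := eqVneq (step' (t ^- 2 * p x - 1)) 0.
  rewrite expr0n /= !mul0r; apply: mulr_ge0; last exact: ltW.
  by apply: mulr_ge0 => //; exact: sqr_ge0.
have c2 : step' (t ^- 2 * p x - 1) ^+ 2 <= c ^+ 2.
  by rewrite -(real_normK (num_real (step' _))) lerXn2r ?nnegrE// /c invr_ge0 flat1_ge0.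
have h' : t ^- 2 * p x <= 2 by lra.
have h3 : 0 <= t ^- 2 * p x by rewrite mulr_ge0 ?axis_dist2_ge0// ltW.
move: (step' _ ^+ 2) (sqr_ge0 (step' (t ^- 2 * p x - 1))) c2 => s s20 c2.
have h4 : s * (t ^- 2 * p x) <= c ^+ 2 * 2 by exact: ler_pM.
have := ler_wpM2l (ltW ti) h4; move: (t ^- 2) => u; lra.
Qed.

(** A box, so that its volume is a product. The half-width [2 t] exceeds the radius of the support
    of [bump t], the square root of [2 t^2]. *)
Definition slab M t : set T := [set x | forall k,
  [set` (if k == i0 then `[a - 2 * t, a + 2 * t] else
         if k == i1 then `[b - 2 * t, b + 2 * t] else `[- M, M])%R] (x ord0 k)].

Lemma measurable_slab M t : measurable (slab M t).
Proof.
apply: (@measurable_prod_set R d.+2 (fun k =>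
  [set` (if k == i0 then `[a - 2 * t, a + 2 * t] else
         if k == i1 then `[b - 2 * t, b + 2 * t] else `[- M, M])%R])) => k.
exact: measurable_itv.
Qed.

Lemma lebesgue_slab M t : 0 < M -> 0 < t ->
  mu (slab M t) = (16 * t ^+ 2 * (2 * M) ^+ d)%:E.
Proof.
move=> M0 t0.
rewrite /slab (lebesgue_rV_box (A := fun k =>
  [set` (if k == i0 then `[a - 2 * t, a + 2 * t] else
         if k == i1 then `[b - 2 * t, b + 2 * t] else `[- M, M])%R])); last first.
  by move=> k; exact: measurable_itv.
have len u v : u < v -> lebesgue_measure [set` `[u, v]%R] = (v - u)%:E :> \bar R.
  by move=> uv; rewrite lebesgue_measure_itv /= lte_fin uv.
rewrite 2!big_ord_recl /=.
rewrite (eq_bigr (fun=> (2 * M)%:E)); last first.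
  by move=> k _; rewrite len; [congr EFin; ring|lra].
rewrite !len; [|lra|lra].
rewrite prodEFin prodr_const card_ord -!EFinM.
by congr EFin; ring.
Qed.

Lemma mem_slab M t x : 0 < t -> cube d.+2 M x -> p x <= 2 * t ^+ 2 -> slab M t x.
Proof.
move=> t0 Qx px k /=.
have bd u : u * u <= 2 * t ^+ 2 -> - (2 * t) <= u <= 2 * t.
  move=> h; rewrite -ler_norml -ler_sqr ?nnegrE// ?real_normK ?num_real//; last lra.
  by rewrite expr2; have := sqr_ge0 t; lra.
have q0 := sqr_ge0 (x ord0 i0 - a); have q1 := sqr_ge0 (x ord0 i1 - b).
case: eqVneq => [->|_].
  have /bd /andP[h1 h2] : (x ord0 i0 - a) * (x ord0 i0 - a) <= 2 * t ^+ 2.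
    by move: px; rewrite /axis_dist2; lra.
  by rewrite in_itv /=; apply/andP; split; lra.
case: eqVneq => [->|_].
  have /bd /andP[h1 h2] : (x ord0 i1 - b) * (x ord0 i1 - b) <= 2 * t ^+ 2.
    by move: px; rewrite /axis_dist2; lra.
  by rewrite in_itv /=; apply/andP; split; lra.
by rewrite in_itv /=; exact: Qx.
Qed.

Lemma bump_in_slab M t x : 0 < t -> cube d.+2 M x ->
  bump t x <= \1_(slab M t) x /\
  \sum_i pderiv i (bump t) x ^+ 2 <= 8 * c ^+ 2 * t ^- 2 * \1_(slab M t) x.
Proof.
move=> t0 Qx; have t2 : 0 < t ^+ 2 by rewrite exprn_gt0.
have [px|px] := leP (p x) (2 * t ^+ 2).
  have Sx := mem_slab t0 Qx px; rewrite indicE mem_set// mulr1; split.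
    exact: step_le1.
  exact: gradient_bump_le.
have -> : bump t x = 0.
  apply: step_ge1; rewrite lerBrDr mulrC ler_pdivlMr//.
  by rewrite -[1 + 1]/(2 : R) ltW.
have c0 : 0 <= 8 * c ^+ 2 * t ^- 2.
  apply: mulr_ge0; last by rewrite invr_ge0 ltW.
  by apply: mulr_ge0 => //; exact: sqr_ge0.
split; first by rewrite indicE.
rewrite big1; first by rewrite mulr_ge0// indicE.
move=> i _; have [->|/(pderiv_bump_neq0 t0) /andP[_ h]] := eqVneq (pderiv i (bump t) x) 0.
  by rewrite expr0n.
by move: (lt_trans px h); rewrite ltxx.
Qed.

Let kc s : 0 <= 8 * c ^+ 2 * s ^- 2.
Proof.
apply: mulr_ge0; last by rewrite invr_ge0 sqr_ge0.
by apply: mulr_ge0 => //; exact: sqr_ge0.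
Qed.

Let t (j : nat) : R := 2^-1 ^+ j.
Let t0 j : 0 < t j. Proof. by rewrite exprn_gt0. Qed.

Let t_le m n : (m <= n)%N -> t n <= t m.
Proof. by move=> mn; apply: ler_wiXn2l => //; rewrite invf_le1// ler1n. Qed.

(** Between the extreme scales this is, up to smoothing, an affine function of the logarithm of the
    distance to the axis. *)
Definition log_cutoff n (x : T) : R := n.+1%:R^-1 * \sum_(j < n.+1) bump (t j) x.

Lemma smooth_log_cutoff n : smooth (log_cutoff n).
Proof. by apply: smoothZ; apply: smooth_sum => j; exact: smooth_bump. Qed.

Lemma log_cutoff_ge0 n x : 0 <= log_cutoff n x.
Proof. by rewrite mulr_ge0// sumr_ge0// => j _; exact: step_ge0. Qed.

Lemma log_cutoff_le1 n x : log_cutoff n x <= 1.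
Proof.
rewrite /log_cutoff mulrC ler_pdivrMr// mul1r.
apply: (@le_trans _ _ (\sum_(j < n.+1) 1)).
  by apply: ler_sum => j _; exact: step_le1.
by rewrite sumr_const card_ord.
Qed.

Lemma log_cutoff_eq1 n x : p x <= t n ^+ 2 -> log_cutoff n x = 1.
Proof.
move=> px; rewrite /log_cutoff (eq_bigr (fun=> 1)).
  by rewrite sumr_const card_ord mulVf.
move=> j _; apply: step_le0; rewrite subr_le0 mulrC ler_pdivrMr ?exprn_gt0// mul1r.
apply: le_trans px _; apply: lerXn2r; rewrite ?nnegrE; [exact: ltW|exact: ltW|].
by apply: t_le; rewrite -ltnS.
Qed.

Let disj j k i x : (j < k)%N -> pderiv i (bump (t j)) x * pderiv i (bump (t k)) x = 0.
Proof.
move=> jk; apply/eqP; rewrite mulf_eq0; apply/negPn/negP; rewrite negb_or.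
move=> /andP[/(pderiv_bump_neq0 (t0 j)) /andP[h1 _] /(pderiv_bump_neq0 (t0 k)) /andP[_ h2]].
have := lt_trans h1 h2; apply/negP; rewrite -leNgt.
have tk : t k <= 2^-1 * t j.
  by rewrite -exprS; exact: t_le.
have := t0 j; have := t0 k; nra.
Qed.

Lemma gradient_log_cutoff n x : \sum_i pderiv i (log_cutoff n) x ^+ 2 =
  n.+1%:R ^- 2 * \sum_(j < n.+1) \sum_i pderiv i (bump (t j)) x ^+ 2.
Proof.
rewrite exchange_big mulr_sumr; apply: eq_bigr => i _.
have sb (j : 'I_n.+1) : smooth (bump (t j)) by exact: smooth_bump.
rewrite (pderivZ _ _ _ (smooth_sum _ sb)) (pderiv_sum _ _ sb) exprMn -exprVn.
congr (_ * _); apply: sqr_sum_disjoint => j k jk.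
have [h|h|/val_inj e] := ltngtP j k; first exact: disj.
  by rewrite mulrC disj.
by rewrite e eqxx in jk.
Qed.

Lemma bounded1_log_cutoff n : exists C, bounded1 C (log_cutoff n).
Proof.
pose K : R := n.+1%:R ^- 2 * \sum_(j < n.+1) (8 * c ^+ 2 * t j ^- 2).
have hK x : \sum_i pderiv i (log_cutoff n) x ^+ 2 <= K.
  rewrite gradient_log_cutoff ler_wpM2l ?invr_ge0 ?sqr_ge0//.
  by apply: ler_sum => j _; exact: gradient_bump_le.
(* [K + 1] bounds the values because [K >= 0], and the derivatives because [|q| <= q^2 + 1]. *)
exists (K + 1); split; first exact: smooth_log_cutoff.
- move=> x; rewrite ger0_norm ?log_cutoff_ge0//; apply: le_trans (log_cutoff_le1 n x) _.
  rewrite lerDr; apply: le_trans (hK 0); apply: sumr_ge0 => i _; exact: sqr_ge0.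
- move=> i x; have := hK x; rewrite (bigD1 i)//= => h.
  have h2 : 0 <= \sum_(k < d.+2 | k != i) pderiv k (log_cutoff n) x ^+ 2.
    by apply: sumr_ge0 => k _; exact: sqr_ge0.
  have := sqr_ge0 (`|pderiv i (log_cutoff n) x| - 1).
  have := real_normK (num_real (pderiv i (log_cutoff n) x)).
  have := normr_ge0 (pderiv i (log_cutoff n) x).
  by move: `|_| h h2 => q; nra.
Qed.

(** One explicit step function above both the cutoff and its squared gradient in the cube, so that a
    single integral has to be estimated. *)
Definition cutoff_majorant M n (x : T) : R := \sum_(j < n.+1)
  (n.+1%:R^-1 + n.+1%:R ^- 2 * (8 * c ^+ 2 * t j ^- 2)) * \1_(slab M (t j)) x.

Lemma cutoff_majorantP M n x : cube d.+2 M x ->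
  log_cutoff n x <= cutoff_majorant M n x /\
  \sum_i pderiv i (log_cutoff n) x ^+ 2 <= cutoff_majorant M n x.
Proof.
move=> Qx.
have k0 j : 0 <= n.+1%:R ^- 2 * (8 * c ^+ 2 * t j ^- 2).
  by apply: mulr_ge0 => //; rewrite invr_ge0 sqr_ge0.
have n0 : 0 <= n.+1%:R^-1 :> R by [].
have i0 j : 0 <= \1_(slab M (t j)) x :> R by rewrite indicE.
split.
  rewrite /log_cutoff mulr_sumr; apply: ler_sum => j _.
  have [h _] := bump_in_slab (t0 j) Qx; apply: le_trans (ler_wpM2l n0 h) _.
  by rewrite ler_wpM2r// lerDl.
rewrite gradient_log_cutoff mulr_sumr; apply: ler_sum => j _.
have [_ h] := bump_in_slab (t0 j) Qx.
have n2 : 0 <= n.+1%:R ^- 2 :> R by rewrite invr_ge0 sqr_ge0.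
apply: le_trans (ler_wpM2l n2 h) _.
by rewrite mulrA ler_wpM2r// lerDr.
Qed.

Lemma cutoff_majorant_ge0 M n x : 0 <= cutoff_majorant M n x.
Proof.
apply: sumr_ge0 => j _; rewrite mulr_ge0 ?indicE//.
by rewrite addr_ge0//; apply: mulr_ge0 => //; rewrite invr_ge0 sqr_ge0.
Qed.

Let intg_slab M s : 0 < M -> 0 < s -> intg mu (\1_(slab M s) : T -> R) /\
  \int[mu]_x (\1_(slab M s) x) = 16 * s ^+ 2 * (2 * M) ^+ d.
Proof.
move=> M0 s0'; have mS := measurable_slab M s.
have E : (\int[mu]_x ((\1_(slab M s) x)%:E : \bar R) = (16 * s ^+ 2 * (2 * M) ^+ d)%:E)%E.
  by rewrite integral_indic// setIT; exact: lebesgue_slab.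
split; last by rewrite /Rintegral E.
apply/integrableP; split; first by apply/measurable_EFinP; exact: measurable_indic.
under eq_integral do rewrite /= ger0_norm//.
by rewrite E ltry.
Qed.

Lemma cutoff_majorant_intg M n : 0 < M ->
  intg mu (cutoff_majorant M n) /\
  \int[mu]_x cutoff_majorant M n x <=
    16 * (2 * M) ^+ d * (2 + 8 * c ^+ 2) * n.+1%:R^-1.
Proof.
move=> M0; have ii (j : 'I_n.+1) := (intg_slab M0 (t0 j)).1.
have iZ (j : 'I_n.+1) := intgZ (n.+1%:R^-1 + n.+1%:R ^- 2 * (8 * c ^+ 2 * t j ^- 2)) (ii j).
split; first exact: intg_sum iZ.
rewrite (Rintegral_sum iZ).
rewrite (eq_bigr (fun j : 'I_n.+1 => 16 * (2 * M) ^+ d * n.+1%:R^-1 *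
   (4^-1 ^+ j + 8 * c ^+ 2 * n.+1%:R^-1))); last first.
  move=> j _; have tj : t j != 0 by rewrite gt_eqF.
  rewrite RintegralZl//; last exact: ii.
  rewrite (intg_slab M0 (t0 j)).2.
  have -> : 4^-1 ^+ j = t j ^+ 2 by rewrite /t -exprM mulnC exprM; congr (_ ^+ _); field.
  have n1 : n.+1%:R != 0 :> R by [].
  by move: (n.+1%:R : R) (t j) tj n1 ((2 * M) ^+ d) => N s h1 h2 m; field; rewrite h1 h2.
rewrite -mulr_sumr big_split /= sumr_const card_ord -[X in _ + X]mulr_natr divfK//.
have geo : \sum_(j < n.+1) 4^-1 ^+ j <= 2 :> R.
  have := subrX1 (4^-1 : R) n.+1.
  have : 0 <= 4^-1 ^+ n.+1 :> R by rewrite exprn_ge0.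
  by move: (4^-1 ^+ n.+1) (\sum_(j < n.+1) _) => q S; lra.
rewrite [leRHS]mulrAC ler_wpM2l ?lerD2r//.
apply: mulr_ge0 => //; apply: mulr_ge0 => //.
by rewrite exprn_ge0// mulr_ge0// ltW.
Qed.

End fixed_axis.

(* The measure of a square slab of side [4t] around the axis is of order [t^2],
   which exactly compensates the size [t^-2] of the squared gradient of [bump t]:
   each scale contributes O(1), and averaging n scales gives O(1/n). *)
Lemma codim2_cutoff (M e : R) : 0 < M -> 0 < e ->
  exists2 rho : R, 0 < rho & forall a b, exists eta m C,
    [/\ bounded1 C eta, forall x, 0 <= eta x <= 1,
        forall x, axis_dist2 a b x <= rho -> eta x = 1,
        [/\ intg mu m, forall x, 0 <= m x & \int[mu]_x m x <= e] &
        forall x, cube d.+2 M x ->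
          eta x <= m x /\ \sum_i pderiv i eta x ^+ 2 <= m x].
Proof.
move=> M0 e0; pose c : R := (flat 1 (flat 1 1))^-1.
pose K := 16 * (2 * M) ^+ d * (2 + 8 * c ^+ 2).
have [n Kn] : exists n, K * n.+1%:R^-1 <= e.
  exists (Num.truncn (K / e)); rewrite ler_pdivrMr// mulrC -ler_pdivrMr//.
  exact: ltW (truncnS_gt _).
(* The squared smallest scale, fixed before the axis: the axis will be found only once the two sets
   to be compared are given. *)
exists ((2^-1 ^+ n) ^+ 2); first by rewrite !exprn_gt0.
move=> a b; have [C hC] := bounded1_log_cutoff a b n.
have [im Im] := cutoff_majorant_intg a b n M0.
exists (log_cutoff a b n), (cutoff_majorant a b M n), C; split => //.
- by move=> x; rewrite log_cutoff_ge0 log_cutoff_le1.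
- by move=> x; exact: log_cutoff_eq1.
- split => //; first by move=> x; exact: cutoff_majorant_ge0.
  exact: le_trans Im Kn.
- by move=> x; exact: cutoff_majorantP.
Qed.

End cutoff.

(** * Approximation by bounded data *)

Section truncation.
Context d (T : measurableType d) (R : realType).
Variable mu : {measure set T -> \bar R}.
Implicit Types f g : T -> R.

Lemma le_Rintegral_ae f g : intg mu f -> intg mu g ->
  {ae mu, forall x, f x <= g x} -> \int[mu]_x f x <= \int[mu]_x g x.
Proof.
move=> hf hg fg; rewrite -subr_ge0 -RintegralB//.
have hgf : intg mu (fun x => g x - f x).
  have := intgD hg (intgZ (-1) hf); congr intg.
  by apply/funext => x; rewrite mulN1r.
rewrite (@Rintegral_ae _ _ _ mu _ (fun x => `|g x - f x|))//.
- by apply: Rintegral_ge0 => x _.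
- exact: integrable_norm hgf.
- by apply: filterS fg => x h; rewrite ger0_norm// subr_ge0.
Qed.

Lemma sq_truncation f (e : R) : sq mu f -> 0 < e -> exists B h,
  [/\ 0 <= B, sq mu h, forall x, `|h x| <= B & ip mu (f \- h) (f \- h) <= e].
Proof.
move=> hf e0; have mf := sq_meas hf.
pose A n : set T := [set x | `|f x| <= n%:R].
have mA n : measurable (A n).
  have -> : A n = f @^-1` [set` `[- n%:R, n%:R]%R].
    by apply/seteqP; split => x; rewrite /A /= in_itv /= ler_norml.
  by rewrite -[X in measurable X]setTI; apply: mf => //; exact: measurable_itv.
pose h n x := \1_(A n) x * f x.
have m1 n : measurable_fun [set: T] (\1_(A n) : T -> R) by exact: measurable_indic.
have b1 n x : `|\1_(A n) x : R| <= 1.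
  by rewrite indicE; case: (_ \in _); rewrite ?normr1 ?normr0.
have sh n : sq mu (h n) by exact: (sqMb (m1 n) (b1 n) hf).
have hn n x : `|h n x| <= n%:R.
  rewrite /h indicE; case: (boolP (x \in A n)) => [|_].
    by rewrite inE mul1r.
  by rewrite mul0r normr0.
have fh n : sq mu (f \- h n) by exact: sqB.
have [| | | | |_ _ H] := @dominated_convergence _ _ _ mu setT measurableT
  (fun n x => ((f x - h n x) * (f x - h n x))%:E) (cst 0%E) (fun x => (f x ^+ 2)%:E).
- by move=> n; apply/measurable_EFinP/measurable_funM; exact: (sq_meas (fh n)).
- exact: measurable_cst.
- apply: aeW => x _; apply: cvg_near_cst; near=> n.
  have An : A n x.
    rewrite /A /=; apply: (@le_trans _ _ (Num.truncn `|f x|).+1%:R).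
      exact: ltW (truncnS_gt _).
    rewrite ler_nat; near: n; exact: nbhs_infty_ge.
  by rewrite /h indicE mem_set// mul1r subrr mul0r.
- exact: hf.2.
- apply: aeW => x n _; rewrite lee_fin -expr2 normrX real_normK ?num_real//.
  rewrite /h indicE; case: (_ \in _); last by rewrite mul0r subr0.
  by rewrite mul1r subrr expr0n sqr_ge0.
have {}H : (fun n => ip mu (f \- h n) (f \- h n)) @ \oo --> (0 : R).
  move: H; rewrite integral0 => H.
  exact: (fine_cvg H).
have /cvgrPdist_le /(_ _ e0) [N _ HN] := H.
exists N%:R, (h N); split => //.
by have := HN N (leqnn N); rewrite sub0r normrN ger0_norm// ip_ge0.
Unshelve. all: by end_near. Qed.

End truncation.

(** * Stability of weak solutions *)

Section stability.
Context (R : realType) (d : nat).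
Local Notation mu := (@lebesgue_rV R d).
Local Notation V := (option 'I_d -> 'rV[R]_d -> R).
Implicit Types (f h : 'rV[R]_d -> R) (D U W : set 'rV[R]_d) (F G H : V).

Let dP := @dirichlet_semi_inner R d.

Lemma weak_solutionB D f h F G : sq mu f -> sq mu h ->
  weak_solution_jet D f F -> weak_solution_jet D h G ->
  weak_solution_jet D (f \- h) (F - G).
Proof.
move=> sf sh [hF eF] [hG eG]; split; first exact: closB.
move=> H hH; have vH := clos_vsq hH.
rewrite (formBl dP (clos_vsq hF) (clos_vsq hG) vH) eF// eG//.
by rewrite -(formBl (ip_semi_inner mu) sf sh (vH None)).
Qed.

(** Test the equation with [F] itself, use Cauchy-Schwarz and Poincare, and divide by
    [dirichlet F F]. *)
Lemma weak_solution_dirichlet_le D M f F (i : 'I_d) : D `<=` cube d M -> sq mu f ->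
  weak_solution_jet D f F -> dirichlet F F <= poincare_const M * ip mu f f.
Proof.
move=> DM sf [hF eF]; have P := poincare i DM hF.
have := cauchy_schwarz (ip_semi_inner mu) sf (clos_vsq hF None).
rewrite -(eF _ hF) => h; have K0 : 0 <= poincare_const M.
  by rewrite /poincare_const mulr_ge0 ?sqr_ge0.
have f0 := ip_ge0 mu f; have d0 := dirichlet_ge0 F.
have h2 : dirichlet F F ^+ 2 <= ip mu f f * (poincare_const M * dirichlet F F).
  by apply: le_trans h _; rewrite ler_wpM2l.
have [->|dn0] := eqVneq (dirichlet F F) 0; first by rewrite mulr_ge0.
have dpos : 0 < dirichlet F F by rewrite lt_neqAle eq_sym dn0.
by rewrite -(ler_pM2r dpos) -expr2; apply: le_trans h2 _; rewrite mulrA (mulrC (ip _ _ _)).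
Qed.

Lemma sobolev_le_dirichlet D M F (i : 'I_d) : D `<=` cube d M -> clos D F ->
  sobolev F F <= (1 + poincare_const M) * dirichlet F F.
Proof.
by move=> DM /(poincare i DM); rewrite /sobolev mulrDl mul1r addrC lerD2l.
Qed.

(* Both solutions represent the same functional on [clos U], so [FW - FU] is
   orthogonal to [clos U] and [FU] is the projection of [FW]. *)
Lemma projection_le U W f FU FW H : U `<=` W -> weak_solution_jet U f FU ->
  weak_solution_jet W f FW -> clos U H ->
  dirichlet (FW - FU) (FW - FU) <= dirichlet (FW - H) (FW - H).
Proof.
move=> UW [hU eU] [hW eW] hH.
have vU := clos_vsq hU; have vW := clos_vsq hW; have vH := clos_vsq hH.
have hHU := closB hH hU; have vHU := clos_vsq hHU.
have vWU := vsqB vW vU; have vWH := vsqB vW vH.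
have orth : dirichlet (FW - FU) (H - FU) = 0.
  rewrite (formBl dP)// eU// eW ?subrr//; exact: clos_mono hHU.
have E : dirichlet (FW - FU) (FW - FU) = dirichlet (FW - FU) (FW - H).
  rewrite -[RHS]addr0 -orth -(formDr dP)//.
  by congr dirichlet; rewrite addrA subrK.
have := form_le2 dP vWU vWH; rewrite -E; lra.
Qed.

(** The lower bound is the barrier for [- F], which solves the equation with [- f]. *)
Lemma weak_solution_bounded D M B f F (i : 'I_d) : open D -> D `<=` cube d M ->
  0 <= B -> sq mu f -> (forall x, `|f x| <= B) -> weak_solution_jet D f F ->
  {ae mu, forall x, `|F None x| <= barrier_const M B}.
Proof.
move=> oD DM B0 sf fB hF.
have h1 : {ae mu, forall x, F None x <= barrier_const M B}.
  apply: (barrier i DM B0 oD hF sf) => x.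
  exact: le_trans (ler_norm _) (fB x).
have h0 : weak_solution_jet D (fun=> 0) (0 : V).
  split; first exact: clos0.
  move=> G hG; rewrite (form0l dP (clos_vsq hG)).
  by have := form0l (ip_semi_inner mu) (clos_vsq hG None).
have hN := weak_solutionB (sq0 mu) sf h0 hF.
have h2 : {ae mu, forall x, (0 - F) None x <= barrier_const M B}.
  apply: (barrier i DM B0 oD hN (sqB (sq0 mu) sf)) => x.
  by rewrite /= sub0r (le_trans (ler_norm _))// normrN.
apply: filterS2 h1 h2 => x h1.
rewrite -[(0 - F) None x]/(0 - F None x) => h2.
by rewrite ler_norml h1 andbT; lra.
Qed.

(** With [|f| <= B] and [|F| <= B'], the two terms of [energy_cutoff] are at most the integrals of
    [B B' eta^2], where [eta^2 <= eta <= m], and of [B'^2 |grad eta|^2]. Bounds in the cube suffice,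
    since [F] vanishes outside [D]. *)
Lemma cutoff_dirichlet_le D M B C f F (eta m : 'rV[R]_d -> R) (i : 'I_d) :
  open D -> D `<=` cube d M -> 0 <= B -> sq mu f -> (forall x, `|f x| <= B) ->
  weak_solution_jet D f F -> bounded1 C eta -> (forall x, 0 <= eta x <= 1) ->
  intg mu m -> (forall x, 0 <= m x) ->
  (forall x, cube d M x -> eta x <= m x /\ \sum_i pderiv i eta x ^+ 2 <= m x) ->
  dirichlet (mulj eta F) (mulj eta F) <=
    (B * barrier_const M B + barrier_const M B ^+ 2) * \int[mu]_x m x.
Proof.
move=> oD DM B0 sf fB hsol ha e01 im m0 hm; rewrite (energy_cutoff ha hsol).
have [hF _] := hsol; have vF := clos_vsq hF.
have uB := weak_solution_bounded i oD DM B0 sf fB hsol.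
have u0 := clos_ae_out None oD hF.
have [seta etaC detaC] := ha; have [see eeC deeC] := bounded1_sqr ha.
set B' := barrier_const M B in uB *.
have B'0 : 0 <= B' by rewrite /B' /barrier_const mulr_ge0 ?sqr_ge0// divr_ge0.
clearbody B'.
have s1 : sq mu (fun x => eta x * eta x * F None x).
  exact: sqMb (smooth_measurable see) eeC (vF None).
have s2 k : sq mu (fun x => pderiv k eta x * F None x).
  exact: sqMb (smooth_measurable (smooth_pderiv k seta)) (detaC k) (vF None).
rewrite mulrDl; apply: lerD.
  rewrite -RintegralZl//; apply: le_Rintegral_ae; [exact: sqM|exact: intgZ|].
  apply: filterS2 uB u0 => x uBx u0x.
  have [Dx|Dx] := pselect (D x); last first.
    by rewrite u0x// !mulr0; apply: mulr_ge0 => //; exact: mulr_ge0.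
  have [em _] := hm _ (DM _ Dx); have /andP[e0 e1] := e01 x.
  apply: le_trans (ler_norm _) _; rewrite !normrM -!mulrA; apply: ler_pM => //.
  rewrite (ger0_norm e0) mulrA [leLHS]mulrC; apply: ler_pM => //.
    exact: mulr_ge0.
  by apply: le_trans em; rewrite ler_piMl.
rewrite /ip -(Rintegral_sum (fun k => sqM (s2 k) (s2 k))) -RintegralZl//.
apply: le_Rintegral_ae; [by apply: intg_sum => k; exact: sqM|exact: intgZ|].
apply: filterS2 uB u0 => x uBx u0x.
have -> : \sum_k pderiv k eta x * F None x * (pderiv k eta x * F None x) =
    F None x ^+ 2 * \sum_k pderiv k eta x ^+ 2.
  by rewrite mulr_sumr; apply: eq_bigr => k _; ring.
have [Dx|Dx] := pselect (D x); last first.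
  by rewrite u0x// expr0n mul0r mulr_ge0 ?sqr_ge0.
have [_ dm] := hm _ (DM _ Dx); apply: ler_pM => //; first exact: sqr_ge0.
  by apply: sumr_ge0 => k _; exact: sqr_ge0.
by rewrite -(real_normK (num_real (F None x))) lerXn2r ?nnegrE.
Qed.

End stability.

(** * Adding a piece close to a plane of codimension two *)

Section small_changes.
Context (R : realType) (d : nat).
Local Notation T := 'rV[R]_d.+2.
Local Notation mu := (@lebesgue_rV R d.+2).
Implicit Types (f h : T -> R) (U W : set T).

(** The product is supported in the part of the support of [phi] at squared distance at least [rho]
    from the axis; this part is compact and avoids [W] minus [U]. *)
Lemma test_minus_cutoff U W a b rho (eta phi : T -> R) : U `<=` W ->
  (forall x, W x -> ~ U x -> axis_dist2 a b x < rho) -> smooth eta ->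
  (forall x, axis_dist2 a b x <= rho -> eta x = 1) ->
  test_function W phi -> test_function U (fun x => (1 - eta x) * phi x).
Proof.
move=> UW WU seta eta1 [sp cp pW].
have clA : closed [set x : T | rho <= axis_dist2 a b x].
  have := smooth_continuous (@smooth_axis_dist2 R d a b) => /continuousP /(_ [set y | y < rho]).
  move=> /(_ (@open_lt _ rho)) /open_closedC; congr closed.
  by apply/seteqP; split => x /=; rewrite leNgt => /negP.
apply: (@test_in_compact _ _ _ _ (closure [set x | phi x != 0] `&` [set x | rho <= axis_dist2 a b x])).
- by apply: smoothM => //; apply: smoothB => //; exact: smooth_cst.
- exact: compact_closedI.
- apply: closedI => //; exact: closed_closure.
- move=> x [/pW Wx /= px]; apply: contrapT => Ux.
  by have := WU _ Wx Ux; rewrite ltNge px.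
- move=> x; rewrite mulf_eq0 negb_or => /andP[h1 h2]; split; first exact: subset_closure.
  rewrite /= leNgt; apply/negP => px; move: h1.
  by rewrite eta1 ?subrr ?eqxx// ltW.
Qed.

Lemma small_change_bounded M B f e : 0 < M -> 0 <= B -> sq mu f ->
  (forall x, `|f x| <= B) -> 0 < e ->
  exists2 rho : R, 0 < rho & forall U W FU FW, open U -> open W -> U `<=` W ->
    W `<=` cube d.+2 M ->
    (exists a b, forall x, W x -> ~ U x -> axis_dist2 a b x < rho) ->
    weak_solution_jet U f FU -> weak_solution_jet W f FW ->
    dirichlet (FW - FU) (FW - FU) <= e.
Proof.
move=> M0 B0 sf fB e0.
pose K := B * barrier_const M B + barrier_const M B ^+ 2.
have B'0 : 0 <= barrier_const M B by rewrite /barrier_const mulr_ge0 ?sqr_ge0// divr_ge0.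
have K1 : 0 < K + 1 by rewrite ltr_wpDl// addr_ge0 ?sqr_ge0// mulr_ge0.
have [rho rho0 H] := codim2_cutoff d M0 (divr_gt0 e0 K1).
exists rho => // U W FU FW oU oW UW WM [a [b WU]] hU hW.
have [eta [m [C [ha e01 eta1 [im m0 Im] hm]]]] := H a b.
have [hFW _] := hW; have vW := clos_vsq hFW; have [seta _ _] := ha.
have hD := cutoff_dirichlet_le ord0 oW WM B0 sf fB hW ha e01 im m0 hm.
have hb : bounded1 (1 + C) (fun x => 1 - eta x).
  have [_ etaC detaC] := ha.
  split; first by apply: smoothB => //; exact: smooth_cst.
  - move=> x; apply: le_trans (ler_normB _ _) _.
    by rewrite normr1 lerD2l.
  - move=> i x; rewrite (pderivB _ _ (smooth_cst 1) seta) pderiv_cst sub0r normrN.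
    by apply: le_trans (detaC i x) _; rewrite lerDr.
have hH : clos U (mulj (fun x => 1 - eta x) FW).
  apply: (clos_mulj hb _ hFW) => phi.
  exact: test_minus_cutoff UW WU seta eta1.
have := projection_le UW hU hW hH.
have -> : FW - mulj (fun x => 1 - eta x) FW = mulj eta FW.
  apply/funext => -[i|]; apply/funext => x.
    rewrite -[LHS]/(FW (Some i) x - ((1 - eta x) * FW (Some i) x +
      pderiv i (fun x => 1 - eta x) x * FW None x)).
    rewrite (pderivB _ _ (smooth_cst 1) seta) pderiv_cst /=; ring.
  rewrite -[LHS]/(FW None x - (1 - eta x) * FW None x) /=; ring.
move=> h; apply: le_trans h _; apply: le_trans hD _; rewrite -/K.
have I0 : 0 <= \int[mu]_x m x by apply: Rintegral_ge0.
apply: (@le_trans _ _ ((K + 1) * \int[mu]_x m x)).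
  by rewrite ler_wpM2r// lerDl.
by rewrite mulrC -ler_pdivlMr.
Qed.

Lemma small_change M f e : 0 < M -> sq mu f -> 0 < e ->
  exists2 rho : R, 0 < rho & forall U W FU FW, open U -> open W -> U `<=` W ->
    W `<=` cube d.+2 M ->
    (exists a b, forall x, W x -> ~ U x -> axis_dist2 a b x < rho) ->
    weak_solution_jet U f FU -> weak_solution_jet W f FW ->
    sobolev (FW - FU) (FW - FU) <= e.
Proof.
move=> M0 sf e0; pose K := poincare_const M.
have K0 : 0 <= K by rewrite /K /poincare_const mulr_ge0 ?sqr_ge0.
(* Splitting [FW - FU] into three differences costs [6 K + 4], for which [12 K + 12] leaves room;
   [1 + K] passes from the Dirichlet to the Sobolev form. *)
pose L := (1 + K) * (12 * K + 12); have L0 : 0 < L.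
  by rewrite /L; apply: mulr_gt0; lra.
have eL : 0 < e / L by exact: divr_gt0.
have [B [h [B0 sh hB fh]]] := sq_truncation sf eL.
have [rho rho0 H] := small_change_bounded M0 B0 sh hB eL.
exists rho => // U W FU FW oU oW UW WM WU hU hW.
have UM := subset_trans UW WM.
have [GU hGU] : exists GU, weak_solution_jet U h GU by exact: weak_solution_exists ord0 UM sh.
have [GW hGW] : exists GW, weak_solution_jet W h GW by exact: weak_solution_exists ord0 WM sh.
have h1 := H U W GU GW oU oW UW WM WU hGU hGW.
have dif := weak_solutionB sf sh.
have h2 := weak_solution_dirichlet_le ord0 WM (sqB sf sh) (dif _ _ _ hW hGW).
have h3 := weak_solution_dirichlet_le ord0 UM (sqB sf sh) (dif _ _ _ hU hGU).
have hd := @dirichlet_semi_inner R d.+2.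
have [cU _] := hU; have [cW _] := hW; have [cGU _] := hGU; have [cGW _] := hGW.
have vU := clos_vsq cU; have vW := clos_vsq cW.
have vGU := clos_vsq cGU; have vGW := clos_vsq cGW.
have cWU := closB cW (clos_mono UW cU).
apply: le_trans (sobolev_le_dirichlet ord0 WM cWU) _; rewrite -/K.
have E : FW - FU = (FW - GW) + ((GW - GU) + (GU - FU)).
  by rewrite [RHS]addrA (addrA (FW - GW)) subrK addrA subrK.
have vA := vsqB vW vGW; have vB := vsqB vGW vGU; have vC := vsqB vGU vU.
have h4 := form_sqrD_le hd vA (vsqD vB vC); have h5 := form_sqrD_le hd vB vC.
have h6 : dirichlet (GU - FU) (GU - FU) = dirichlet (FU - GU) (FU - GU).
  exact: (form_sqrBC hd vGU vU).
rewrite -E h6 in h4 h5.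
have h7 : (1 + K) * (12 * K + 12) * (e / L) = e by rewrite mulrC divfK// gt_eqF.
have h8 : K * ip mu (f \- h) (f \- h) <= K * (e / L) by rewrite ler_wpM2l.
rewrite -[X in _ <= X]h7 -mulrA ler_wpM2l//; first by rewrite addr_ge0.
move: h1 h2 h3 h4 h5 h8 (ltW eL); rewrite -/K.
move: (e / L) (K * ip _ _ _) => k p.
move: (dirichlet (GW - GU) _) (dirichlet (FW - GW) _) (dirichlet (FU - GU) _).
move: (dirichlet (FW - FU) _) (dirichlet (GW - GU + (GU - FU)) _) => q r s t w.
have := K0; nra.
Qed.

End small_changes.

(** * The interpolating family *)

Section filtration.
Context (R : realType) (d : nat).
Local Notation T := 'rV[R]_d.+2.
Implicit Types (x y : T) (s t : R).

Definition axis_coord (c : bool) x : R :=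
  x ord0 (if c then lift ord0 ord0 else ord0 : 'I_d.+2).

(** Indices code pairs of a coordinate, first or second, and a rational; an index that codes nothing
    gives a bit independent of [x]. *)
Definition bit (j : nat) x : bool :=
  if unpickle j is Some (c, q) then ratr (q : rat) <= axis_coord c x else false.

(* [digits k x] and [digits k x + 3^-k / 2] bracket the number g(x) whose ternary
   digits are the [bit j x]; g is upper semicontinuous and [level t] is [g < t]. *)
Definition digits (k : nat) x : R := \sum_(j < k) 3 ^- j.+1 * (bit j x)%:R.
Definition upper (k : nat) x : R := digits k x + 3 ^- k / 2.
Definition level t : set T := [set x | exists k, upper k x < t].

Let p3 k : 0 < 3 ^- k :> R.
Proof. by rewrite invr_gt0 exprn_gt0. Qed.

Let p3S k : 3 ^- k = 3 * 3 ^- k.+1 :> R.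
Proof. by rewrite exprS invfM mulrA mulfV ?mul1r. Qed.

Lemma digitsS k x : digits k.+1 x = digits k x + 3 ^- k.+1 * (bit k x)%:R.
Proof. by rewrite /digits big_ord_recr. Qed.

Lemma digits_mono m n x : (m <= n)%N -> digits m x <= digits n x.
Proof.
elim: n => [|n IH]; first by rewrite leqn0 => /eqP ->.
rewrite leq_eqVlt => /predU1P[->//|]; rewrite ltnS => /IH h.
by apply: le_trans h _; rewrite digitsS lerDl mulr_ge0// ltW.
Qed.

(** [3 ^- k / 2] is the sum of all the weights from rank [k] on, the most that later digits can
    add. *)
Lemma upper_anti m n x : (m <= n)%N -> upper n x <= upper m x.
Proof.
elim: n => [|n IH]; first by rewrite leqn0 => /eqP ->.
rewrite leq_eqVlt => /predU1P[->//|]; rewrite ltnS => /IH h.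
apply: le_trans h; rewrite /upper digitsS (p3S n); have := p3 n.+1.
by case: (bit n x); move: (3 ^- n.+1) => q; rewrite ?mulr1 ?mulr0; lra.
Qed.

(** Each bit is 1 on a closed half-space, so a bit that is 0 at [x] remains 0 nearby. *)
Lemma digits_near k x : \forall y \near x, digits k y <= digits k x.
Proof.
have nW (P : T -> Prop) : (forall y, P y) -> \forall y \near x, P y.
  exact: (@nearW _ (nbhs x) _ (nbhs_filter x)).
elim: k => [|k IH]; first by apply: nW => y; rewrite /digits !big_ord0.
have bk : \forall y \near x, bit k y -> bit k x.
  rewrite /bit; case: (unpickle k) => [[c q]|]; last exact: nW.
  have [_|h] := leP (ratr q) (axis_coord c x); first exact: nW.
  have : \forall y \near x, axis_coord c y < ratr q.
    have /continuousP/(_ _ (@open_lt R (ratr q))) op :=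
      @coord_continuous R 1 d.+2 ord0 (if c then lift ord0 ord0 else ord0).
    exact: (open_nbhs_nbhs (conj op h)).
  by apply: filterS => y yq; rewrite leNgt yq.
apply: filterS2 IH bk => y h hb; rewrite !digitsS lerD// ler_wpM2l//.
by case: (bit k y) hb => [/(_ isT) ->|_]; rewrite ?ler0n.
Qed.

Lemma open_level t : open (level t).
Proof.
rewrite openE => x [k xk]; apply: filterS (digits_near k x) => y h.
by exists k; apply: le_lt_trans xk; rewrite /upper lerD2r.
Qed.

Lemma level_mono s t : s <= t -> level s `<=` level t.
Proof. by move=> st x [k xk]; exists k; exact: lt_le_trans st. Qed.

Lemma level_le0 : level 0 = set0.
Proof.
apply/seteqP; split => // x [k]; apply/negP; rewrite -leNgt /upper.
by apply: addr_ge0; [apply: sumr_ge0 => j _; rewrite mulr_ge0|exact: divr_ge0].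
Qed.

Lemma level_1 : level 1 = setT.
Proof.
apply/seteqP; split => // x _; exists 0%N.
by rewrite /upper /digits big_ord0 expr0 invr1 add0r mul1r invf_lt1// ltr1n.
Qed.

(** This is where base 3 with digits 0 and 1 matters: at a first disagreement of rank [j], the digit
    1 adds [3 ^- j.+1], while a digit 0 followed by anything adds at most half of it. The values of
    g then differ by at least [3 ^- j.+1 / 2], whereas in base 2 they could coincide. *)
Lemma bits_agree s t k x y : s - t <= 3 ^- k / 2 ->
  level s x -> ~ level t x -> level s y -> ~ level t y ->
  forall j, (j < k)%N -> bit j x = bit j y.
Proof.
move=> st sx tx sy ty.
have key u v j : level s u -> ~ level t v -> digits j u = digits j v ->
    bit j u -> ~~ bit j v -> (j < k)%N -> False.
  move=> [m um] tv E bu bv jk.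
  have h1 : t <= upper j.+1 v.
    by rewrite leNgt; apply/negP => h; apply: tv; exists j.+1.
  have h2 : digits j.+1 u < s.
    apply: le_lt_trans um; apply: le_trans (upper_anti u (leq_maxl m j.+1)).
    apply: le_trans (digits_mono u (leq_maxr m j.+1)) _.
    by rewrite /upper lerDl divr_ge0// ltW.
  move: h1 h2; rewrite /upper !digitsS bu (negbTE bv) E mulr1 mulr0 addr0 => h1 h2.
  have h3 : 3 ^- k <= 3 ^- j.+1 :> R.
    by rewrite lef_pV2 ?posrE ?exprn_gt0// ler_eXn2l// ltr1n.
  lra.
elim/ltn_ind => j IH jk.
have E : digits j x = digits j y.
  by apply: eq_bigr => i _; rewrite IH// (ltn_trans (ltn_ord i)).
case bx: (bit j x); case byy: (bit j y) => //; exfalso.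
  by apply: (key x y j) => //; rewrite byy.
by apply: (key y x j) => //; rewrite bx.
Qed.

(** Enough bits include the comparisons with all points of a grid of step [1/N <= r] covering the
    cube, in both coordinates. *)
Lemma bits_separate M r : 0 < r -> exists k, forall x y,
  cube d.+2 M x -> cube d.+2 M y ->
  (forall j, (j < k)%N -> bit j x = bit j y) ->
  forall c, `|axis_coord c x - axis_coord c y| <= r.
Proof.
move=> r0; pose n := Num.truncn r^-1; pose N : R := n.+1%:R.
have N0 : 0 < N by rewrite ltr0n.
have Nr : N^-1 <= r by rewrite invf_ple ?posrE// ltW// truncnS_gt.
(* The shift by [L] lets the grid points, including negative ones, be indexed by natural numbers. *)
pose L := (Num.truncn (`|M| * N)).+1.
have ML : `|M| * N < L%:R by exact: truncnS_gt.
pose q (m : nat) : rat := (m%:R - L%:R) / n.+1%:R.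
have qE m : ratr (q m) = (m%:R - L%:R) / N :> R.
  by rewrite /q rmorphM /= rmorphB /= fmorphV /= !ratr_nat.
pose k := (\max_(p : bool * 'I_(L + L).+1) pickle (p.1, q p.2)).+1.
exists k => x y Qx Qy hb c.
wlog xy : x y Qx Qy hb / axis_coord c y <= axis_coord c x.
  move=> H; have [h|/ltW h] := leP (axis_coord c y) (axis_coord c x); first exact: H.
  by rewrite distrC; apply: H => // j jk; rewrite hb.
rewrite ger0_norm ?subr_ge0//; apply: le_trans Nr.
set u := axis_coord c x in xy *; set v := axis_coord c y in xy *.
have /andP[u1 u2] : - `|M| <= u <= `|M|.
  have /andP[h1 h2] := Qx (if c then lift ord0 ord0 else ord0).
  by rewrite (le_trans _ h1) ?(le_trans h2) ?ler_norm// lerN2 ler_norm.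
(* [q m] is the grid point just below [u]. The common bit puts [v] above it too, so [u - v] is at
   most one step. *)
pose m := Num.truncn (u * N + L%:R).
have pos : 0 <= u * N + L%:R.
  have : - `|M| * N <= u * N by rewrite ler_wpM2r// ltW.
  by rewrite mulNr; move: ML; move: (`|M| * N) (u * N) (L%:R : R) => a b l; lra.
have /andP[m1 m2] := truncn_itv pos; rewrite -/m in m1 m2.
have mL : (m < (L + L).+1)%N.
  rewrite ltnS -(ler_nat R) natrD; apply: le_trans m1 _; rewrite lerD2r.
  by apply: le_trans (ltW ML); rewrite ler_wpM2r// ltW.
have bx : bit (pickle (c, q m)) x.
  by rewrite /bit pickleK qE -/u ler_pdivrMr//; lra.
have := hb (pickle (c, q m)); rewrite bx.
have -> : (pickle (c, q m) < k)%N.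
  by rewrite ltnS; apply: (leq_bigmax (c, Ordinal mL)).
move=> /(_ isT) /esym; rewrite /bit pickleK qE -/v ler_pdivrMr// => h.
rewrite -(ler_pM2r N0) mulVf ?gt_eqF// mulrBl.
by move: m2; rewrite -addn1 natrD; lra.
Qed.

(** Points that enter between times [t] and [s] share their leading bits, hence nearly share their
    first two coordinates: the plane through any one of them, [x], serves as axis for all. *)
Lemma level_gap M rho : 0 < rho -> exists2 del : R, 0 < del &
  forall s t, s - t <= del -> forall x y, cube d.+2 M x -> cube d.+2 M y ->
    level s x -> ~ level t x -> level s y -> ~ level t y ->
    axis_dist2 (axis_coord false x) (axis_coord true x) y < rho.
Proof.
(* [r <= 1] gives [r^2 <= r <= rho / 4], without a square root. *)
move=> rho0; pose r := Num.min 1 (rho / 4).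
have r0 : 0 < r by rewrite lt_min ltr01 divr_gt0.
have r1 : r <= 1 by rewrite ge_min lexx.
have r2 : r <= rho / 4 by rewrite ge_min lexx orbT.
have [k hk] := bits_separate M r0.
exists (3 ^- k / 2); first by rewrite divr_gt0.
move=> s t st x y Qx Qy sx tx sy ty.
have hb := bits_agree st sy ty sx tx.
have h0 := hk y x Qy Qx hb false; have h1 := hk y x Qy Qx hb true.
have bd (u : R) : `|u| <= r -> u * u <= rho / 4.
  move=> h; apply: (@le_trans _ _ r) => //.
  by move: h; rewrite ler_norml => /andP[? ?]; nra.
have := bd _ h0; have := bd _ h1; rewrite /axis_dist2 -/(axis_coord false y) -/(axis_coord true y).
move=> h2 h3; apply: (@le_lt_trans _ _ (rho / 4 + rho / 4)); first by rewrite lerD.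
lra.
Qed.

End filtration.

(** * Continuity of the family *)

Section gamma_continuity.
Context (R : realType) (d : nat).
Local Notation T := 'rV[R]_d.+2.
Local Notation mu := (@lebesgue_rV R d.+2).
Variables (Omega0 Omega1 : set T).
Hypotheses (open0 : open Omega0) (open1 : open Omega1).
Hypotheses (bounded1 : bounded_set Omega1) (sub01 : Omega0 `<=` Omega1).

Definition interpolant (t : R) : set T := Omega0 `|` (Omega1 `&` level t).

Lemma open_interpolant t : open (interpolant t).
Proof. by apply: openU => //; apply: openI => //; exact: open_level. Qed.

Lemma interpolant_sub t : interpolant t `<=` Omega1.
Proof. by move=> x [/sub01|[]]. Qed.

Lemma interpolant_mono s t : s <= t -> interpolant s `<=` interpolant t.
Proof. by move=> /level_mono h x [x0|[x1 xs]]; [left|right; split => //; exact: h]. Qed.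

Lemma interpolant_continuous f (t e : R) : sq mu f -> 0 < e ->
  exists2 del : R, 0 < del & forall s F G, `|t - s| <= del ->
    weak_solution_jet (interpolant t) f F -> weak_solution_jet (interpolant s) f G ->
    sobolev (G - F) (G - F) <= e.
Proof.
move=> sf e0; have [M M0 OM] := bounded_sub_cube bounded1.
have [rho rho0 H] := small_change M0 sf e0.
have [del del0 gap] := @level_gap R d M rho rho0.
have IM s : interpolant s `<=` cube d.+2 M by exact: subset_trans (@interpolant_sub s) OM.
have near_axis s u : s <= u -> u - s <= del -> exists a b, forall x,
    interpolant u x -> ~ interpolant s x -> axis_dist2 a b x < rho.
  move=> su us; have [[y [uy sy]]|none] := pselect (exists y, interpolant u y /\ ~ interpolant s y).
    exists (axis_coord false y), (axis_coord true y) => x ux sx.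
    have lev z : interpolant u z -> ~ interpolant s z -> level u z /\ ~ level s z.
      move=> [z0|[z1 zu]] sz; first by exfalso; apply: sz; left.
      by split => // zs; apply: sz; right.
    have [uy' sy'] := lev _ uy sy; have [ux' sx'] := lev _ ux sx.
    by apply: (gap u s) => //; [exact: IM uy|exact: IM ux].
  (* Nothing is added between the two times, and any axis will do. *)
  by exists 0, 0 => x ux sx; exfalso; apply: none; exists x.
exists del => // s F G ts hF hG.
have [cF _] := hF; have [cG _] := hG.
have [st|/ltW st] := leP t s.
  apply: (H _ _ F G (@open_interpolant t) (@open_interpolant s) (interpolant_mono st) (IM s) _ hF hG).
  apply: near_axis => //; apply: le_trans ts; rewrite distrC.
  exact: ler_norm.
rewrite (form_sqrBC (@sobolev_semi_inner R d.+2) (clos_vsq cG) (clos_vsq cF)).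
apply: (H _ _ G F (@open_interpolant s) (@open_interpolant t) (interpolant_mono st) (IM t) _ hG hF).
by apply: near_axis => //; apply: le_trans ts; exact: ler_norm.
Qed.

(** A bounded functional is Lipschitz for the H^1 norm, so the strong continuity just proved implies
    weak convergence. *)
Lemma interpolant_gamma (t : R) (t_ : nat -> R) : t_ n @[n --> \oo] --> t ->
  gamma_cvg (fun n => interpolant (t_ n)) (interpolant t).
Proof.
move=> tt; split.
  exists Omega1; split => //; last by split; [exact: open_interpolant|exact: interpolant_sub].
  by move=> n; split; [exact: open_interpolant|exact: interpolant_sub].
move=> f /L2P; rewrite restrictT => sf.
have [M M0 OM] := bounded_sub_cube bounded1.
have /choice[F HF] : forall s, exists F, weak_solution_jet (interpolant s) f F /\
    F None = solution (interpolant s) f.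
  move=> s; have IM := subset_trans (@interpolant_sub s) OM.
  by have [F hF FE] := solution_jet ord0 (@open_interpolant s) IM sf; exists F.
have cF s : clos Omega1 (F s).
  by have [[h _] _] := HF s; exact: clos_mono (@interpolant_sub s) h.
have FH s : H1 setT (solution (interpolant s) f).
  by have [_ <-] := HF s; exact: clos_H1 (cF s).
split => // L [Llin [C LC]].
apply/cvgrPdist_le => e e0; have C0 : 0 < `|C| + 1 by rewrite ltr_wpDl.
have e1 : 0 < (e / (`|C| + 1)) ^+ 2 by rewrite exprn_gt0// divr_gt0.
have [del del0 hdel] := interpolant_continuous t sf e1.
have /cvgrPdist_le /(_ _ del0) := tt; apply: filterS => n hn.
have [hF FE] := HF t; have [hG GE] := HF (t_ n).
have hs := hdel _ _ _ hn hF hG.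
have cB := closB (cF (t_ n)) (cF t).
(* The shape [a u + v] in which linearity of [L] is stated. *)
have BE : (F (t_ n) - F t) None =
    (-1) \*o solution (interpolant t) f \+ solution (interpolant (t_ n)) f.
  apply/funext => x; rewrite -[LHS]/(F (t_ n) None x - F t None x) FE GE.
  by rewrite /= mulN1r addrC.
have -> : L (solution (interpolant t) f) - L (solution (interpolant (t_ n)) f) =
    - L ((F (t_ n) - F t) None).
  by rewrite BE Llin//; ring.
rewrite normrN; apply: le_trans (LC _ (clos_H1 cB)) _.
rewrite (clos_H1norm cB).
apply: (@le_trans _ _ ((`|C| + 1) * Num.sqrt (sobolev (F (t_ n) - F t) (F (t_ n) - F t)))).
  by rewrite ler_wpM2r ?sqrtr_ge0// (le_trans (ler_norm C))// lerDl.
rewrite mulrC -ler_pdivlMr// -[leRHS]ger0_norm; last by rewrite divr_ge0 ?ltW.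
by rewrite -sqrtr_sqr ler_wsqrtr.
Qed.

End gamma_continuity.

Unset Implicit Arguments.

Theorem theorem3p3 (R : realType) (d : nat) (hd : (2 <= d)%N)
    (Omega0 Omega1 : set 'rV[R]_d)
    (open0 : open Omega0) (bounded0 : bounded_set Omega0)
    (open1 : open Omega1) (bounded1 : bounded_set Omega1)
    (sub01 : Omega0 `<=` Omega1) :
  exists Omega : R -> set 'rV[R]_d,
    [/\ forall t : R, 0 <= t <= 1 -> open (Omega t),
        Omega 0 = Omega0 /\ Omega 1 = Omega1,
        forall s t : R, 0 <= s <= 1 -> 0 <= t <= 1 -> s < t ->
          Omega s `<=` Omega t &
        forall (t : R) (t_ : nat -> R), 0 <= t <= 1 ->
          (forall n, 0 <= t_ n <= 1) -> t_ n @[n --> \oo] --> t ->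
          gamma_cvg (fun n => Omega (t_ n)) (Omega t)].
Proof.
case: d hd Omega0 Omega1 open0 bounded0 open1 bounded1 sub01 => [|[|d]] // _.
move=> Omega0 Omega1 open0 _ open1 bounded1 sub01.
exists (interpolant Omega0 Omega1); split.
- by move=> t _; exact: open_interpolant.
- split; first by rewrite /interpolant level_le0 setI0 setU0.
  by rewrite /interpolant level_1 setIT; apply/setUidPr.
- by move=> s t _ _ /ltW; exact: interpolant_mono.
- by move=> t t_ _ _; exact: interpolant_gamma.
Qed.
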